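(* Let $p,u\ge1$, $q,r,v,s>0$, $0\le\theta\le1$, and $\alpha_1,\alpha_2,\alpha_3,\sigma\in\mathbb{R}$ satisfy $\frac np+\alpha_2>0$, $\frac nu+\alpha_3>0$, $\frac nq+\alpha_1>0$, $\sigma\le\alpha_2\le\sigma+1$, $\alpha_1=\theta\sigma+(1-\theta)\alpha_3$, $\frac nq+\alpha_1=\theta(\frac np+\alpha_2-1)+(\frac nu+\alpha_3)(1-\theta)$ and $\frac1r=\frac\theta s+\frac{1-\theta}v$. Then there is $c>0$ such that $$\|f\|_{\dot K_q^{\alpha_1,r}(\mathbb{R}^n)}\le c\,\|\nabla f\|_{\dot K_p^{\alpha_2,s}(\mathbb{R}^n)}^{\theta}\,\|f\|_{\dot K_u^{\alpha_3,v}(\mathbb{R}^n)}^{1-\theta}\quad\text{for all } f\in C^1(\mathbb{R}^n).$$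
   Context: For $k\in\mathbb{Z}$ let $C_k=\{x\in\mathbb{R}^n: 2^{k-1}\le |x|<2^k\}$ and $\chi_k$ its characteristic function. For $\alpha\in\mathbb{R}$ and $0<p,q\le\infty$, $\|f\|_{\dot K_p^{\alpha,q}(\mathbb{R}^n)}=\big(\sum_{k\in\mathbb{Z}}2^{k\alpha q}\|f\chi_k\|_{L^p}^q\big)^{1/q}$ (usual modification if $q=\infty$); for the gradient, $\|\nabla f\|_{\dot K_p^{\alpha,q}}$ means $\||\nabla f|\|_{\dot K_p^{\alpha,q}}$.
   Formalization: The inequality is proved for those f in C^1 whose norm in K_u^{alpha3,v} is finite; without this it fails, e.g. for theta=1 and f a nonzero constant (left side infinite, right side 0). *)

(* Defs.v *)
From HB Require Import structures.
From mathcomp Require Import all_boot all_order all_algebra.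
From mathcomp Require Import all_classical all_reals all_analysis.

Set Implicit Arguments.
Unset Strict Implicit.
Unset Printing Implicit Defensive.

Import Order.TTheory GRing.Theory Num.Theory.
Import numFieldNormedType.Exports.

Local Open Scope classical_set_scope.
Local Open Scope ring_scope.

Section Herz.
Variable R : realType.

(* Euclidean norm |x| on R^n = 'rV[R]_n (the library norm on matrices is the
   sup norm, so we define the Euclidean one explicitly). *)
Definition enorm (n : nat) (x : 'rV[R]_n) : R :=
  Num.sqrt (\sum_(i < n) (x ord0 i) ^+ 2).

(* Lebesgue integral of a nonnegative function on R^n, defined as the
   iterated one-dimensional Lebesgue integral (Tonelli). *)
Fixpoint iint (n : nat) : ('rV[R]_n -> \bar R) -> \bar R :=
  match n with
  | 0%N => fun g => g 0
  | m.+1 => fun g =>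
      (\int[@lebesgue_measure R]_(t in [set: R])
          iint (fun y : 'rV[R]_m => g (row_mx (\row_(j < 1) t) y)))%E
  end.

Definition annulus (n : nat) (k : int) (x : 'rV[R]_n) : bool :=
  (2 `^ (k%:~R - 1) <= enorm x) && (enorm x < 2 `^ (k%:~R)).

Definition Lp_annulus (n : nat) (p : R) (g : 'rV[R]_n -> R) (k : int) : \bar R :=
  ((iint (fun x => if annulus k x then (`|g x| `^ p)%:E else 0%E)) `^ p^-1)%E.

Definition herz (n : nat) (alpha p q : R) (g : 'rV[R]_n -> R) : \bar R :=
  ((\esum_(k in [set: int])
      ((2 `^ (k%:~R * alpha * q))%:E * (Lp_annulus p g k `^ q)))
    `^ q^-1)%E.

Definition evec (n : nat) (i : 'I_n) : 'rV[R]_n := delta_mx 0 i.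

Definition C1 (n : nat) (f : 'rV[R]_n -> R) : Prop :=
  (forall x, differentiable f x) /\
  (forall i : 'I_n, continuous (fun x => derive f x (evec i))).

Definition grad_norm (n : nat) (f : 'rV[R]_n -> R) (x : 'rV[R]_n) : R :=
  Num.sqrt (\sum_(i < n) (derive f x (evec i)) ^+ 2).

End Herz.

(* Main.v *)
Require Import Defs.
From HB Require Import structures.
From mathcomp Require Import all_boot all_order all_algebra.
From mathcomp Require Import all_classical all_reals all_analysis.
From mathcomp Require Import measurable_realfun.
From mathcomp Require Import ring lra.

(** On the unit cube, the Sobolev inequality in dual form
    int k^(1/n) h <= (int k)^(1/n) int (h + |grad h|), applied to powers of a
    positive function and interpolated by Hoelder, yields a Gagliardo-Nirenberg
    inequality modulo constants, and Poincare's inequality removes the constant at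
    the price of an L^1 term. Covering the annulus C_0 by small cubes and rescaling
    gives, with G_k, A_k, M_k the k-th terms of the three Herz norms and W_k the
    rescaled L^1 norm of f on C_k,
      M_k <= c ((G_(k-1)+G_k+G_(k+1))^theta (A_(k-1)+A_k+A_(k+1))^(1-theta)
                + 2^(k gamma) (W_(k-1)+W_k+W_(k+1))),   gamma = n/q + alpha1.
    Integrating the radial derivative between |x| and 2|x| bounds W_k - W_(k+1) by
    a multiple of 2^(-k delta) (G_k + G_(k+1)), delta = n/p + alpha2 - 1. Fix L large: either W_(k+L) <= W_k / 2, and then W_k is
    controlled by nearby G's as well as by A_k, or one passes to k + L. Since the
    A_k are bounded this stops after some j steps, at a cost 2^j that is beaten by
    the factor 2^(-j L gamma). Summing the geometric series and applying Hoelder's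
    inequality to the sum over k concludes. *)

Set Implicit Arguments.
Unset Strict Implicit.
Unset Printing Implicit Defensive.

Import Order.TTheory GRing.Theory Num.Theory.
Import numFieldNormedType.Exports.

Local Open Scope classical_set_scope.
Local Open Scope ring_scope.

(** The Herz indices enter the local analysis through one number,
    [s1 = 1/p + (alpha2 - sigma - 1)/n]. The two relations on [alpha1] give
    [1/q = theta s1 + (1 - theta)/u], and [sigma <= alpha2 <= sigma + 1] places [s1] between
    [1/p - 1/n] and [1/p], the Sobolev range. But [s1] may be zero or negative, where no space
    L^(1/s1) exists; the inequality then comes from the same Sobolev inequality by absorption at one
    large exponent, and logarithms keep the exponent algebra linear. The global obstacle is the sign
    of [delta], which is arbitrary: the bound of W_k - W_(k+1) cannot simply be summed to infinity
    as for Hardy's inequality. The positivity of [gamma] and of [beta = n/u + alpha3] carries the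
    argument. [L] is chosen with [L gamma >= 2] and [L beta >= 2]: the first turns
    [2^j 2^(-j L gamma)] into at most [2^-j], the second excludes an endless chain of steps without
    halving. Boundedness of the A_k is used only to stop that chain, so the constant does not depend
    on the bound. *)

(** * Sigma-finite products of measures *)

Section ProductMeasure.
Context (R : realType) d1 d2 (T1 : measurableType d1) (T2 : measurableType d2).
Variables (m1 : {sigma_finite_measure set T1 -> \bar R})
          (m2 : {sigma_finite_measure set T2 -> \bar R}).

(** A name of its own for the product measure: the sigma-finite structure proved below attaches to
    it, so that the product can be iterated in [mun]. *)
Definition sfprod : set (T1 * T2) -> \bar R := (m1 \x m2)%E.

HB.instance Definition _ := Measure.on sfprod.

Lemma sfprod_sigma_finite : sigma_finite setT sfprod.
Proof.
have /sigma_finiteP[F [TF ndF Ffin]] := sigma_finiteT m1.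
have /sigma_finiteP[G [TG ndG Gfin]] := sigma_finiteT m2.
exists (fun k => F k `*` G k) => [|k].
  apply/seteqP; split => [[x y] _|//].
  have [i _ Fx] : (\bigcup_k F k) x by rewrite -TF.
  have [j _ Gy] : (\bigcup_k G k) y by rewrite -TG.
  (* Both exhaustions increase, so the point lies in the rectangle of the larger index. *)
  exists (maxn i j) => //; split.
    by move: x Fx; apply/subsetPset/ndF/leq_maxl.
  by move: y Gy; apply/subsetPset/ndG/leq_maxr.
have [mF Fy] := Ffin k; have [mG Gy] := Gfin k.
split; first exact: measurableX.
by rewrite /sfprod product_measure1E// lte_mul_pinfty// ge0_fin_numE.
Qed.

HB.instance Definition _ :=
  Measure_isSigmaFinite.Build _ _ _ sfprod sfprod_sigma_finite.

End ProductMeasure.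

(** * R^n as an iterated product: Tonelli's theorem and affine changes of variable *)

Section Space.
Variable R : realType.

(* R^n as an iterated product, so that Tonelli's theorem applies; [ev] carries
   its points to row vectors. *)
Fixpoint TT (n : nat) : {d : measure_display & measurableType d} :=
  match n with
  | 0%N => existT _ _ (unit : measurableType _)
  | m.+1 => existT _ _ ((measurableTypeR R * projT2 (TT m))%type : measurableType _)
  end.

(** Unfolds to the very term used in the recursion of [iint], so that slices of the two agree by
    conversion. *)
Definition rcons0 n (t : R) (y : 'rV[R]_n) : 'rV[R]_n.+1 :=
  row_mx (\row_(j < 1) t) y.

Lemma rcons0_0 n t (y : 'rV[R]_n) : rcons0 t y ord0 ord0 = t.
Proof.
have -> : ord0 = lshift n ord0 :> 'I_(1 + n) by apply: val_inj.
by have := row_mxEl (\row_(j < 1) t) y ord0 ord0; rewrite mxE.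
Qed.

Lemma rcons0_S n t (y : 'rV[R]_n) j : rcons0 t y ord0 (lift ord0 j) = y ord0 j.
Proof.
have -> : lift ord0 j = rshift 1 j :> 'I_(1 + n) by apply: val_inj.
exact: row_mxEr (\row_(j < 1) t) y ord0 j.
Qed.

Fixpoint ev (n : nat) : projT2 (TT n) -> 'rV[R]_n :=
  match n with
  | 0%N => fun=> 0
  | m.+1 => fun w => rcons0 w.1 (@ev m w.2)
  end.

(** The measure on each factor is a parameter: Lebesgue measure gives integration on R^n, [unif01]
    gives integration over the unit cube. *)
Fixpoint mun (m0 : {sigma_finite_measure set (measurableTypeR R) -> \bar R}) (n : nat) :
    {sigma_finite_measure set (projT2 (TT n)) -> \bar R} :=
  match n return {sigma_finite_measure set (projT2 (TT n)) -> \bar R} with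
  | 0%N => (\d_tt : {sigma_finite_measure set unit -> \bar R})
  | m.+1 => (sfprod m0 (mun m0 m) : {sigma_finite_measure set (measurableTypeR R * projT2 (TT m))%type -> \bar R})
  end.

Lemma continuous_rV (T : topologicalType) n (F : T -> 'rV[R]_n) :
  (forall j, continuous (fun x => F x ord0 j)) -> continuous F.
Proof.
move=> cF x A; case=> P FP PA; rewrite /nbhs /=.
have H : \forall y \near x, forall j, P ord0 j (F y ord0 j).
  apply: filter_forall => j.
  exact: (cF j x _ (FP ord0 j)).
by apply: filterS H => y Py; apply: PA => i j; rewrite (ord1 i).
Qed.

Lemma rcons0_continuousl n (y : 'rV[R]_n) : continuous (fun t => rcons0 t y).
Proof.
apply: continuous_rV => j; case: (unliftP ord0 j) => [k|] ->.
  by under eq_fun do rewrite rcons0_S; move=> x; exact: cvg_cst.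
by under eq_fun do rewrite rcons0_0; move=> x; exact: cvg_id.
Qed.

Lemma rcons0_continuousr n (t : R) : continuous (fun y : 'rV[R]_n => rcons0 t y).
Proof.
apply: continuous_rV => j; case: (unliftP ord0 j) => [k|] ->.
  by under eq_fun do rewrite rcons0_S; exact: coord_continuous.
by under eq_fun do rewrite rcons0_0; exact: cst_continuous.
Qed.

Lemma continuous_slicel n (h : 'rV[R]_n.+1 -> R) (y : 'rV[R]_n) :
  continuous h -> continuous (fun t => h (rcons0 t y)).
Proof.
move=> ch t; apply: (@continuous_comp _ _ _ (fun t => rcons0 t y) h).
  exact: rcons0_continuousl.
exact: ch.
Qed.

Lemma continuous_slicer n (h : 'rV[R]_n.+1 -> R) t :
  continuous h -> continuous (fun y : 'rV[R]_n => h (rcons0 t y)).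
Proof.
move=> ch y; apply: (@continuous_comp _ _ _ (fun y => rcons0 t y) h).
  exact: rcons0_continuousr.
exact: ch.
Qed.

Lemma floor_approx_cvg (t : R) :
  (Num.floor (m.+1%:R * t))%:~R / m.+1%:R @[m --> \oo] --> t.
Proof.
apply/cvgrPdist_lt => e e0; near=> m.
have m0 : 0 < m.+1%:R :> R by rewrite ltr0n.
have me : e^-1 < m.+1%:R.
  near: m; exists (Num.bound e^-1) => // k /= bk.
  apply: (lt_trans (archi_boundP _)); first by rewrite invr_ge0 ltW.
  by rewrite ltr_nat ltnS.
have [l1 l2] : (Num.floor (m.+1%:R * t))%:~R <= m.+1%:R * t /\
   m.+1%:R * t < (Num.floor (m.+1%:R * t))%:~R + 1.
  by split; [exact: floor_le | rewrite -intrD1; exact: floorD1_gt].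
have -> : t - (Num.floor (m.+1%:R * t))%:~R / m.+1%:R =
   (m.+1%:R * t - (Num.floor (m.+1%:R * t))%:~R) / m.+1%:R.
  by rewrite mulrBl [m.+1%:R * t]mulrC mulfK // gt_eqF.
rewrite ger0_norm; last by rewrite divr_ge0 ?subr_ge0 // ltW.
rewrite ltr_pdivrMr // (lt_trans (y := 1)) ?ltrBlDl //.
by rewrite -ltr_pdivrMl // mulr1.
Unshelve. all: by end_near. Qed.

(* A function that is continuous in one variable and measurable in the other
   is jointly measurable: it is the limit of step functions in the first
   variable. *)
Lemma caratheodory_measurable d (T : measurableType d)
    (G : measurableTypeR R * T -> R) :
  (forall y, continuous (fun t : R => G (t, y))) ->
  (forall t, measurable_fun setT (fun y => G (t, y))) ->
  measurable_fun setT G.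
Proof.
move=> cG mG.
pose a (m : nat) (t : R) : R := (Num.floor (m.+1%:R * t))%:~R / m.+1%:R.
apply: (@measurable_fun_cvg _ _ _ _ (fun m w => G (a m w.1, w.2))); last first.
  move=> [t y] _ /=.
  apply: (@cvg_comp _ _ _ (fun m => a m t) (fun s => G (s, y))).
    exact: floor_approx_cvg.
  exact: cG.
move=> m _ B mB; rewrite setTI.
have -> : (fun w => G (a m w.1, w.2)) @^-1` B =
   \bigcup_(z : int) ([set t : R | Num.floor (m.+1%:R * t) == z] `*`
      ((fun y => G (z%:~R / m.+1%:R, y)) @^-1` B)).
  apply/seteqP; split => [[t y] /= Bt|[t y] /= [z _ [/= /eqP <-]]]; last by [].
  by exists (Num.floor (m.+1%:R * t)) => //; split => /=.
apply: countable_bigcupT_measurable => // z.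
apply: measurableX; last by rewrite -[X in measurable X]setTI; exact: mG.
have m0 : 0 < m.+1%:R :> R by rewrite ltr0n.
rewrite (_ : [set t | _] = `[z%:~R / m.+1%:R, (z%:~R + 1) / m.+1%:R[%classic).
  exact: measurable_itv.
apply/seteqP; split => t /=; rewrite in_itv/= ler_pdivrMr // ltr_pdivlMr //.
  move=> /eqP <-; rewrite ![t * _]mulrC floor_le /=.
  by rewrite -intrD1; exact: floorD1_gt.
by move=> H; apply/eqP/floor_def; rewrite intrD1 ![_ * t]mulrC.
Qed.

Lemma continuous_ev_measurable n (h : 'rV[R]_n -> R) :
  continuous h -> measurable_fun setT (fun w => h (@ev n w)).
Proof.
elim: n h => [|n IH] h ch; first by move=> _ B mB; exact: measurable_unit || idtac.
apply: caratheodory_measurable => [y|t]; first exact: (@continuous_slicel n h (ev y) ch).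
exact: (IH (fun y => h (rcons0 t y)) (continuous_slicer ch)).
Qed.

(** Tonelli's theorem, one coordinate at a time. Monotonicity, sums and Hoelder's inequality are
    then available for a single integral instead of nested ones. *)
Lemma iintE n (g : 'rV[R]_n -> \bar R) : (forall x, (0 <= g x)%E) ->
  measurable_fun setT (fun w => g (@ev n w)) ->
  iint g = (\int[mun (@lebesgue_measure R) n]_w g (ev w))%E.
Proof.
elim: n g => [|n IH] g g0 mg.
  by rewrite /= integral_dirac// diracT mul1e.
rewrite /= [RHS]fubini_tonelli1//.
apply: eq_integral => t _; rewrite IH//.
exact: (measurableT_comp mg (pair1_measurable t)).
Qed.


Lemma integral_mun_rec m0 n (g : 'rV[R]_n.+1 -> \bar R) :
  (forall x, (0 <= g x)%E) ->
  measurable_fun setT (fun w => g (@ev n.+1 w)) ->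
  (\int[mun m0 n.+1]_w g (ev w) =
   \int[m0]_t \int[mun m0 n]_w g (rcons0 t (ev w)))%E.
Proof. by move=> g0 mg; rewrite [LHS]fubini_tonelli1. Qed.

Lemma integral_mun_rec2 m0 n (g : 'rV[R]_n.+1 -> \bar R) :
  (forall x, (0 <= g x)%E) ->
  measurable_fun setT (fun w => g (@ev n.+1 w)) ->
  (\int[mun m0 n.+1]_w g (ev w) =
   \int[mun m0 n]_w \int[m0]_t g (rcons0 t (ev w)))%E.
Proof. by move=> g0 mg; rewrite [LHS]fubini_tonelli2. Qed.

Lemma measurable_slicer n (g : 'rV[R]_n.+1 -> \bar R) t :
  measurable_fun setT (fun w => g (@ev n.+1 w)) ->
  measurable_fun setT (fun w => g (rcons0 t (@ev n w))).
Proof. by move=> mg; exact: (measurableT_comp mg (pair1_measurable t)). Qed.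

Lemma measurable_integral_slice m0 n (g : 'rV[R]_n.+1 -> \bar R) :
  (forall x, (0 <= g x)%E) ->
  measurable_fun setT (fun w => g (@ev n.+1 w)) ->
  measurable_fun setT (fun t : measurableTypeR R =>
    \int[mun m0 n]_w g (rcons0 t (ev w)))%E.
Proof.
move=> g0 mg.
exact: (@measurable_fun_fubini_tonelli_F _ _ _ _ _ (mun m0 n)
  (fun w : measurableTypeR R * projT2 (TT n) => g (@ev n.+1 w))).
Qed.

(** By uniqueness of Lebesgue measure: the image measure, multiplied by [l], gives each interval
    []x, y]] its length. *)
Lemma lebesgue_affine (a l : R) : 0 < l -> forall A : set (measurableTypeR R),
  measurable A -> lebesgue_measure A =
    (l%:E * lebesgue_measure ((fun t : R => (a + l * t)%R) @^-1` A))%E.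
Proof.
move=> l0 A mA.
have mphi : measurable_fun [set: measurableTypeR R]
    ((fun t => a + l * t) : R -> measurableTypeR R).
  by apply: measurable_funD => //; exact: measurable_funM.
pose k := NngNum (ltW l0).
pose m' : {measure set (measurableTypeR R) -> \bar R} :=
  mscale k (pushforward (@lebesgue_measure R) ((fun t => a + l * t) : R -> measurableTypeR R)).
pose m := m' mphi.
have -> : (l%:E * lebesgue_measure ((fun t : R => (a + l * t)%R) @^-1` A))%E = m A.
  by [].
apply: lebesgue_measure_unique => // _ [[x y]] _ <-.
rewrite [RHS](_ : _ = (l%:E *
  lebesgue_measure ((fun t : R => (a + l * t)%R) @^-1` `]x, y]%classic))%E)//.
have -> : (fun t : R => a + l * t) @^-1` `]x, y]%classic =
    `](x - a) / l, (y - a) / l]%classic.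
  apply/seteqP; split => t /=; rewrite !in_itv/= ltr_pdivrMr// ler_pdivlMr//;
    by rewrite ltrBlDl lerBrDl [t * l]mulrC.
rewrite !lebesgue_measure_itv /= !lte_fin ltr_pM2r ?invr_gt0// ltrD2r.
case: ifP => _; last by rewrite mule0.
rewrite -!EFinB -EFinM; congr EFin; field; exact: lt0r_neq0.
Qed.

Lemma integral_affine (a l : R) (g : R -> \bar R) : 0 < l ->
  measurable_fun setT g -> (forall x, (0 <= g x)%E) ->
  (\int[@lebesgue_measure R]_t g t =
   l%:E * \int[@lebesgue_measure R]_t g (a + l * t)%R)%E.
Proof.
move=> l0 mg g0.
have mphi : measurable_fun [set: measurableTypeR R]
    ((fun t => a + l * t) : R -> measurableTypeR R).
  by apply: measurable_funD => //; exact: measurable_funM.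
pose k := NngNum (ltW l0).
pose m' : {measure set (measurableTypeR R) -> \bar R} :=
  mscale k (pushforward (@lebesgue_measure R) ((fun t => a + l * t) : R -> measurableTypeR R)).
pose m := m' mphi.
transitivity (\int[m]_t g t)%E.
  by apply: eq_measure_integral => A mA _; exact: lebesgue_affine.
by rewrite ge0_integral_mscale// ge0_integral_pushforward.
Qed.

Lemma iint_affine n (a : 'rV[R]_n) (l : R) (g : 'rV[R]_n -> \bar R) : 0 < l ->
  (forall x, (0 <= g x)%E) ->
  measurable_fun setT (fun w => g (@ev n w)) ->
  iint g = ((l ^+ n)%:E * iint (fun x => g (a + l *: x)%R))%E.
Proof.
move=> l0; elim: n a g => [|n IH] a g g0 mg.
  by rewrite /= expr0 mul1e; congr g; apply/rowP => -[].
pose a0 := a ord0 ord0; pose a' : 'rV[R]_n := \row_j a ord0 (lift ord0 j).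
have aE t y : a + l *: rcons0 t y = rcons0 (a0 + l * t) (a' + l *: y).
  have E m (b x : 'rV[R]_m) k : (b + l *: x) ord0 k = b ord0 k + l * x ord0 k.
    by rewrite !mxE.
  apply/rowP => j; rewrite E.
  by case: (unliftP ord0 j) => [k|] ->; rewrite ?rcons0_S ?rcons0_0 ?E ?mxE.
have gS t : iint (fun y => g (rcons0 t y)) =
    ((l ^+ n)%:E * iint (fun y => g (rcons0 t (a' + l *: y)%R)))%E.
  by rewrite (IH a')//; exact: measurable_slicer.
pose Phi t := iint (fun y => g (rcons0 t y)).
have mPhi : measurable_fun [set: measurableTypeR R] Phi.
  rewrite (_ : Phi = fun t => \int[mun (@lebesgue_measure R) n]_w g (rcons0 t (ev w)))%E.
    exact: measurable_integral_slice.
  by apply/funext => t; apply: iintE => //; exact: measurable_slicer.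
have Phi0 t : (0 <= Phi t)%E.
  rewrite /Phi iintE//; last exact: measurable_slicer.
  exact: integral_ge0.
have PhiE t : Phi t = ((l ^+ n)%:E * iint (fun y => g (rcons0 t (a' + l *: y)%R)))%E.
  exact: gS.
rewrite [LHS](_ : _ = \int[@lebesgue_measure R]_t Phi t)%E//.
rewrite (integral_affine a0 l0)//.
rewrite exprS EFinM -muleA; congr (_ * _)%E.
have ln0 : l ^+ n != 0 by rewrite expf_neq0// gt_eqF.
have -> : (fun t => Phi (a0 + l * t)) = fun t =>
   ((l ^+ n)%:E * iint (fun y => g (a + l *: rcons0 t y)%R))%E.
  by apply/funext => t; rewrite PhiE; under eq_fun do rewrite -aE.
rewrite ge0_integralZl//.
(* Measurability and positivity of the rescaled inner integral are read off [Phi], of which it is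
   the multiple by [l ^- n]. *)
- rewrite (_ : (fun t => _) = fun t => ((l ^- n)%:E * Phi (a0 + l * t)%R)%E).
    apply: measurable_funeM; apply: (measurableT_comp mPhi).
    by apply: measurable_funD => //; exact: measurable_funM.
  apply/funext => t; rewrite PhiE muleA -EFinM mulVf// mul1e.
  by under eq_fun do rewrite aE.
- move=> t _; rewrite (_ : iint _ = ((l ^- n)%:E * Phi (a0 + l * t)%R)%E).
    by rewrite mule_ge0// lee_fin invr_ge0 exprn_ge0// ltW.
  rewrite PhiE muleA -EFinM mulVf// mul1e.
  by under eq_fun do rewrite aE.
- by rewrite lee_fin exprn_ge0// ltW.
Qed.

End Space.

(** * Continuity of real powers and Hoelder's inequality *)

Section PowerHolder.
Variable R : realType.
Implicit Types a b x y : R.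

Lemma powR_norm_continuous a : 0 < a -> continuous (fun x : R => `|x| `^ a).
Proof.
move=> a0 x; have [->|x0] := eqVneq x 0; last first.
  have nx0 : 0 < `|x| by rewrite normr_gt0.
  apply: (@continuous_comp _ _ _ (fun y : R => `|y|) (fun y => y `^ a)).
    exact: norm_continuous.
  apply: differentiable_continuous; apply/derivable1_diffP.
  by apply: derivable_powR; rewrite in_itv/= andbT.
apply/cvgrPdist_lt => e e0; near=> y.
rewrite normr0 powR0 ?gt_eqF// sub0r normrN ger0_norm ?powR_ge0//.
have ye : `|y| < e `^ a^-1.
  near: y; exists (e `^ a^-1) => /=; first exact: powR_gt0.
  by move=> z; rewrite /= sub0r normrN.
have -> : e = (e `^ a^-1) `^ a by rewrite -powRrM mulVf ?gt_eqF// powRr1// ltW.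
by apply: gt0_ltr_powR => //; rewrite nnegrE ?normr_ge0 ?powR_ge0.
Unshelve. all: by end_near. Qed.

(** For positive [a] and [b] this is the usual inequality for [f^a] and [g^b] with exponents [1/a]
    and [1/b]. The endpoints are equalities, because [x^0 = 1] also at [x = 0]; they cover
    [theta = 0] and [theta = 1] later on. *)
Lemma integral_holder d (T : measurableType d) (mu : {measure set T -> \bar R})
    (f g : T -> R) a b :
  0 <= a -> 0 <= b -> a + b = 1 ->
  measurable_fun setT f -> measurable_fun setT g ->
  (forall t, 0 <= f t) -> (forall t, 0 <= g t) ->
  (\int[mu]_x (f x `^ a * g x `^ b)%:E <=
   (\int[mu]_x (f x)%:E) `^ a * (\int[mu]_x (g x)%:E) `^ b)%E.
Proof.
rewrite le_eqVlt => /predU1P[<- _|a0].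
  rewrite add0r => -> mf mg f0 g0.
  under eq_integral do rewrite powRr0 mul1r powRr1//.
  rewrite poweRe0 mul1e poweRe1//; apply: integral_ge0 => x _; exact: g0.
rewrite le_eqVlt => /predU1P[<-|b0].
  rewrite addr0 => -> mf mg f0 g0.
  under eq_integral do rewrite powRr0 mulr1 powRr1//.
  by rewrite poweRe0 mule1 poweRe1//; apply: integral_ge0 => x _; exact: f0.
move=> ab mf mg f0 g0.
have mfa : measurable_fun setT (fun t => f t `^ a).
  exact: (measurableT_comp (measurable_powR _) mf).
have mgb : measurable_fun setT (fun t => g t `^ b).
  exact: (measurableT_comp (measurable_powR _) mg).
have EN (k : T -> R) c : 0 < c -> (forall t, 0 <= k t) ->
    ('N[mu]_(c^-1%:E)[EFin \o (fun t => k t `^ c)%R] = (\int[mu]_t (k t)%:E) `^ c)%E.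
  move=> c0 k0; rewrite Lnorm.unlock invrK; congr poweR.
  apply: eq_integral => t _; rewrite /= ger0_norm ?powR_ge0//.
  by rewrite -powRrM mulfV ?gt_eqF// powRr1.
have E1 : ('N[mu]_1[EFin \o ((fun t => f t `^ a) \* (fun t => g t `^ b))%R] =
    \int[mu]_t (f t `^ a * g t `^ b)%:E)%E.
  rewrite Lnorm.unlock invr1 poweRe1; last first.
    by apply: integral_ge0 => t _; exact: poweR_ge0.
  apply: eq_integral => t _; rewrite poweRe1 ?abse_ge0// gee0_abs//.
  by rewrite lee_fin mulr_ge0 ?powR_ge0.
rewrite -E1 -!EN//; apply: hoelder => //; rewrite ?invr_gt0//.
by rewrite !invrK.
Qed.

End PowerHolder.

(** * Integration over the unit cube *)

Section Cube.
Variable R : realType.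

(** This class is stable under slices, sums, products and nonnegative powers, and it provides
    measurability, positivity and finite integrals on the cube at once. *)
Definition cnn n (h : 'rV[R]_n -> R) := continuous h /\ forall x, 0 <= h x.

Definition slice n (h : 'rV[R]_n.+1 -> R) (t : R) : 'rV[R]_n -> R :=
  fun y => h (rcons0 t y).

Lemma cnn_slice n (h : 'rV[R]_n.+1 -> R) t : cnn h -> cnn (slice h t).
Proof.
by move=> [ch h0]; split=> [|x]; [exact: continuous_slicer | exact: h0].
Qed.

Lemma cnn_cst n (c : R) : 0 <= c -> cnn (fun _ : 'rV[R]_n => c).
Proof. by move=> c0; split => //; exact: cst_continuous. Qed.

Lemma cnnD n (h k : 'rV[R]_n -> R) : cnn h -> cnn k -> cnn (fun x => h x + k x).
Proof.
move=> [ch h0] [ck k0]; split=> [x|x]; last exact: addr_ge0.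
by apply: continuousD; [exact: ch | exact: ck].
Qed.

Lemma cnnM n (h k : 'rV[R]_n -> R) : cnn h -> cnn k -> cnn (fun x => h x * k x).
Proof.
move=> [ch h0] [ck k0]; split=> [x|x]; last exact: mulr_ge0.
by apply: continuousM; [exact: ch | exact: ck].
Qed.

Lemma cnnZ n (h : 'rV[R]_n -> R) c : 0 <= c -> cnn h -> cnn (fun x => c * h x).
Proof. by move=> c0; apply: cnnM; exact: cnn_cst. Qed.

Lemma cnn_norm n (h : 'rV[R]_n -> R) : continuous h -> cnn (fun x => `|h x|).
Proof.
move=> ch; split=> // x.
by apply: (@continuous_comp _ _ _ h); [exact: ch | exact: norm_continuous].
Qed.

Lemma cnn_powR n (h : 'rV[R]_n -> R) a : 0 <= a -> cnn h -> cnn (fun x => h x `^ a).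
Proof.
rewrite le_eqVlt => /predU1P[<- _|a0 [ch h0]].
  by under eq_fun do rewrite powRr0; exact: cnn_cst.
split=> [x|x]; last exact: powR_ge0.
rewrite (_ : (fun _ => _) = (fun y => `|y| `^ a) \o h); last first.
  by apply/funext => y /=; rewrite ger0_norm.
apply: continuous_comp; first exact: ch.
exact: powR_norm_continuous.
Qed.

(** A probability on the whole line, so that an integral over the cube needs no domain of
    integration and constants integrate to themselves. *)
Definition unif01 : {sigma_finite_measure set (measurableTypeR R) -> \bar R} :=
  uniform_prob (@ltr01 R).

Definition cubeint n (h : 'rV[R]_n -> R) : \bar R :=
  (\int[mun unif01 n]_w (h (ev w))%:E)%E.

Definition cube n : set 'rV[R]_n := [set x | forall j, 0 <= x ord0 j <= 1].

Lemma cube_rcons0 n t (y : 'rV[R]_n) : 0 <= t <= 1 -> cube y -> cube (rcons0 t y).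
Proof.
move=> t01 cy j; case: (unliftP ord0 j) => [k|] ->.
  by rewrite rcons0_S; exact: cy.
by rewrite rcons0_0.
Qed.

Lemma cnn_measurable n (h : 'rV[R]_n -> R) : cnn h ->
  measurable_fun setT (fun w => (h (@ev R n w))%:E).
Proof. by move=> [ch _]; exact/measurable_EFinP/continuous_ev_measurable. Qed.

Lemma integral_unif01 (f : R -> \bar R) : measurable_fun setT f ->
  (forall x, (0 <= f x)%E) ->
  (\int[unif01]_t f t = \int[@lebesgue_measure R]_(t in `[0%R, 1%R]) f t)%E.
Proof. by move=> mf f0; rewrite integral_uniform// subr0 invr1 mul1e. Qed.

Lemma lebesgue_measure01 : (@lebesgue_measure R `[0%R, 1%R]%classic = 1)%E.
Proof. by rewrite lebesgue_measure_itv/= lte_fin ltr01 sube0. Qed.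

Lemma cubeint_ge0 n (h : 'rV[R]_n -> R) : cnn h -> (0 <= cubeint h)%E.
Proof. by move=> [_ h0]; apply: integral_ge0 => w _; rewrite lee_fin. Qed.

Lemma cubeint_slice_measurable n (h : 'rV[R]_n.+1 -> R) : cnn h ->
  measurable_fun [set: R] (fun t => cubeint (slice h t)).
Proof.
move=> ch; apply: (@measurable_integral_slice _ _ _ (fun x => (h x)%:E)).
  by move=> x; rewrite lee_fin; case: ch.
exact: cnn_measurable.
Qed.

Lemma cubeint_rec n (h : 'rV[R]_n.+1 -> R) : cnn h ->
  cubeint h = (\int[@lebesgue_measure R]_(t in `[0%R, 1%R]) cubeint (slice h t))%E.
Proof.
move=> ch; rewrite /cubeint (@integral_mun_rec _ _ _ (fun x => (h x)%:E)).
- rewrite integral_unif01//; first exact: cubeint_slice_measurable.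
  by move=> t; apply: (@cubeint_ge0 _ (slice h t)); exact: cnn_slice.
- by move=> x; rewrite lee_fin; case: ch.
- exact: cnn_measurable.
Qed.

Lemma cubeint0 (h : 'rV[R]_0 -> R) : cubeint h = (h 0)%:E.
Proof. by rewrite /cubeint /= integral_dirac// diracT mul1e. Qed.

Lemma cubeint_cst n (c : R) : 0 <= c -> cubeint (fun _ : 'rV[R]_n => c) = c%:E.
Proof.
move=> c0; elim: n => [|n IH]; first by rewrite cubeint0.
rewrite cubeint_rec; last exact: cnn_cst.
rewrite (eq_integral (cst c%:E)) ?integral_cst//.
by rewrite [X in (_ * X)%E]lebesgue_measure01 mule1.
Qed.

(** The comparison is known on the cube only, whereas the integral ranges over the whole space; the
    induction brings each coordinate back to [0,1]. *)
Lemma cubeint_le n (h k : 'rV[R]_n -> R) : cnn h -> cnn k ->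
  (forall x, cube x -> h x <= k x) -> (cubeint h <= cubeint k)%E.
Proof.
elim: n h k => [|n IH] h k ch ck hk.
  by rewrite !cubeint0 lee_fin; apply: hk => -[].
rewrite !cubeint_rec//; apply: ge0_le_integral => //.
- by move=> t _; apply: cubeint_ge0; exact: cnn_slice.
- by apply: measurable_funTS; exact: cubeint_slice_measurable.
- by apply: measurable_funTS; exact: cubeint_slice_measurable.
- move=> t; rewrite /= in_itv/= => t01.
  apply: IH; [exact: cnn_slice|exact: cnn_slice|].
  by move=> y cy; apply: hk; exact: cube_rcons0.
Qed.

Lemma cube_compact n : compact (@cube n).
Proof.
rewrite (_ : @cube n = [set x | forall j, `[0, 1]%classic (x ord0 j)]); last first.
  by apply/seteqP; split => x H j; have := H j; rewrite /= in_itv.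
apply: (@rV_compact R n (fun=> `[0, 1]%classic)) => _; exact: segment_compact.
Qed.

Lemma cnn_bounded n (h : 'rV[R]_n -> R) : cnn h ->
  exists2 M : R, 0 <= M & forall x, cube x -> h x <= M.
Proof.
move=> [ch h0].
have [||c _ hc] := @EVT_max_rV R n h (@cube n) _ (@cube_compact n).
- by exists 0 => j; rewrite mxE lexx ler01.
- exact: continuous_subspaceT.
- by exists (h c) => // x cx; apply: hc; rewrite inE.
Qed.

Lemma cubeint_fin n (h : 'rV[R]_n -> R) : cnn h -> cubeint h \is a fin_num.
Proof.
move=> ch; rewrite ge0_fin_numE ?cubeint_ge0//.
have [M M0 hM] := cnn_bounded ch.
apply: (@le_lt_trans _ _ M%:E); last exact: ltry.
by rewrite -(cubeint_cst n M0); apply: cubeint_le => //; exact: cnn_cst.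
Qed.

End Cube.

(** [fine] loses nothing on continuous nonnegative functions, which are bounded on the cube. *)
HB.lock Definition I (R : realType) n (h : 'rV[R]_n -> R) : R := fine (cubeint h).

Section CubeIntegral.
Variable R : realType.
Local Notation unif01 := (unif01 R).
Local Notation itv01 := (`[0%R, 1%R]%classic : set R).

Lemma IE n (h : 'rV[R]_n -> R) : cnn h -> cubeint h = (I h)%:E.
Proof. by move=> ch; rewrite I.unlock fineK//; exact: cubeint_fin. Qed.

Lemma I0E (h : 'rV[R]_0 -> R) : I h = h 0.
Proof. by rewrite I.unlock cubeint0. Qed.

Lemma I_ge0 n (h : 'rV[R]_n -> R) : cnn h -> 0 <= I h.
Proof. by move=> ch; rewrite -lee_fin -IE// cubeint_ge0. Qed.

Lemma I_le n (h k : 'rV[R]_n -> R) : cnn h -> cnn k ->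
  (forall x, cube x -> h x <= k x) -> I h <= I k.
Proof. by move=> ch ck hk; rewrite -lee_fin -!IE//; exact: cubeint_le. Qed.

Lemma I_cst n (c : R) : 0 <= c -> I (fun _ : 'rV[R]_n => c) = c.
Proof. by move=> c0; rewrite I.unlock cubeint_cst. Qed.

Lemma I_add n (h k : 'rV[R]_n -> R) : cnn h -> cnn k ->
  I (fun x => h x + k x) = I h + I k.
Proof.
move=> ch ck; apply: EFin_inj; rewrite EFinD -!IE//; last exact: cnnD.
rewrite /cubeint; under eq_integral do rewrite EFinD.
rewrite ge0_integralD//; [|exact: cnn_measurable| |exact: cnn_measurable].
- by move=> w _; rewrite lee_fin; case: ch.
- by move=> w _; rewrite lee_fin; case: ck.
Qed.

Lemma I_scale n (h : 'rV[R]_n -> R) c : 0 <= c -> cnn h ->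
  I (fun x => c * h x) = c * I h.
Proof.
move=> c0 ch; apply: EFin_inj; rewrite EFinM -!IE//; last exact: cnnZ.
rewrite /cubeint; under eq_integral do rewrite EFinM.
rewrite ge0_integralZl//; first exact: cnn_measurable.
by move=> w _; rewrite lee_fin; case: ch.
Qed.

Lemma I_holder n (h k : 'rV[R]_n -> R) a b : 0 <= a -> 0 <= b -> a + b = 1 ->
  cnn h -> cnn k -> I (fun x => h x `^ a * k x `^ b) <= I h `^ a * I k `^ b.
Proof.
move=> a0 b0 ab ch ck; rewrite -lee_fin EFinM -!poweR_EFin -!IE//; last first.
  by apply: cnnM; apply: cnn_powR.
apply: integral_holder => //.
- by case: ch => ch _; exact: continuous_ev_measurable.
- by case: ck => ck _; exact: continuous_ev_measurable.
- by move=> w; case: ch.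
- by move=> w; case: ck.
Qed.

Lemma I_slice_measurable n (h : 'rV[R]_n.+1 -> R) : cnn h ->
  measurable_fun [set: R] (fun t => I (slice h t)).
Proof.
move=> ch; apply/measurable_EFinP.
rewrite (_ : _ \o _ = fun t => cubeint (slice h t)).
  exact: cubeint_slice_measurable.
by apply/funext => t /=; rewrite -IE//; exact: cnn_slice.
Qed.

Lemma I_rec n (h : 'rV[R]_n.+1 -> R) : cnn h ->
  (I h)%:E = (\int[unif01]_t (I (slice h t))%:E)%E.
Proof.
move=> ch; rewrite -IE// cubeint_rec// -integral_unif01//.
- by apply: eq_integral => t _; rewrite -IE//; exact: cnn_slice.
- exact: cubeint_slice_measurable.
- by move=> t; apply: cubeint_ge0; exact: cnn_slice.
Qed.

Lemma I_rec01 n (h : 'rV[R]_n.+1 -> R) : cnn h ->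
  (I h)%:E = (\int[@lebesgue_measure R]_(t in `[0%R, 1%R]) (I (slice h t))%:E)%E.
Proof.
move=> ch; rewrite I_rec// integral_unif01//.
- by apply/measurable_EFinP; exact: I_slice_measurable.
- by move=> t; rewrite lee_fin; apply: I_ge0; exact: cnn_slice.
Qed.

(** Hoelder's inequality in the slicing variable, with the same two exponents. It is the induction
    step of [sobolev_dual]. *)
Lemma I_slice_holder n (h b d : 'rV[R]_n.+1 -> R) c x y :
  0 <= c -> 0 <= x -> 0 <= y -> x + y = 1 -> cnn h -> cnn b -> cnn d ->
  (forall t, 0 <= t <= 1 ->
    I (slice h t) <= c * (I (slice b t) `^ x * I (slice d t) `^ y)) ->
  I h <= c * (I b `^ x * I d `^ y).
Proof.
move=> c0 x0 y0 xy ch cb cd H.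
have I0 (k : 'rV[R]_n.+1 -> R) t : cnn k -> 0 <= I (slice k t).
  by move=> ck; apply: I_ge0; exact: cnn_slice.
pose F t := I (slice b t) `^ x * I (slice d t) `^ y.
have F0 t : 0 <= F t by rewrite mulr_ge0// powR_ge0.
have mF : measurable_fun [set: R] F.
  apply: measurable_funM; apply: (measurableT_comp (measurable_powR _));
  exact: I_slice_measurable.
rewrite -lee_fin I_rec01//.
apply: (@le_trans _ _ (\int[@lebesgue_measure R]_(t in `[0%R, 1%R]) (c%:E * (F t)%:E)))%E.
  apply: ge0_le_integral => //.
  - by move=> t _; rewrite lee_fin I0.
  - by apply/measurable_EFinP/measurable_funTS; exact: I_slice_measurable.
  - by apply: measurable_funTS; apply: measurable_funeM; exact/measurable_EFinP.
rewrite -integral_unif01; first last.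
- by move=> t; rewrite -EFinM lee_fin mulr_ge0.
- by apply: measurable_funeM; exact/measurable_EFinP.
rewrite ge0_integralZl//; first last.
- by move=> t _; rewrite lee_fin.
- exact/measurable_EFinP.
rewrite [leRHS]EFinM; apply: lee_wpmul2l; first by rewrite lee_fin.
rewrite EFinM -!poweR_EFin !I_rec//.
by apply: integral_holder => //; [exact: I_slice_measurable|exact: I_slice_measurable| |] => t; exact: I0.
Qed.

Lemma I_slice_le n (h b : 'rV[R]_n.+1 -> R) c :
  0 <= c -> cnn h -> cnn b ->
  (forall t, 0 <= t <= 1 -> I (slice h t) <= c * I (slice b t)) ->
  I h <= c * I b.
Proof.
move=> c0 ch cb H.
have := @I_slice_holder n h b b c 1 0 c0 ler01 (lexx 0) (addr0 1) ch cb cb.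
rewrite powRr0 mulr1 powRr1 ?I_ge0//; apply=> t t01.
by rewrite powRr0 mulr1 powRr1 ?H// I_ge0//; exact: cnn_slice.
Qed.

(** Tonelli's theorem with the first variable innermost, the order in which the fundamental theorem
    of calculus along that variable can be inserted. *)
Lemma I_fubini_le n (h0 : 'rV[R]_n -> R) (w : 'rV[R]_n.+1 -> R) :
  cnn h0 -> cnn w ->
  (forall y, ((h0 y)%:E <=
     \int[@lebesgue_measure R]_(t in `[0%R, 1%R]) (w (rcons0 t y))%:E)%E) ->
  I h0 <= I w.
Proof.
move=> ch cw H; rewrite -lee_fin -!IE// /cubeint.
have w0 x : (0 <= (w x)%:E)%E by rewrite lee_fin; case: cw.
rewrite (@integral_mun_rec2 _ _ _ (fun x => (w x)%:E))//; last exact: cnn_measurable.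
apply: ge0_le_integral => //.
- by move=> y _; rewrite lee_fin; case: ch.
- exact: cnn_measurable.
- apply: (@measurable_fun_fubini_tonelli_G _ _ _ _ _ unif01
    (fun z : measurableTypeR R * projT2 (TT R n) => (w (@ev R n.+1 z))%:E)) => //.
  exact: (@cnn_measurable R n.+1 w).
- move=> y _; rewrite integral_unif01//.
  apply/measurable_EFinP; apply: continuous_measurable_fun.
  by apply: continuous_slicel; case: cw.
Qed.

(** Otherwise [G] would be positive on [0,1] with integral zero, hence zero almost everywhere there,
    although [0,1] has measure 1. *)
Lemma I_slice_exists n (h : 'rV[R]_n.+1 -> R) : cnn h ->
  exists2 t, 0 <= t <= 1 & I (slice h t) <= I h.
Proof.
move=> ch; apply: contrapT => H.
have Hlt t : 0 <= t <= 1 -> I h < I (slice h t).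
  by move=> t01; rewrite ltNge; apply/negP => le; apply: H; exists t.
pose G t := I (slice h t) - I h.
have mS := I_slice_measurable ch.
have mG : measurable_fun [set: R] G by apply: measurable_funB.
have eqI : (\int[@lebesgue_measure R]_(t in `[0%R, 1%R]) (G t)%:E = 0)%E.
  have : ((I h)%:E = \int[@lebesgue_measure R]_(t in `[0%R, 1%R]) ((G t)%:E + (I h)%:E))%E.
    rewrite {1}I_rec01//; apply: eq_integral => t _.
    by rewrite -EFinD /G subrK.
  rewrite ge0_integralD//; first last.
  - by move=> t _; rewrite lee_fin I_ge0.
  - by apply: measurable_funTS; exact/measurable_EFinP.
  - by move=> t; rewrite /= in_itv/= => t01; rewrite lee_fin /G subr_ge0 ltW// Hlt.
  have -> : (\int[@lebesgue_measure R]_(t in `[0%R, 1%R]) (I h)%:E = (I h)%:E)%E.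
    rewrite (eq_integral (cst (I h)%:E))// integral_cst//.
    by rewrite [X in (_ * X)%E]lebesgue_measure01 mule1.
  have key (z : \bar R) : ((I h)%:E = z + (I h)%:E -> z = 0)%E.
    by case: z => [z| |]// [/eqP]; rewrite -subr_eq subrr => /eqP <-.
  exact: key.
have mGE : measurable_fun itv01 (EFin \o G).
  by apply/measurable_EFinP; exact: measurable_funTS.
have : ae_eq (@lebesgue_measure R) itv01 (EFin \o G) (cst 0%E).
  apply: (ae_eq_integral_abs (@lebesgue_measure R) (measurable_itv _) mGE).1.
  rewrite -[RHS]eqI; apply: eq_integral => t; rewrite inE/= in_itv/= => t01.
  by rewrite ger0_norm// /G subr_ge0 ltW// Hlt.
move=> [A [mA A0 sA]].
have : (@lebesgue_measure R `[0%R, 1%R]%classic <= lebesgue_measure A)%E.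
  apply: le_measure; rewrite ?inE//= => t; rewrite /= in_itv/= => t01.
  apply: sA => /= /(_ _) H1; have := H1; rewrite in_itv/= => /(_ t01) [] /eqP.
  by rewrite subr_eq0 gt_eqF// Hlt.
by rewrite A0 lebesgue_measure01 lee_fin ler10.
Qed.

End CubeIntegral.

(** * Dominated partial derivatives and the Sobolev inequality *)

Section Gradient.
Variable R : realType.

(* [g] dominates the partial derivatives of [h]; unlike the gradient itself,
   this relation is stable under slicing, powers and smoothing. *)
Definition DG n (h g : 'rV[R]_n -> R) := forall x i,
  exists2 d : R, is_derive (0 : R) (1 : R) (fun s : R => h (x + s *: delta_mx 0 i)) d
               & `|d| <= g x.

Lemma rcons0_deltaS n t (y : 'rV[R]_n) (s : R) i :
  rcons0 t y + s *: delta_mx 0 (lift ord0 i) = rcons0 t (y + s *: delta_mx 0 i).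
Proof.
have E m (b x : 'rV[R]_m) k : (b + s *: x) ord0 k = b ord0 k + s * x ord0 k.
  by rewrite !mxE.
apply/rowP => j; rewrite E.
case: (unliftP ord0 j) => [k|] ->; rewrite ?rcons0_S ?rcons0_0 ?E.
  by rewrite !mxE (inj_eq lift_inj).
by rewrite mxE /= mulr0 addr0.
Qed.

Lemma rcons0_delta0 n t (y : 'rV[R]_n) (s : R) :
  rcons0 t y + s *: delta_mx 0 ord0 = rcons0 (t + s) y.
Proof.
have E m (b x : 'rV[R]_m) k : (b + s *: x) ord0 k = b ord0 k + s * x ord0 k.
  by rewrite !mxE.
apply/rowP => j; rewrite E.
case: (unliftP ord0 j) => [k|] ->; rewrite ?rcons0_S ?rcons0_0.
  by rewrite mxE /= mulr0 addr0.
by rewrite mxE eqxx mulr1.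
Qed.

Lemma DG_slice n (h g : 'rV[R]_n.+1 -> R) t : DG h g -> DG (slice h t) (slice g t).
Proof.
move=> H y i; have [d dd dg] := H (rcons0 t y) (lift ord0 i).
by exists d => //; under eq_fun do rewrite /slice -rcons0_deltaS.
Qed.

Lemma is_derive_line (phi : R -> R) t d :
  is_derive (0 : R) (1 : R) (fun s => phi (t + s)) d -> is_derive t (1 : R) phi d.
Proof.
move=> H; rewrite (_ : phi = (fun s => phi (t + s)) \o (fun u => u - t)); last first.
  by apply/funext => u /=; rewrite addrC subrK.
rewrite -[d]mulr1; apply: is_derive1_comp; first by rewrite subrr.
have := @is_deriveB _ _ _ id (fun=> t) t (1 : R) 1 0 (is_derive_id _ _) (is_derive_cst _ _ _).
by rewrite subr0.
Qed.

Lemma DG_first n (h g : 'rV[R]_n.+1 -> R) y t : DG h g ->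
  exists2 d : R, is_derive t (1 : R) (fun t => h (rcons0 t y)) d & `|d| <= g (rcons0 t y).
Proof.
move=> H; have [d dd dg] := H (rcons0 t y) ord0.
exists d => //; apply: is_derive_line.
by under eq_fun do rewrite -rcons0_delta0.
Qed.

(** Only differentiability of [phi] is assumed, and its derivative need not be integrable. So the
    fundamental theorem is applied to the continuous majorant: if [F] is a primitive of [gam], then
    [F - phi] and [F + phi] both have nonnegative derivative. *)
Lemma derive_bound_integral (phi gam : R -> R) (s t : R) : s <= t ->
  continuous gam -> (forall u, exists2 d : R, is_derive u (1 : R) phi d & `|d| <= gam u) ->
  (`|phi t - phi s|%:E <= \int[@lebesgue_measure R]_(u in `[s, t]) (gam u)%:E)%E.
Proof.
rewrite le_eqVlt => /predU1P[<-|st] cg Hd.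
  rewrite subrr normr0; apply: integral_ge0 => u _; rewrite lee_fin.
  by have [d _] := Hd u; apply: le_trans.
have gint a b : (@lebesgue_measure R).-integrable `[a, b] (EFin \o gam).
  apply: continuous_compact_integrable; first exact: segment_compact.
  exact: continuous_subspaceT.
(* The base point [s - 1] makes [F] differentiable on both sides at [s]. *)
pose F x := (\int[@lebesgue_measure R]_(u in `[s - 1, x]) gam u)%R.
have FE x : s - 1 < x -> derivable F x 1 /\ derive1 F x = gam x.
  move=> sx; apply: (@continuous_FTC1_closed _ gam (s - 1) x (x + 1)) => //.
  - by rewrite ltrDl.
  - exact: cg.
have Fder x : s - 1 < x -> is_derive x (1 : R) F (gam x).
  by move=> /FE [dF <-]; rewrite derive1E; exact/derivableP.
have Fc : {within `[s, t], continuous F}.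
  apply: derivable_within_continuous => x; rewrite in_itv/= => /andP[sx _].
  by apply: (FE x _).1; lra.
have pc : {within `[s, t], continuous phi}.
  apply: derivable_within_continuous => x _.
  by have [d [dd _] _] := Hd x.
have E : (\int[@lebesgue_measure R]_(u in `[s, t]) (gam u)%:E = (F t - F s)%:E)%E.
  rewrite (@continuous_FTC2 _ gam F s t st) ?EFinB//.
  - exact: continuous_subspaceT.
  - split.
    + by move=> x; rewrite in_itv/= => /andP[sx _]; apply: (FE x _).1; lra.
    + by have [_ + _] := (continuous_within_itvP F st).1 Fc.
    + by have [_ _ +] := (continuous_within_itvP F st).1 Fc.
  - by move=> x; rewrite in_itv/= => /andP[sx _]; apply: (FE x _).2; lra.
rewrite E lee_fin ler_norml.
have mono (G : R -> R) (d' : R -> R) : (forall x, s - 1 < x -> is_derive x (1 : R) G (d' x)) ->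
    (forall x, 0 <= d' x) -> G s <= G t.
  move=> dG d0.
  have cG : {within `[s, t], continuous G}.
    apply: derivable_within_continuous => x; rewrite in_itv/= => /andP[sx _].
    have sx1 : s - 1 < x by lra.
    by case: (dG x sx1).
  apply: (@ger0_derive1_ndecr _ G s t _ _ cG s t) => //; try exact: ltW;
    move=> x; rewrite ?in_itv/= => /andP[sx _].
  - have sx1 : s - 1 < x by lra.
    by case: (dG x sx1).
  - have sx1 : s - 1 < x by lra.
    by rewrite derive1E; case: (dG x sx1) => _ ->.
pose d u := 'D_1 phi u.
have dP u : is_derive u (1 : R) phi (d u) /\ `|d u| <= gam u.
  have [e de eg] := Hd u; have <- : e = d u by rewrite /d derive_val.
  by split.
have h1 : F s - phi s <= F t - phi t.
  apply: (@mono (fun x => F x - phi x) (fun x => gam x - d x)).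
  - by move=> x sx; apply: is_deriveB; [exact: Fder|exact: (dP x).1].
  - by move=> x; rewrite subr_ge0 (le_trans (ler_norm _) (dP x).2).
have h2 : F s + phi s <= F t + phi t.
  apply: (@mono (fun x => F x + phi x) (fun x => gam x + d x)).
  - by move=> x sx; apply: is_deriveD; [exact: Fder|exact: (dP x).1].
  - move=> x; have := (dP x).2; rewrite ler_norml => /andP[]; lra.
by apply/andP; split; lra.
Qed.

Lemma derive_bound01 (phi gam : R -> R) (s t : R) : 0 <= s <= 1 -> 0 <= t <= 1 ->
  continuous gam -> (forall u, exists2 d : R, is_derive u (1 : R) phi d & `|d| <= gam u) ->
  (`|phi t - phi s|%:E <= \int[@lebesgue_measure R]_(u in `[0%R, 1%R]) (gam u)%:E)%E.
Proof.
wlog st : s t / s <= t.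
  move=> H s01 t01; have [st|/ltW ts] := leP s t; first exact: H.
  by rewrite distrC; exact: H.
move=> /andP[s0 s1] /andP[t0 t1] cg Hd.
apply: (le_trans (derive_bound_integral st cg Hd)).
apply: ge0_subset_integral => //.
- by apply: measurable_funTS; apply/measurable_EFinP; exact: continuous_measurable_fun.
- by move=> u _; rewrite lee_fin; have [d _] := Hd u; apply: le_trans.
- by apply: subset_itv; rewrite bnd_simp.
Qed.

Lemma DG_osc n (h g : 'rV[R]_n.+1 -> R) y s t : cnn g -> DG h g ->
  0 <= s <= 1 -> 0 <= t <= 1 ->
  (`|h (rcons0 t y) - h (rcons0 s y)|%:E <=
    \int[@lebesgue_measure R]_(u in `[0%R, 1%R]) (g (rcons0 u y))%:E)%E.
Proof.
move=> [cg _] H s01 t01.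
apply: (@derive_bound01 (fun t => h (rcons0 t y)) (fun t => g (rcons0 t y))) => //.
  exact: continuous_slicel.
by move=> u; exact: DG_first.
Qed.

(** Average [h t <= h s + J] over [s] in [0,1], where [J] is the integral of [g] along the segment.
    If [J] is infinite there is nothing to prove. *)
Lemma DG_sup n (h g : 'rV[R]_n.+1 -> R) y t : cnn h -> cnn g -> DG h g ->
  0 <= t <= 1 ->
  ((h (rcons0 t y))%:E <=
    \int[@lebesgue_measure R]_(u in `[0%R, 1%R]) (h (rcons0 u y) + g (rcons0 u y))%:E)%E.
Proof.
move=> ch cg H t01.
have mm (k : 'rV[R]_n.+1 -> R) : cnn k ->
  measurable_fun (`[0%R, 1%R]%classic : set R) (fun u => (k (rcons0 u y))%:E).
  move=> [ck _]; apply: measurable_funTS; apply/measurable_EFinP.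
  by apply: continuous_measurable_fun; exact: continuous_slicel.
under eq_integral do rewrite EFinD.
rewrite ge0_integralD//; first last.
- exact: mm.
- by move=> u _; rewrite lee_fin; case: cg.
- exact: mm.
- by move=> u _; rewrite lee_fin; case: ch.
set J := (\int[_]_(u in _) (g _)%:E)%E.
have osc s : 0 <= s <= 1 -> (`|h (rcons0 t y) - h (rcons0 s y)|%:E <= J)%E.
  by move=> s01; exact: DG_osc.
clearbody J; case: J osc => [r| |] osc; first last.
- by have := osc 0; rewrite lexx ler01 => /(_ isT).
- by rewrite addey ?leey// gt_eqF// (lt_le_trans (ltNyr 0))// integral_ge0// => u _; rewrite lee_fin; case: ch.
have r0 : 0 <= r by rewrite -lee_fin (le_trans _ (osc t t01))// lee_fin.
have -> : r%:E = (\int[@lebesgue_measure R]_(u in `[0%R, 1%R]) (cst r%:E) u)%E.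
  by rewrite integral_cst// [X in (_ * X)%E]lebesgue_measure01 mule1.
have -> : (h (rcons0 t y))%:E = (\int[@lebesgue_measure R]_(u in `[0%R, 1%R]) (cst (h (rcons0 t y))%:E) u)%E.
  by rewrite integral_cst// [X in (_ * X)%E]lebesgue_measure01 mule1.
rewrite -ge0_integralD//; first last.
- exact: mm.
- by move=> u _; rewrite lee_fin; case: ch.
apply: ge0_le_integral => //.
- by move=> u _; rewrite lee_fin; case: ch.
- by apply: emeasurable_funD => //; exact: mm.
- move=> u; rewrite /= in_itv/= => u01; have := osc u u01.
  rewrite lee_fin ler_norml => /andP[_]; rewrite -EFinD lee_fin; lra.
Qed.

Lemma powRDp (x a b : R) : 0 < a + b -> x `^ (a + b) = x `^ a * x `^ b.
Proof. by move=> ab; rewrite powRD// gt_eqF. Qed.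

Lemma powR_split (x D a b : R) : 0 <= D -> a + b = 1 ->
  D `^ a * (x * D `^ b) <= x * D.
Proof. by move=> D0 ab; rewrite mulrCA -powRDp ab ?powRr1. Qed.

(** Trace inequality for W^{1,1}: [DG_sup] integrated over the remaining variables. *)
Lemma slice_le_I n (h g : 'rV[R]_n.+1 -> R) t : cnn h -> cnn g -> DG h g ->
  0 <= t <= 1 -> I (slice h t) <= I (fun x => h x + g x).
Proof.
move=> ch cg H t01; apply: I_fubini_le; [exact: cnn_slice|exact: cnnD|].
by move=> y; exact: DG_sup.
Qed.

(* The Gagliardo-Nirenberg-Sobolev inequality W^{1,1} -> L^{n/(n-1)} in dual
   form; this form is also meaningful for n = 1. *)
Lemma sobolev_dual n (k h g : 'rV[R]_n.+1 -> R) : cnn k -> cnn h -> cnn g -> DG h g ->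
  I (fun x => k x `^ (n.+1%:R^-1) * h x) <= I k `^ (n.+1%:R^-1) * I (fun x => h x + g x).
Proof.
elim: n k h g => [|n IH] k h g ck ch cg H.
  rewrite invr1 powRr1 ?I_ge0// mulrC.
  apply: I_slice_le => //; first by apply: I_ge0; exact: cnnD.
    by apply: cnnM => //; apply: cnn_powR.
  move=> t t01; rewrite !I0E /slice powRr1; last by case: ck.
  rewrite mulrC ler_wpM2r//; first by case: ck.
  have := slice_le_I ch cg H t01.
  by rewrite I0E.
pose N : R := n.+1%:R; have N0 : 0 < N :> R by rewrite ltr0n.
have -> : n.+2%:R = N + 1 :> R by rewrite /N -[n.+2]addn1 natrD.
set D := I (fun x => h x + g x); have D0 : 0 <= D by apply: I_ge0; exact: cnnD.
set a := (N + 1)^-1; set b := N / (N + 1).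
have N10 : 0 < N + 1 by lra.
have a0 : 0 < a by rewrite invr_gt0.
have b0 : 0 < b by rewrite divr_gt0.
have ab : a + b = 1 by rewrite /a /b -{1}[_^-1]mul1r -mulrDl [1 + N]addrC mulfV ?gt_eqF.
have aNb : N^-1 * b = a by rewrite /a /b mulrA mulVf ?gt_eqF// mul1r.
have cN1 : cnn (fun x => k x `^ N^-1) by apply: cnn_powR => //; rewrite invr_ge0 ltW.
apply: (@le_trans _ _ (D `^ a * (I k `^ a * D `^ b))); last first.
  exact: (powR_split _ D0 ab).
apply: I_slice_holder => //; try exact: ltW.
- exact: powR_ge0.
- by apply: cnnM => //; apply: cnn_powR => //; exact: ltW.
- exact: cnnD.
move=> t t01.
have ckt := cnn_slice t ck; have cht := cnn_slice t ch; have cgt := cnn_slice t cg.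
(* Hoelder on the slice with weights [b] and [a]. The factor with [h] alone is at most [D^a] by
   [slice_le_I]; the other one is the induction hypothesis raised to the power [b], and [b/N = a]
   restores the exponent of [k]. *)
have -> : slice (fun x => k x `^ a * h x) t =
   (fun y => (slice k t y `^ N^-1 * slice h t y) `^ b * slice h t y `^ a).
  apply/funext => y; rewrite /slice.
  have k0 : 0 <= k (rcons0 t y) by case: ck.
  have h0 : 0 <= h (rcons0 t y) by case: ch.
  rewrite powRM// ?powR_ge0// -powRrM -mulrA -powRDp [b + a]addrC ab// powRr1//.
  by rewrite aNb.
have cNk : cnn (fun y => slice k t y `^ N^-1) by apply: cnn_powR => //; rewrite invr_ge0 ltW.
apply: (le_trans (I_holder _ _ _ _ _)); rewrite ?[b + a]addrC //; try exact: ltW.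
  exact: cnnM.
rewrite [leLHS]mulrC; apply: ler_pM; try exact: powR_ge0; try exact: mulr_ge0.
  apply: ge0_ler_powR; rewrite ?nnegrE//; first exact: ltW.
    exact: I_ge0.
  exact: slice_le_I.
have := IH _ _ _ ckt cht cgt (DG_slice t H).
rewrite -/N => IHt.
have -> : I (slice k t) `^ a = (I (slice k t) `^ N^-1) `^ b.
  by rewrite -powRrM aNb.
rewrite -powRM ?powR_ge0//; last by apply: I_ge0; exact: cnnD.
apply: ge0_ler_powR; rewrite ?nnegrE ?(ltW b0)//.
- by apply: I_ge0; exact: cnnM.
- by rewrite mulr_ge0 ?powR_ge0// I_ge0//; exact: cnnD.
Qed.

End Gradient.

(** * Poincare's inequality on the cube *)

Section CubeInequalities.
Variable R : realType.

Lemma powRK (x a : R) : 0 <= x -> a != 0 -> (x `^ a) `^ a^-1 = x.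
Proof. by move=> x0 a0; rewrite -powRrM mulfV// powRr1. Qed.

Lemma powRVK (x a : R) : 0 <= x -> a != 0 -> (x `^ a^-1) `^ a = x.
Proof. by move=> x0 a0; rewrite -powRrM mulVf// powRr1. Qed.

Lemma powR_le (x y a : R) : 0 <= a -> 0 <= x -> x <= y -> x `^ a <= y `^ a.
Proof.
move=> a0 x0 xy; apply: ge0_ler_powR; rewrite ?nnegrE//.
exact: le_trans xy.
Qed.

(** The sum is at most twice the larger term. This crude form holds for every exponent [a >= 0],
    below or above 1, which matters for [r], [s] and [v]. *)
Lemma powR_addle (x y a : R) : 0 <= a -> 0 <= x -> 0 <= y ->
  (x + y) `^ a <= 2 `^ a * (x `^ a + y `^ a).
Proof.
move=> a0 x0 y0.
wlog xy : x y x0 y0 / x <= y.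
  move=> H; have [xy|/ltW yx] := leP x y; first exact: H.
  by rewrite addrC [x `^ a + _]addrC; exact: H.
apply: (@le_trans _ _ ((2 * y) `^ a)).
  by apply: powR_le => //; lra.
by rewrite powRM// ler_wpM2l ?powR_ge0// lerDr powR_ge0.
Qed.

(** [x^r + y^r <= 2 (x + y)^r <= 2^r (x + y)^r], whence the constant [2 * 2]. This replaces
    Minkowski's inequality: the triangle inequality with constant 4 is enough. *)
Lemma powR_quasi_norm (x y z r : R) : 1 <= r -> 0 <= x -> 0 <= y -> 0 <= z ->
  z `^ r <= 2 `^ r * (x `^ r + y `^ r) -> z <= 4 * (x + y).
Proof.
move=> r1 x0 y0 z0 H; have r0 : 0 < r by exact: lt_le_trans r1.
have H2 : z `^ r <= (4 * (x + y)) `^ r.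
  apply: (le_trans H).
  have -> : 4 * (x + y) = 2 * (2 * (x + y)) by lra.
  rewrite powRM ?ler_wpM2l ?powR_ge0//; last by rewrite mulr_ge0// addr_ge0.
  rewrite powRM ?addr_ge0//.
  have le2 : 2 <= 2 `^ r by apply: le1r_powR => //; lra.
  have h1 : x `^ r <= (x + y) `^ r by apply: powR_le; rewrite ?(ltW r0)//; lra.
  have h2 : y `^ r <= (x + y) `^ r by apply: powR_le; rewrite ?(ltW r0)//; lra.
  have h3 : 0 <= (x + y) `^ r by exact: powR_ge0.
  nra.
rewrite leNgt; apply/negP => lt; have := gt0_ltr_powR r0.
move=> /(_ (4 * (x + y)) z); rewrite !nnegrE z0 mulr_ge0 ?addr_ge0// => /(_ isT isT lt).
by rewrite ltNge H2.
Qed.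

Lemma cnn_dist n (h : 'rV[R]_n -> R) (c : R) : continuous h ->
  cnn (fun x => `|h x - c|).
Proof.
move=> ch; apply: cnn_norm => x; apply: continuousB; first exact: ch.
exact: cst_continuous.
Qed.

Lemma jensen01 (gam : R -> R) p : 1 <= p -> continuous gam -> (forall t, 0 <= gam t) ->
  ((\int[@lebesgue_measure R]_(u in `[0%R, 1%R]) (gam u)%:E) <=
   (\int[@lebesgue_measure R]_(u in `[0%R, 1%R]) (gam u `^ p)%:E) `^ p^-1)%E.
Proof.
move=> p1 cg g0; have p0 : 0 < p by apply: lt_le_trans p1.
have mg : measurable_fun [set: R] gam by exact: continuous_measurable_fun.
have mgp : measurable_fun [set: R] (fun t => gam t `^ p).
  exact: (measurableT_comp (measurable_powR _) mg).
rewrite -!integral_unif01; first last.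
- by move=> t; rewrite lee_fin.
- exact/measurable_EFinP.
- by move=> t; rewrite lee_fin powR_ge0.
- exact/measurable_EFinP.
have pV : p^-1 <= 1 by rewrite invf_le1.
have := @integral_holder R _ _ (unif01 R) (fun t => gam t `^ p) (fun=> 1) p^-1 (1 - p^-1).
rewrite invr_ge0 subr_ge0 addrC subrK => /(_ (ltW p0) pV erefl mgp (measurable_cst _)).
move=> /(_ (fun t => powR_ge0 _ _) (fun=> ler01)).
under eq_integral do rewrite powRK ?gt_eqF// powR1 mulr1.
rewrite [X in (_ * (X `^ _))%E](_ : _ = 1%E) ?poweR1r ?mule1//.
rewrite integral_unif01//.
by rewrite (eq_integral (cst 1%E))// integral_cst// [X in (_ * X)%E]lebesgue_measure01 mule1.
Qed.

(** Induction on the dimension. The constant is taken from a slice on which [g^p] does not exceed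
    its mean; any other slice differs from that one by at most the integral of [g] in the first
    variable. In dimension 0 the constant is the value of [h], so [c] is always a value of [h]. *)
Lemma poincare n p : 1 <= p -> exists2 K : R, 0 <= K & forall h g : 'rV[R]_n -> R,
  continuous h -> cnn g -> DG h g ->
  exists c : R, I (fun x => `|h x - c| `^ p) <= K * I (fun x => g x `^ p).
Proof.
move=> p1; have p0 : 0 < p by apply: lt_le_trans p1.
elim: n => [|n [K K0 IH]].
  exists 0 => // h g _ _ _; exists (h 0).
  by rewrite mul0r I0E subrr normr0 powR0 ?gt_eqF.
exists (2 `^ p * (1 + K)); first by rewrite mulr_ge0 ?powR_ge0 ?addr_ge0.
move=> h g ch cg H.
have cgp : cnn (fun x => g x `^ p) by apply: cnn_powR => //; exact: ltW.
have [t0 t01 gt0] := I_slice_exists cgp.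
have chs t : continuous (slice h t) by exact: continuous_slicer.
have [c Hc] := IH _ _ (chs t0) (cnn_slice t0 cg) (DG_slice t0 H).
exists c.
have cL : cnn (fun x => `|h x - c| `^ p) by apply: cnn_powR; [exact: ltW|exact: cnn_dist].
have I1 : I (fun _ : 'rV[R]_n.+1 => 1) = 1 :> R by rewrite I_cst.
set c0 := 2 `^ p * (1 + K) * _.
rewrite -[c0]mulr1 -I1; apply: I_slice_le => //.
- by rewrite !mulr_ge0 ?powR_ge0 ?addr_ge0 ?I_ge0.
- exact: cnn_cst.
move=> t tt; rewrite [X in _ * X](_ : _ = 1) ?mulr1; last exact: I_cst.
have cd : cnn (fun y => `|slice h t y - slice h t0 y| `^ p).
  apply: cnn_powR; first exact: ltW.
  apply: cnn_norm => y; apply: continuousB; exact: chs.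
have cc : cnn (fun y => `|slice h t0 y - c| `^ p).
  by apply: cnn_powR; [exact: ltW|exact: cnn_dist].
apply: (@le_trans _ _ (I (fun y => 2 `^ p * (`|slice h t y - slice h t0 y| `^ p +
      `|slice h t0 y - c| `^ p)))).
  apply: I_le; [exact: (cnn_slice t cL)|by apply: cnnZ; [exact: powR_ge0|exact: cnnD]|].
  move=> y _; rewrite {1}/slice -/(slice h t y).
  apply: le_trans (powR_addle (ltW p0) (normr_ge0 _) (normr_ge0 _)).
  apply: powR_le => //; first exact: ltW.
  have -> : slice h t y - c = (slice h t y - slice h t0 y) + (slice h t0 y - c).
    by rewrite addrA subrK.
  exact: ler_normD.
rewrite I_scale ?powR_ge0//; last exact: cnnD.
rewrite I_add// /c0 -mulrA ler_wpM2l ?powR_ge0// mulrDl mul1r lerD//; last first.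
  by apply: (le_trans Hc); rewrite ler_wpM2l.
apply: I_fubini_le => // y.
set J := (\int[_]_(u in _) _)%E.
have J0 : (0 <= J)%E by apply: integral_ge0 => u _; rewrite lee_fin powR_ge0.
have cgy : continuous (fun u => g (rcons0 u y)) by apply: continuous_slicel; case: cg.
have gy0 u : 0 <= g (rcons0 u y) by case: cg.
have := le_trans (DG_osc y cg H t01 tt) (jensen01 p1 cgy gy0).
rewrite -/J => /(gt0_ler_poweR (ltW p0)).
rewrite !in_itv/= !leey !andbT lee_fin normr_ge0 poweR_ge0 => /(_ isT isT).
by rewrite -poweRrM mulVf ?gt_eqF// poweRe1.
Qed.

Lemma I_Lp_mono n (h : 'rV[R]_n -> R) a b : 0 < a -> a <= b -> cnn h ->
  I (fun x => h x `^ a) `^ a^-1 <= I (fun x => h x `^ b) `^ b^-1.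
Proof.
move=> a0 ab ch; have b0 : 0 < b by exact: lt_le_trans ab.
have c0 : cnn (fun x => h x `^ a) by apply: cnn_powR => //; exact: ltW.
have cb : cnn (fun x => h x `^ b) by apply: cnn_powR => //; exact: ltW.
have ab1 : a / b <= 1 by rewrite ler_pdivrMr// mul1r.
have := @I_holder R n (fun x => h x `^ b) (fun=> 1) (a / b) (1 - a / b).
have ab2 : a / b + (1 - a / b) = 1 by rewrite addrC subrK.
rewrite subr_ge0 => /(_ (divr_ge0 (ltW a0) (ltW b0)) ab1 ab2 cb (cnn_cst _ ler01)).
rewrite (@I_cst R n 1 ler01) [1 `^ _](_ : _ = 1); last by rewrite powR1.
rewrite mulr1 (_ : (fun x => _ * _) = fun x => h x `^ a); last first.
  by apply/funext => x; rewrite mulr1 -powRrM [b * _]mulrC mulfVK ?gt_eqF.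
move=> /(powR_le (a := a^-1)) H.
apply: (le_trans (H _ _)); rewrite ?invr_ge0 ?I_ge0 ?(ltW a0)//.
by rewrite -powRrM mulrAC mulfV ?gt_eqF// mul1r.
Qed.

End CubeInequalities.

(** * Normalised L^r norms on the cube and smoothing of an absolute value *)

HB.lock Definition Nm (R : realType) n (r : R) (h : 'rV[R]_n -> R) : R :=
  I (fun x => h x `^ r) `^ r^-1.

Section CubeNorms.
Variable R : realType.

Lemma NmE n r (h : 'rV[R]_n -> R) : Nm r h = I (fun x => h x `^ r) `^ r^-1.
Proof. by rewrite Nm.unlock. Qed.

Lemma Nm_ge0 n r (h : 'rV[R]_n -> R) : 0 <= Nm r h.
Proof. by rewrite NmE powR_ge0. Qed.

Lemma Nm_le n r (h k : 'rV[R]_n -> R) : 0 < r -> cnn h -> cnn k ->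
  (forall x, cube x -> h x <= k x) -> Nm r h <= Nm r k.
Proof.
move=> r0 ch ck hk.
have cp m : cnn m -> cnn (fun x : 'rV[R]_n => m x `^ r).
  by apply: cnn_powR; exact: ltW.
rewrite !NmE; apply: powR_le; [by rewrite invr_ge0 ltW|by apply: I_ge0; exact: cp|].
apply: I_le; [exact: cp|exact: cp|move=> x cx].
apply: powR_le; [exact: ltW|by case: ch|exact: hk].
Qed.

Lemma Nm_cst n r (c : R) : 0 < r -> 0 <= c -> Nm r (fun _ : 'rV[R]_n => c) = c.
Proof. by move=> r0 c0; rewrite NmE I_cst ?powR_ge0// powRK// gt_eqF. Qed.

Lemma Nm_add n r (h k : 'rV[R]_n -> R) : 1 <= r -> cnn h -> cnn k ->
  Nm r (fun x => h x + k x) <= 4 * (Nm r h + Nm r k).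
Proof.
move=> r1 ch ck; have r0 : 0 < r by exact: lt_le_trans r1.
have cp m : cnn m -> cnn (fun x : 'rV[R]_n => m x `^ r).
  by apply: cnn_powR; exact: ltW.
have ch' := cp _ ch; have ck' := cp _ ck.
have H : I (fun x => (h x + k x) `^ r) <=
   2 `^ r * (I (fun x => h x `^ r) + I (fun x => k x `^ r)).
  rewrite -I_add// -I_scale ?powR_ge0//; last exact: cnnD.
  apply: I_le; [by apply: cp; exact: cnnD|by apply: cnnZ; [exact: powR_ge0|exact: cnnD]|].
  by move=> x _; apply: powR_addle; [exact: ltW|case: ch|case: ck].
have IE' m : cnn m -> I (fun x : 'rV[R]_n => m x `^ r) = Nm r m `^ r.
  by move=> cm; rewrite NmE powRVK ?gt_eqF// I_ge0//; exact: cp.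
rewrite !IE'// in H; last exact: cnnD.
by apply: powR_quasi_norm H; rewrite ?Nm_ge0.
Qed.

Lemma ln_Nm n r (h : 'rV[R]_n -> R) : ln (Nm r h) = ln (I (fun x => h x `^ r)) / r.
Proof. by rewrite NmE ln_powR mulrC. Qed.

Lemma Nm_scale_le n r K (h k : 'rV[R]_n -> R) : 0 < r -> 0 <= K -> cnn h -> cnn k ->
  I (fun x => h x `^ r) <= K * I (fun x => k x `^ r) -> Nm r h <= K `^ r^-1 * Nm r k.
Proof.
move=> r0 K0 ch ck H; rewrite !NmE -powRM//; last by apply: I_ge0; apply: cnn_powR => //; exact: ltW.
apply: powR_le => //; first by rewrite invr_ge0 ltW.
by apply: I_ge0; apply: cnn_powR => //; exact: ltW.
Qed.

Lemma Nm1 n (h : 'rV[R]_n -> R) : cnn h -> Nm 1 h = I h.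
Proof.
move=> ch; rewrite NmE (_ : (fun x => h x `^ 1) = h) ?invr1 ?powRr1 ?I_ge0//.
by apply/funext => x; rewrite powRr1//; case: ch.
Qed.

Lemma Nm_mono n a b (h : 'rV[R]_n -> R) : 0 < a -> a <= b -> cnn h -> Nm a h <= Nm b h.
Proof. by rewrite !NmE; exact: I_Lp_mono. Qed.

Lemma I_gt0 n (h : 'rV[R]_n -> R) : continuous h -> (forall x, 0 < h x) -> 0 < I h.
Proof.
move=> ch h0.
have chn : cnn h by split=> // x; exact: ltW.
have [||c _ hc] := @EVT_max_rV R n (fun x => - h x) (@cube R n) _ (@cube_compact R n).
- by exists 0 => j; rewrite mxE lexx ler01.
- by apply: continuous_subspaceT => x; apply: continuousN; exact: ch.
- apply: (lt_le_trans (h0 c)); rewrite -(I_cst n (ltW (h0 c))).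
  apply: I_le => //; first by apply: cnn_cst; exact: ltW.
  by move=> x cx; rewrite -lerN2; apply: hc; rewrite inE.
Qed.

Lemma Nm_gt0 n r (h : 'rV[R]_n -> R) : 0 <= r -> continuous h -> (forall x, 0 < h x) ->
  0 < Nm r h.
Proof.
move=> r0 ch h0; rewrite NmE; apply: powR_gt0; apply: I_gt0 => [|x]; last exact: powR_gt0.
have cn : cnn h by split=> // x; exact: ltW.
by case: (cnn_powR r0 cn).
Qed.

Lemma DG_subr n (h g : 'rV[R]_n -> R) c : DG h g -> DG (fun x => h x - c) g.
Proof.
move=> H x i; have [d dd dg] := H x i; exists d => //.
rewrite -[d]subr0; exact: is_deriveB.
Qed.

Lemma is_derive_powR (x a : R) : 0 < x ->
  is_derive x (1 : R) (fun y => y `^ a) (a * x `^ (a - 1)).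
Proof.
move=> x0; have xi : x \in `]0, +oo[%R by rewrite in_itv/= andbT.
by apply: DeriveDef; [exact: derivable_powR|rewrite -derive1E powR_derive1].
Qed.

Lemma DG_powR n (h g : 'rV[R]_n -> R) a : 0 <= a -> (forall x, 0 < h x) -> DG h g ->
  DG (fun x => h x `^ a) (fun x => a * h x `^ (a - 1) * g x).
Proof.
move=> a0 h0 H x i; have [d dd dg] := H x i.
exists (a * h x `^ (a - 1) * d); last first.
  by rewrite normrM ger0_norm ?mulr_ge0 ?powR_ge0// ler_wpM2l ?mulr_ge0 ?powR_ge0.
apply: (@is_derive1_comp _ (fun y => y `^ a) (fun s : R => h (x + s *: delta_mx 0 i))).
  by rewrite scale0r addr0; exact: is_derive_powR.
Qed.

(* A smooth positive substitute for |F|, decreasing to it as e tends to 0. *)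
Definition smabs n (e : R) (F : 'rV[R]_n -> R) x := (F x ^+ 2 + e ^+ 2) `^ 2^-1.

Lemma smabs_gt0 n e (F : 'rV[R]_n -> R) x : 0 < e -> 0 < smabs e F x.
Proof. by move=> e0; apply: powR_gt0; rewrite ltr_wpDl ?sqr_ge0// exprn_gt0. Qed.

Lemma smabs_ge n e (F : 'rV[R]_n -> R) x : `|F x| <= smabs e F x.
Proof.
rewrite /smabs powR12_sqrt ?addr_ge0 ?sqr_ge0// -sqrtr_sqr ler_wsqrtr//.
by rewrite lerDl sqr_ge0.
Qed.

Lemma smabs_le n e (F : 'rV[R]_n -> R) x : 0 <= e -> smabs e F x <= `|F x| + e.
Proof.
move=> e0; rewrite /smabs powR12_sqrt ?addr_ge0 ?sqr_ge0//.
rewrite -[leRHS]ger0_norm ?addr_ge0// -sqrtr_sqr ler_wsqrtr//.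
by rewrite sqrrD real_normK ?num_real// lerD2r lerDl mulrn_wge0// mulr_ge0.
Qed.

Lemma smabs_cnn n e (F : 'rV[R]_n -> R) : continuous F -> cnn (smabs e F).
Proof.
move=> cF; apply: cnn_powR => //.
rewrite (_ : (fun x => _) = fun x => `|F x| * `|F x| + e ^+ 2); last first.
  by apply/funext => x; rewrite -expr2 real_normK ?num_real.
apply: cnnD; last by apply: cnn_cst; exact: sqr_ge0.
by apply: cnnM; exact: cnn_norm.
Qed.

(** The derivative is [F F' (F^2 + e^2)^(-1/2)], and [|F|] is at most the root of [F^2 + e^2]; hence
    the same majorant [g] serves for every [e]. *)
Lemma DG_smabs n e (F g : 'rV[R]_n -> R) : 0 < e -> DG F g -> DG (smabs e F) g.
Proof.
move=> e0 H x i; have [d dd dg] := H x i.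
set S := F x ^+ 2 + e ^+ 2.
have S0 : 0 < S by rewrite ltr_wpDl ?sqr_ge0// exprn_gt0.
exists (2^-1 * S `^ (2^-1 - 1) * (2 * F x * d)); last first.
  have -> : 2^-1 * S `^ (2^-1 - 1) * (2 * F x * d) = (F x * S `^ (2^-1 - 1)) * d.
    by field.
  rewrite normrM; apply: le_trans dg; rewrite ler_piMl// normrM [`|_ `^ _|]ger0_norm ?powR_ge0//.
  apply: (@le_trans _ _ (S `^ 2^-1 * S `^ (2^-1 - 1))).
    by rewrite ler_wpM2r ?powR_ge0//; exact: (@smabs_ge n e F x).
  rewrite -powRD; last by apply/implyP => _; rewrite gt_eqF.
  by rewrite (_ : _ + _ = 0) ?powRr0//; field.
apply: (@is_derive1_comp _ (fun y => y `^ 2^-1)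
   (fun s : R => F (x + s *: delta_mx 0 i) ^+ 2 + e ^+ 2)).
  by rewrite scale0r addr0; exact: is_derive_powR.
rewrite -[X in is_derive _ _ _ X]addr0; apply: is_deriveD.
rewrite (_ : 2 * F x * d = F x * d + F x * d); last by ring.
have := @is_deriveM _ _ (fun s : R => F (x + s *: delta_mx 0 i)) (fun s : R => F (x + s *: delta_mx 0 i)) 0 1 d d dd dd.
by rewrite /= scale0r addr0.
Qed.

End CubeNorms.

(** * The Gagliardo-Nirenberg inequality for positive functions, in logarithms *)

Section GagliardoNirenberg.
Variable R : realType.

Lemma ln_le (x y : R) : 0 < x -> x <= y -> ln x <= ln y.
Proof. by move=> x0 xy; rewrite ler_ln// posrE (lt_le_trans x0). Qed.

(* Logarithmic bookkeeping: x b = ln (I (G^b)) and a p = ln of the L^p norm of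
   G + |grad G|. The clauses are Hoelder's inequality, the Sobolev inequality for
   powers of G, and monotonicity of normalised norms; all the exponent algebra of
   the Gagliardo-Nirenberg inequality takes place at this linear level. *)
Definition logsys (N : R) (x a : R -> R) := [/\ x 0 = 0,
  forall b c s t, 0 <= s -> 0 <= t -> s + t = 1 -> 0 <= b -> 0 <= c ->
    x (s * b + t * c) <= s * x b + t * x c,
  forall Q P l p, 1 <= p -> 0 <= Q -> 0 <= P -> 1 <= l -> P * (1 - p^-1) = l - 1 ->
    x (Q / N + l) <= ln l + x Q / N + (1 - p^-1) * x P + a p &
  forall p p', 1 <= p -> p <= p' -> a p <= a p'].

(** Convexity of [x] between 0 and [c], with [x 0 = 0]. *)
Lemma logsys_mono N x a b c : logsys N x a -> 0 <= b -> b <= c -> 0 < c ->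
  x b <= b / c * x c.
Proof.
move=> [x0 conv _ _] b0 bc c0.
have := conv c 0 (b / c) (1 - b / c).
rewrite mulr0 addr0 mulfVK ?gt_eqF// x0 mulr0 addr0; apply=> //.
- by rewrite divr_ge0// ltW.
- by rewrite subr_ge0 ler_pdivrMr// mul1r.
- by rewrite addrC subrK.
- exact: ltW.
Qed.

Lemma logsys_interp N x a u b c : logsys N x a -> 0 <= u -> u <= b -> b <= c -> u < c ->
  (c - u) * x b <= (c - b) * x u + (b - u) * x c.
Proof.
move=> [x0 conv _ _] u0 ub bc uc.
have d0 : 0 < c - u by rewrite subr_gt0.
have := conv u c ((c - b) / (c - u)) ((b - u) / (c - u)).
rewrite !divr_ge0 ?subr_ge0 ?(ltW uc)// => /(_ isT isT).
have -> : (c - b) / (c - u) + (b - u) / (c - u) = 1 by field; rewrite gt_eqF.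
move=> /(_ erefl u0 (ltW (le_lt_trans u0 uc))).
have -> : (c - b) / (c - u) * u + (b - u) / (c - u) * c = b by field; rewrite gt_eqF.
move=> H; have := H; rewrite -(ler_pM2l d0) => /le_trans; apply.
rewrite le_eqVlt; apply/orP; left; apply/eqP; field; by rewrite gt_eqF.
Qed.

(** The embedding into L^(1/s1). It is the third clause of [logsys] for exponents at which all
    powers of [G] combine into the single unknown [x (1/s1)], which is then absorbed on the left. *)
Lemma sobolev_log N s1 p x a : 1 <= N -> 1 <= p -> 0 < s1 -> s1 <= p^-1 ->
  p^-1 <= s1 + N^-1 -> logsys N x a ->
  s1 * x s1^-1 <= ln (Num.max 1 (s1^-1 * (1 - N^-1))) + a p.
Proof.
move=> N1 p1 s10 s1p ps1 sys; have [x0 conv star amono] := sys.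
have p0 : 0 < p by exact: lt_le_trans p1.
have N0 : 0 < N by exact: lt_le_trans N1.
have NV0 : 0 < N^-1 by rewrite invr_gt0.
have NV1 : N^-1 <= 1 by rewrite invf_le1.
have pV1 : p^-1 <= 1 by rewrite invf_le1.
pose p1' := s1^-1; have p10 : 0 < p1' by rewrite invr_gt0.
have sp : s1 * p1' = 1 by rewrite mulfV// gt_eqF.
have [le1|gt1] := leP (s1 + N^-1) 1.
  (* [pt <= p] is the exponent whose critical Sobolev exponent is [1/s1]. With [Q = P = 1/s1] and
     [Q/N + l = 1/s1], the right side carries [(1 - s1) x (1/s1)]. *)
  pose pt := (s1 + N^-1)^-1.
  have spos : 0 < s1 + N^-1 by rewrite addr_gt0.
  have ptV : pt^-1 = s1 + N^-1 by rewrite invrK.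
  have pt1 : 1 <= pt by rewrite -[1]invr1 lef_pV2 ?posrE.
  have ptp : pt <= p by rewrite -[p]invrK lef_pV2 ?posrE ?invr_gt0.
  pose l := p1' * (1 - N^-1).
  have l1 : 1 <= l by rewrite -sp mulrC /l ler_wpM2l ?(ltW p10)//; lra.
  have Pl : p1' * (1 - pt^-1) = l - 1.
    have -> : p1' * (1 - pt^-1) = l - s1 * p1' by rewrite ptV /l; ring.
    by rewrite sp.
  have := star p1' p1' l pt pt1 (ltW p10) (ltW p10) l1 Pl.
  have -> : p1' / N + l = p1' by rewrite /l; ring.
  have := amono _ _ pt1 ptp.
  have : ln l <= ln (Num.max 1 l) by apply: ln_le; [lra|rewrite le_max lexx orbT].
  rewrite ptV -/p1' -/l.
  move: (x p1') (a p) (a pt) (ln l) (ln (Num.max 1 l)) => y b b' c c'; lra.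
have p1'1 : 1 <= p1' by rewrite -[1]invr1 lef_pV2 ?posrE// (le_trans s1p).
(* Here [pt] would be below 1. The case [p = 1], [l = 1] is used instead, and [Q <= 1/s1] lets [x Q]
   be bounded through [logsys_mono]. *)
pose Q := N * (p1' - 1).
have Q0 : 0 <= Q by rewrite mulr_ge0 ?subr_ge0// ltW.
have NVN : N * N^-1 = 1 by rewrite mulfV// gt_eqF.
have Qp : Q <= p1'.
  have h1 : p1' - 1 <= p1' * N^-1.
    rewrite -sp [s1 * _]mulrC -{1}[p1']mulr1 -mulrBr ler_wpM2l ?(ltW p10)//; lra.
  have -> : p1' = N * (p1' * N^-1) by rewrite mulrCA NVN mulr1.
  by rewrite /Q ler_wpM2l// ltW.
have Pl : 0 * (1 - 1^-1) = 1 - 1 :> R by rewrite mul0r subrr.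
have := star Q 0 1 1 (lexx 1) Q0 (lexx 0) (lexx 1) Pl.
rewrite invr1 subrr mul0r ln1 add0r addr0.
have -> : Q / N + 1 = p1' by rewrite /Q [N * _]mulrC mulfK ?gt_eqF// subrK.
move=> H1.
have H2 := logsys_mono sys Q0 Qp p10.
have H3 := amono _ _ (lexx 1) p1.
have H4 : 0 <= ln (Num.max 1 (p1' * (1 - N^-1))) by apply: ln_ge0; rewrite le_max lexx.
have H6 : (p1' - 1) / p1' = 1 - s1 by rewrite /p1' invrK mulrBl mulVf ?gt_eqF// mul1r.
have H5 : x Q / N <= (1 - s1) * x p1'.
  rewrite ler_pdivrMr// (le_trans H2)// -H6 /Q.
  by rewrite (_ : N * _ / _ * _ = (p1' - 1) / p1' * x p1' * N)//; ring.
move: H1 H3 H4 H5; rewrite -/p1'.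
move: (x p1') (a p) (a 1) (x Q / N) (ln _) => y b b' c c'; lra.
Qed.

(** Exponents for the absorption argument. The third clause of [logsys] is to bound [x q0] by [x Q]
    and [x P], both of which must lie between [u] and [q0] so as to be interpolated. *)
Lemma gn_params (N s1 p u q : R) : 1 <= N -> 1 <= p -> s1 <= 0 -> s1 <= p^-1 ->
  p^-1 <= s1 + N^-1 -> 1 <= u -> u < q ->
  exists q0 P Q l pt : R,
   [/\ q <= q0, u < q0, u <= P <= q0, u <= Q <= q0 & 1 <= l] /\
   [/\ 1 <= pt, pt <= p, pt^-1 = s1 + N^-1, P * (1 - pt^-1) = l - 1 & Q / N = q0 - l].
Proof.
move=> N1 p1 s10 s1p ps1 u1 uq.
have p0 : 0 < p by exact: lt_le_trans p1.
have N0 : 0 < N by exact: lt_le_trans N1.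
have u0 : 0 < u by exact: lt_le_trans u1.
have NV0 : 0 < N^-1 by rewrite invr_gt0.
have NV1 : N^-1 <= 1 by rewrite invf_le1.
have pVp : 0 < p^-1 by rewrite invr_gt0.
have NVN : N * N^-1 = 1 by rewrite mulfV// gt_eqF.
have spos : 0 < s1 + N^-1 by lra.
have [pi0 pi0E] : exists z, z = 1 - (s1 + N^-1) by eexists.
have pi1 : 1 - N^-1 <= pi0 by rewrite pi0E; lra.
have pi2 : pi0 <= 1 by rewrite pi0E; lra.
have pi3 : 0 <= pi0 by lra.
(* Two lower bounds ensure [u <= Q]: [1 + 2 u] when [P = u], and [u + N] when [Q = q0 - N]. *)
have [q0 [q0q q0N q0u]] : exists q0, [/\ q <= q0, u + N <= q0 & 1 + 2 * u <= q0].
  exists (Num.max q (Num.max (u + N) (1 + 2 * u))).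
  by rewrite !le_max !lexx !orbT.
have uq0 : u < q0 by lra.
(* The second entry makes [l = 1 + q0 (1 - 1/N)], that is [Q = q0 - N]. If [pi0 = 0] then [N = 1],
   and the quotient is 0 because the inverse of 0 is 0, so [P = u]. *)
have [P PE] : exists P, P = Num.max u (q0 * (1 - N^-1) / pi0) by eexists.
have Pu : u <= P by rewrite PE le_max lexx.
have Pq : P <= q0.
  rewrite PE ge_max (ltW uq0) /=.
  have [pi00|pi00] := eqVneq pi0 0; first by rewrite pi00 invr0 mulr0; lra.
  rewrite ler_pdivrMr ?ler_wpM2l//; first by lra.
  by rewrite lt_def pi00.
have [l lE] : exists l, l = 1 + P * pi0 by eexists.
have l1 : 1 <= l by rewrite lE lerDl mulr_ge0//; lra.
have lb : 1 + q0 * (1 - N^-1) <= l.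
  rewrite lE lerD2l.
  have [pi00|pi00] := eqVneq pi0 0.
    have -> : 1 - N^-1 = 0 by lra.
    by rewrite pi00 !mulr0.
  rewrite -ler_pdivrMr; first by rewrite PE le_max lexx orbT.
  by rewrite lt_def pi00.
exists q0, P, (N * (q0 - l)), l, (s1 + N^-1)^-1; split; split=> //.
- by rewrite Pu Pq.
- apply/andP; split; last first.
    have h : q0 - l <= q0 * N^-1 - 1 by move: lb; rewrite mulrBr mulr1; lra.
    have : N * (q0 - l) <= N * (q0 * N^-1 - 1) by rewrite ler_wpM2l// ltW.
    by rewrite [X in _ <= X]mulrBr mulrCA NVN !mulr1; lra.
  have [c1|c1] := leP (q0 * (1 - N^-1) / pi0) u.
    have PE' : P = u by rewrite PE; apply/max_idPl.
    have h : u <= q0 - l.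
      have : u * pi0 <= u by rewrite ler_piMr// ltW.
      by rewrite lE PE'; lra.
    apply: (le_trans h); rewrite ler_peMl//; lra.
  have PE' : P = q0 * (1 - N^-1) / pi0 by rewrite PE; apply/max_idPr; exact: ltW.
  have pi00 : pi0 != 0.
    by apply/eqP => pi00; move: c1; rewrite pi00 invr0 mulr0; lra.
  have -> : l = 1 + q0 * (1 - N^-1) by rewrite lE PE' mulfVK.
  have -> : N * (q0 - (1 + q0 * (1 - N^-1))) = q0 * (N * N^-1) - N by ring.
  by rewrite NVN mulr1; lra.
- by rewrite -[1]invr1 lef_pV2 ?posrE//; lra.
- by rewrite -[p]invrK lef_pV2 ?posrE ?invr_gt0.
- by rewrite invrK.
- by rewrite invrK -pi0E lE; ring.
- by rewrite [N * _]mulrC mulfK// gt_eqF.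
Qed.

(** As [Q/N + P (1 - 1/pt) = q0 - 1], interpolating both terms between [u] and [q0] leaves on the
    right the coefficient [(q0 - u) - (1 - u s1)] of [xq]. The difference [1 - u s1] survives on the
    left; it is positive when [s1 <= 0]. *)
Lemma gn_absorb (N q0 u s1 P Q l xu xq xQ xP ap lnl : R) : 0 < N -> u < q0 ->
  0 <= 1 - (s1 + N^-1) -> P * (1 - (s1 + N^-1)) = l - 1 -> Q / N = q0 - l ->
  xq <= lnl + xQ / N + (1 - (s1 + N^-1)) * xP + ap ->
  (q0 - u) * xQ <= (q0 - Q) * xu + (Q - u) * xq ->
  (q0 - u) * xP <= (q0 - P) * xu + (P - u) * xq ->
  (1 - u * s1) * xq <= (q0 - u) * (lnl + ap) + (1 - q0 * s1) * xu.
Proof.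
move=> N0 uq0 pi0 Pl QN S iQ iP.
have d0 : 0 < q0 - u by lra.
have T1 : (q0 - u) * (xQ / N) <= ((q0 - Q) * xu + (Q - u) * xq) / N.
  by rewrite mulrA ler_pM2r// invr_gt0.
have T2 : (q0 - u) * ((1 - (s1 + N^-1)) * xP) <=
    (1 - (s1 + N^-1)) * ((q0 - P) * xu + (P - u) * xq).
  by rewrite mulrCA ler_wpM2l.
have T3 : (q0 - u) * xq <= (q0 - u) * (lnl + xQ / N + (1 - (s1 + N^-1)) * xP + ap).
  by rewrite ler_pM2l.
have T4 : ((q0 - Q) * xu + (Q - u) * xq) / N +
    (1 - (s1 + N^-1)) * ((q0 - P) * xu + (P - u) * xq) =
    (1 - q0 * s1) * xu + (q0 - u) * xq - (1 - u * s1) * xq.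
  transitivity ((q0 * (1 - s1) - (Q / N + P * (1 - (s1 + N^-1)))) * xu +
     ((Q / N + P * (1 - (s1 + N^-1))) - u * (1 - s1)) * xq); first by ring.
  by rewrite QN Pl; ring.
rewrite !mulrDr in T3; rewrite [X in _ <= X + _]mulrDr.
have F (t1 t2 t3 t4 t5 t6 t7 t8 t9 : R) : t1 <= t5 -> t2 <= t6 ->
  t5 + t6 = t9 + t7 - t8 -> t7 <= t4 + t1 + t2 + t3 -> t8 <= t4 + t3 + t9 by lra.
exact: F T1 T2 T4 T3.
Qed.

(* For s1 <= 0 the bound is first proved for one large exponent q0, by
   interpolating the two norms of the right-hand side between u and q0 and
   absorbing, and then interpolated down to q. *)
Lemma gn_log_nonpos N s1 p u q : 1 <= N -> 1 <= p -> s1 <= 0 -> s1 <= p^-1 ->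
  p^-1 <= s1 + N^-1 -> 1 <= u -> u < q ->
  exists2 C, 0 <= C & forall x a, logsys N x a ->
    (1 - u * s1) * x q <= (q - u) * (C + a p) + (1 - s1 * q) * x u.
Proof.
move=> N1 p1 s10 s1p ps1 u1 uq.
have [q0 [P [Q [l [pt []]]]]] := gn_params N1 p1 s10 s1p ps1 u1 uq.
move=> [q0q uq0 /andP[Pu Pq] /andP[Qu Qq] l1] [pt1 ptp ptV Pl QN].
have u0 : 0 < u by exact: lt_le_trans u1.
exists (ln l); first exact: ln_ge0.
move=> x a sys; have [x0 conv star amono] := sys.
have Q0 : 0 <= Q by exact: le_trans (ltW u0) Qu.
have P0 : 0 <= P by exact: le_trans (ltW u0) Pu.
have := star Q P l pt pt1 Q0 P0 l1 Pl; rewrite QN subrK ptV => S.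
have {}S : x q0 <= ln l + x Q / N + (1 - (s1 + N^-1)) * x P + a p.
  by apply: (le_trans S); rewrite lerD2l; exact: amono.
have iQ := logsys_interp sys (ltW u0) Qu Qq uq0.
have iP := logsys_interp sys (ltW u0) Pu Pq uq0.
have iq := logsys_interp sys (ltW u0) (ltW uq) q0q uq0.
have pi0 : 0 <= 1 - (s1 + N^-1) by rewrite -ptV subr_ge0 invf_le1// (lt_le_trans _ pt1).
rewrite ptV in Pl.
have S2 := gn_absorb (lt_le_trans ltr01 N1) uq0 pi0 Pl QN S iQ iP.
have d0 : 0 < q0 - u by rewrite subr_gt0.
have us0 : 0 < 1 - u * s1.
  have : u * s1 <= 0 by rewrite mulr_ge0_le0// ltW.
  by clear; move: (u * s1) => z; lra.
have quo : 0 <= q - u by rewrite subr_ge0 ltW.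
rewrite -(ler_pM2l d0).
have U1 : (1 - u * s1) * ((q0 - u) * x q) <= (1 - u * s1) * ((q0 - q) * x u + (q - u) * x q0).
  by rewrite ler_pM2l.
have U2 : (q - u) * ((1 - u * s1) * x q0) <= (q - u) * ((q0 - u) * (ln l + a p) + (1 - q0 * s1) * x u).
  by rewrite ler_wpM2l.
have U3 : (1 - u * s1) * ((q0 - q) * x u + (q - u) * x q0) =
   (1 - u * s1) * (q0 - q) * x u + (q - u) * ((1 - u * s1) * x q0) by ring.
have U4 : (1 - u * s1) * (q0 - q) * x u + (q - u) * ((q0 - u) * (ln l + a p) + (1 - q0 * s1) * x u)
  = (q0 - u) * ((q - u) * (ln l + a p) + (1 - s1 * q) * x u) by ring.
by rewrite mulrCA; apply: (le_trans U1); rewrite U3 -U4 lerD2l.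
Qed.

(** If [s1 > 0], the Sobolev embedding is followed by Hoelder between [1/s1] and [u]. If [s1 <= 0],
    then either [theta = 0] and [q = u], or [u < q] and the absorbed inequality applies. *)
Lemma gn_log N p u q theta s1 : 1 <= N -> 1 <= p -> 1 <= u -> 0 < q ->
  0 <= theta <= 1 -> s1 <= p^-1 -> p^-1 <= s1 + N^-1 ->
  q^-1 = theta * s1 + (1 - theta) / u ->
  exists2 C, 0 <= C & forall x a, logsys N x a ->
    x q / q <= C + theta * a p + (1 - theta) * (x u / u).
Proof.
move=> N1 p1 u1 q0 /andP[th0 th1] s1p ps1 qE.
have u0 : 0 < u by exact: lt_le_trans u1.
have qV0 : 0 < q^-1 by rewrite invr_gt0.
have uV0 : 0 < u^-1 by rewrite invr_gt0.
have [s10|s10] := leP s1 0; last first.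
  exists (theta * ln (Num.max 1 (s1^-1 * (1 - N^-1)))).
    by rewrite mulr_ge0//; apply: ln_ge0; rewrite le_max lexx.
  move=> x a sys; have S := sobolev_log N1 p1 s10 s1p ps1 sys.
  have [_ conv _ _] := sys.
  (* The weights are [q] times the two summands of [1/q], so they add up to 1 and have barycentre
     [q]. *)
  have := conv s1^-1 u (theta * s1 * q) ((1 - theta) / u * q).
  have -> : theta * s1 * q + (1 - theta) / u * q = 1.
    by rewrite -mulrDl -qE mulVf// gt_eqF.
  have -> : theta * s1 * q * s1^-1 + (1 - theta) / u * q * u = q.
    by field; rewrite !gt_eqF.
  have n1 : 0 <= theta * s1 * q by rewrite !mulr_ge0// ltW.
  have n2 : 0 <= (1 - theta) / u * q by rewrite !mulr_ge0 ?subr_ge0// ltW.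
  have n3 : 0 <= s1^-1 by rewrite invr_ge0 ltW.
  move=> /(_ n1 n2 erefl n3 (ltW u0)) H.
  have H2 : x q / q <= theta * (s1 * x s1^-1) + (1 - theta) * (x u / u).
    rewrite ler_pdivrMr// (le_trans H)// le_eqVlt; apply/orP; left; apply/eqP; ring.
  have := ler_wpM2l th0 S; rewrite mulrDr; lra.
have [th00|th00] := eqVneq theta 0.
  exists 0 => // x a sys; rewrite th00 mul0r addr0 add0r subr0 mul1r.
  have -> : q = u; last by [].
  by apply: invr_inj; rewrite qE th00 mul0r add0r subr0 mul1r.
have thp : 0 < theta by rewrite lt_def th00.
have us0 : 0 < 1 - u * s1.
  have : u * s1 <= 0 by rewrite mulr_ge0_le0// ltW.
  by lra.
have uqV : q * u^-1 = q * u^-1 by [].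
have qqV : q * q^-1 = 1 by rewrite mulfV// gt_eqF.
have uuV : u * u^-1 = 1 by rewrite mulfV// gt_eqF.
(* The relation for [1/q] multiplied by [u q]. With [s1 <= 0 < theta] it forces [u < q]. *)
have E1 : u = q * (theta * (u * s1) + (1 - theta)).
  have -> : theta * (u * s1) + (1 - theta) = u * q^-1.
    by rewrite qE mulrDr [u * ((1 - theta) / u)]mulrCA uuV mulr1; ring.
  by rewrite mulrCA qqV mulr1.
have E2 : q - u = q * (theta * (1 - u * s1)) by rewrite {1}E1; ring.
have uq : u < q by rewrite -subr_gt0 E2 !mulr_gt0.
have [C C0 HC] := gn_log_nonpos N1 p1 s10 s1p ps1 u1 uq.
exists (theta * C); first exact: mulr_ge0.
move=> x a sys; have := HC x a sys; rewrite E2.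
have E3 : (1 - s1 * q) * u = (1 - theta) * (1 - u * s1) * q.
  have : u = q * (theta * (u * s1) + (1 - theta)) by [].
  nra.
have -> : (1 - s1 * q) * x u = (1 - theta) * (1 - u * s1) * q * (x u / u).
  by rewrite -E3 -mulrA [u * _]mulrCA uuV mulr1.
move=> H.
have H2 : (1 - u * s1) * x q <= (1 - u * s1) * (q * (theta * C + theta * a p + (1 - theta) * (x u / u))).
  by apply: (le_trans H); rewrite le_eqVlt; apply/orP; left; apply/eqP; ring.
by move: H2; rewrite ler_pM2l// => H2; rewrite ler_pdivrMr// mulrC.
Qed.

Lemma lnM_powR (y l z w a b : R) : 0 < y -> 0 < l -> 0 < z -> 0 < w ->
  ln (y `^ a * (l * (z `^ b * w))) = a * ln y + (ln l + (b * ln z + ln w)).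
Proof. by move=> y0 l0 z0 w0; rewrite !lnM ?posrE ?mulr_gt0 ?powR_gt0// !ln_powR. Qed.

Section fixed.
Variables (n : nat) (G g : 'rV[R]_n.+1 -> R).
Hypotheses (cG : continuous G) (G0 : forall x, 0 < G x) (cg : cnn g) (dG : DG G g).
Let N : R := n.+1%:R.

Let cnnG : cnn G. Proof. by split=> // x; exact: ltW. Qed.

Let cnnGp a : 0 <= a -> cnn (fun x => G x `^ a).
Proof. by move=> a0; exact: cnn_powR. Qed.

Let X a := I (fun x => G x `^ a).
Let A p := I (fun x => (G x + g x) `^ p) `^ p^-1.

Let X_gt0 a : 0 <= a -> 0 < X a.
Proof.
by move=> a0; apply: I_gt0 => [|x]; [by case: (cnnGp a0)|exact: powR_gt0].
Qed.

Let A_gt0 p : 0 <= p -> 0 < A p.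
Proof.
move=> p0; apply: powR_gt0; apply: I_gt0 => [|x].
  by case: (cnn_powR p0 (cnnD cnnG cg)).
by apply: powR_gt0; rewrite ltr_pwDl//; case: cg.
Qed.

Let X0 : X 0 = 1.
Proof.
rewrite /X (_ : (fun x => _) = fun=> 1) ?(@I_cst R _ 1 ler01)//.
by apply/funext => x; rewrite powRr0.
Qed.

Definition lX a := ln (X a).
Definition lA p := ln (A p).

Let holderX (a b s t : R) : 0 <= s -> 0 <= t -> s + t = 1 -> 0 <= a -> 0 <= b ->
  lX (s * a + t * b) <= s * lX a + t * lX b.
Proof.
move=> s0 t0 st a0 b0.
have Xa := X_gt0 a0; have Xb := X_gt0 b0.
have H := I_holder s0 t0 st (cnnGp a0) (cnnGp b0).
rewrite /lX -!ln_powR -lnM ?posrE ?powR_gt0//.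
apply: ln_le; first by apply: X_gt0; rewrite addr_ge0// mulr_ge0.
rewrite /X (_ : (fun x => _) = fun x => (G x `^ a) `^ s * (G x `^ b) `^ t); first exact: H.
apply/funext => x; rewrite -!powRrM [a * s]mulrC [b * t]mulrC -powRD//.
by apply/implyP => _; rewrite gt_eqF.
Qed.

(* The Sobolev inequality applied to G^l, dualised against G^Q. *)
Let star (Q P l p : R) : 1 <= p -> 0 <= Q -> 0 <= P -> 1 <= l -> P * (1 - p^-1) = l - 1 ->
  lX (Q / N + l) <= ln l + lX Q / N + (1 - p^-1) * lX P + lA p.
Proof.
move=> p1 Q0 P0 l1 Pl.
have p0 : 0 < p by exact: lt_le_trans p1.
have l0 : 0 < l by exact: lt_le_trans l1.
have N0 : 0 < N by rewrite /N ltr0n.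
have pV : 0 <= 1 - p^-1 by rewrite subr_ge0 invf_le1.
have pV0 : 0 <= p^-1 by rewrite invr_ge0 ltW.
have cGg := cnnD cnnG cg.
have cGgp : cnn (fun x => (G x + g x) `^ p) by apply: cnn_powR => //; exact: ltW.
have l10 : 0 <= l - 1 by rewrite subr_ge0.
have cg' : cnn (fun x => l * G x `^ (l - 1) * g x).
  by apply: cnnM => //; apply: cnnZ; [exact: ltW|exact: cnnGp].
have S := sobolev_dual (cnnGp Q0) (cnnGp (ltW l0)) cg' (DG_powR (ltW l0) G0 dG).
have S1 : X (Q / N + l) <= X Q `^ N^-1 * I (fun x => G x `^ l + l * G x `^ (l - 1) * g x).
  rewrite {1}/X (_ : (fun x => _) = fun x => (G x `^ Q) `^ N^-1 * G x `^ l)//.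
  apply/funext => x; rewrite -powRrM -powRDp// ltr_wpDl// divr_ge0// ltW.
(* Pointwise, [l >= 1] gives [G^l + l G^(l-1) g <= l G^(l-1) (G + g)]. The relation between [P] and
   [l] writes [G^(l-1)] as [(G^P)^(1 - 1/p)], ready for Hoelder. *)
have S2 : I (fun x => G x `^ l + l * G x `^ (l - 1) * g x) <= l * (X P `^ (1 - p^-1) * A p).
  apply: (@le_trans _ _ (l * I (fun x => (G x `^ P) `^ (1 - p^-1) * ((G x + g x) `^ p) `^ p^-1))).
    have cH : cnn (fun x => (G x `^ P) `^ (1 - p^-1) * ((G x + g x) `^ p) `^ p^-1).
      by apply: cnnM; apply: cnn_powR => //; exact: cnnGp.
    rewrite -I_scale//; last exact: ltW.
    apply: I_le.
    - by apply: cnnD => //; apply: cnnGp; exact: ltW.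
    - by apply: cnnZ => //; exact: ltW.
    move=> x _; have Gx := G0 x; have gx : 0 <= g x by case: cg.
    rewrite -powRrM Pl powRK ?gt_eqF//; last by rewrite addr_ge0// ltW.
    have -> : G x `^ l = G x * G x `^ (l - 1) by rewrite mulr_powRB1// ltW.
    have := powR_ge0 (G x) (l - 1); move: (G x `^ (l - 1)) => y y0.
    move: (G x) (g x) Gx gx => z w z0 w0.
    have H1 : z * y <= l * (z * y) by rewrite ler_peMl// mulr_ge0// ltW.
    have -> : l * (y * (z + w)) = l * (z * y) + l * y * w by ring.
    by rewrite lerD2r.
  rewrite ler_wpM2l ?(ltW l0)//.
  by apply: I_holder => //; [rewrite subrK|exact: cnnGp].
have XQ := X_gt0 Q0; have XP := X_gt0 P0; have Ap := A_gt0 (ltW p0).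
have S3 : X (Q / N + l) <= X Q `^ N^-1 * (l * (X P `^ (1 - p^-1) * A p)).
  by apply: (le_trans S1); rewrite ler_wpM2l ?powR_ge0.
have Xl : 0 < X (Q / N + l).
  by apply: X_gt0; rewrite addr_ge0 ?divr_ge0 ?(ltW l0) ?(ltW N0).
have := ln_le Xl S3; rewrite (lnM_powR _ _ XQ l0 XP Ap) => /le_trans; apply.
by rewrite /lX /lA [ln (X Q) / N]mulrC !addrA [ln l + _]addrC.
Qed.

Let lA_mono p p' : 1 <= p -> p <= p' -> lA p <= lA p'.
Proof.
move=> p1 pp'; have p0 : 0 < p by exact: lt_le_trans p1.
apply: ln_le; first by apply: A_gt0; exact: ltW.
by apply: I_Lp_mono => //; exact: cnnD.
Qed.


Lemma logsys_cube : logsys N lX lA.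
Proof.
split; first by rewrite /lX X0 ln1.
- exact: holderX.
- exact: star.
- exact: lA_mono.
Qed.

End fixed.
End GagliardoNirenberg.

(** * The Gagliardo-Nirenberg inequality on the cube for functions of any sign *)

Section CubeGN.
Variable R : realType.

Lemma le_expR_ln (x y z C t : R) : 0 < x -> 0 < y -> 0 < z ->
  ln x <= C + t * ln y + (1 - t) * ln z -> x <= expR C * (y `^ t * z `^ (1 - t)).
Proof.
move=> x0 y0 z0 H.
rewrite -ler_ln ?posrE ?mulr_gt0 ?powR_gt0 ?expR_gt0//.
rewrite lnM ?posrE ?mulr_gt0 ?powR_gt0 ?expR_gt0// expRK.
by rewrite lnM ?posrE ?powR_gt0// !ln_powR addrA.
Qed.

Lemma gn_positive n p u q theta s1 : 1 <= p -> 1 <= u -> 0 < q ->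
  0 <= theta <= 1 -> s1 <= p^-1 -> p^-1 <= s1 + n.+1%:R^-1 ->
  q^-1 = theta * s1 + (1 - theta) / u ->
  exists2 K : R, 0 < K & forall G g : 'rV[R]_n.+1 -> R,
    continuous G -> (forall x, 0 < G x) -> cnn g -> DG G g ->
    Nm q G <= K * (Nm p (fun x => G x + g x) `^ theta * Nm u G `^ (1 - theta)).
Proof.
move=> p1 u1 q0 th s1p ps1 qE.
have N1 : 1 <= n.+1%:R :> R by rewrite ler1n.
have [C C0 HC] := gn_log N1 p1 u1 q0 th s1p ps1 qE.
exists (expR C); first exact: expR_gt0.
move=> G g cG G0 cg dG.
have H := HC _ _ (logsys_cube cG G0 cg dG).
have cGn : cnn G by split=> // x; exact: ltW.
have p0 : 0 <= p by exact: le_trans p1.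
have u0 : 0 <= u by exact: le_trans u1.
have Gg0 x : 0 < G x + g x by rewrite ltr_pwDl//; case: cg.
have Npg := Nm_gt0 p0 (cnnD cGn cg).1 Gg0.
apply: (le_expR_ln (Nm_gt0 (ltW q0) cG G0) Npg (Nm_gt0 u0 cG G0)).
by move: H; rewrite !ln_Nm /lX /lA ln_powR [p^-1 * _]mulrC.
Qed.

Lemma powR_norm_continuous0 (a : R) : 0 <= a -> continuous (fun x : R => `|x| `^ a).
Proof.
rewrite le_eqVlt => /predU1P[<-|]; last exact: powR_norm_continuous.
by under eq_fun do rewrite powRr0; exact: cst_continuous.
Qed.

(** Removes the regularisation: the right side is continuous in [e] at 0, also where [a] or [b]
    vanishes or an exponent is 0. *)
Lemma powR_limit (X K a b theta : R) : 0 <= theta <= 1 -> 0 <= a -> 0 <= b ->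
  (forall e, 0 < e -> X <= K * ((a + e) `^ theta * (b + e) `^ (1 - theta))) ->
  X <= K * (a `^ theta * b `^ (1 - theta)).
Proof.
move=> /andP[th0 th1] a0 b0 H.
pose phi (e : R) := K * (`|a + e| `^ theta * `|b + e| `^ (1 - theta)).
have cphi : {for 0, continuous phi}.
  have caux c t : 0 <= t -> continuous (fun e : R => `|c + e| `^ t).
    move=> t0 x; apply: (@continuous_comp _ _ _ (fun e => c + e) (fun y => `|y| `^ t)).
      by apply: continuousD; [exact: cst_continuous|exact: cvg_id].
    exact: powR_norm_continuous0.
  apply: continuousM; first exact: cst_continuous.
  by apply: continuousM; apply: caux => //; rewrite subr_ge0.
have phi0 : phi 0 = K * (a `^ theta * b `^ (1 - theta)).
  by rewrite /phi !addr0 !ger0_norm.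
rewrite -phi0 leNgt; apply/negP => lt.
have /cvgrPdist_lt /(_ (X - phi 0)) := cphi.
rewrite subr_gt0 => /(_ lt) [d /= d0 Hd].
have d20 : 0 < d / 2 by rewrite divr_gt0.
have := Hd (d / 2); rewrite /= sub0r normrN ger0_norm ?(ltW d20)//.
have dd : d / 2 < d by rewrite ltr_pdivrMr// ltr_pMr// ltr1n.
move=> /(_ dd); rewrite distrC => /(le_lt_trans (ler_norm _)); rewrite ltrD2r.
rewrite {1}/phi !ger0_norm ?addr_ge0 ?(ltW d20)//.
by rewrite ltNge H.
Qed.

Lemma powR_scale2 (M a b t : R) : 1 <= M -> 0 <= a -> 0 <= b ->
  (M * a) `^ t * (M * b) `^ (1 - t) <= M * (a `^ t * b `^ (1 - t)).
Proof.
move=> M1 a0 b0; have M0 : 0 <= M by exact: le_trans M1.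
rewrite !powRM// mulrACA -powRDp; last by rewrite addrC subrK.
by rewrite addrC subrK powRr1.
Qed.

Lemma I_le_Nm n p (h : 'rV[R]_n -> R) : 1 <= p -> cnn h -> I h <= Nm p h.
Proof.
by move=> p1 ch; rewrite -Nm1//; exact: Nm_mono.
Qed.

(** The constant has to be controlled by the L^1 norm of [f] as well, since that norm alone may pay
    for it. The Poincare constant only satisfies [|c0| <= I |f| + K1' Nm p g]. *)
Lemma poincare_normalized n p : 1 <= p -> exists2 K : R, 1 <= K &
  forall f g : 'rV[R]_n -> R, continuous f -> cnn g -> DG f g ->
  exists2 c : R, Nm p (fun x => `|f x - c|) <= K * Nm p g & `|c| <= K * I (fun x => `|f x|).
Proof.
move=> p1; have p0 : 0 < p by exact: lt_le_trans p1.
have [K1 K10 HK] := @poincare R n p p1.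
pose K1' := K1 `^ p^-1; have K1'0 : 0 <= K1' by exact: powR_ge0.
exists (8 * K1' + 4); first by lra.
move=> f g cf cg dg.
have [c0 Hc] := HK f g cf cg dg.
have cgp : cnn (fun x => g x `^ p) by apply: cnn_powR => //; exact: ltW.
have cfc c : cnn (fun x => `|f x - c|) by exact: cnn_dist.
have cff : cnn (fun x => `|f x|) by exact: cnn_norm.
have P1 : Nm p (fun x => `|f x - c0|) <= K1' * Nm p g.
  exact: Nm_scale_le.
have P2 : `|c0| <= I (fun x => `|f x|) + K1' * Nm p g.
  apply: (@le_trans _ _ (I (fun x => `|f x|) + I (fun x => `|f x - c0|))); last first.
    by rewrite lerD2l (le_trans _ P1)// I_le_Nm.
  rewrite -I_add// -(@I_cst R n `|c0|)//; apply: I_le.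
  - exact: cnn_cst.
  - exact: cnnD.
  move=> x _; have := ler_normB (f x) (f x - c0).
  by rewrite subKr.
have g0 : 0 <= Nm p g by exact: Nm_ge0.
have f0 : 0 <= I (fun x => `|f x|) by exact: I_ge0.
have P3 : Nm p (fun x => `|f x - 0|) <= 4 * (Nm p (fun x => `|f x - c0|) + `|c0|).
  rewrite -(@Nm_cst R n p `|c0| p0)//.
  apply: le_trans (Nm_add p1 (cfc c0) (cnn_cst _ (normr_ge0 c0))).
  apply: Nm_le => //.
    by apply: cnnD => //; exact: cnn_cst.
  by move=> x _; rewrite subr0 -{1}[f x](subrK c0) ler_normD.
(* If the gradient is the smaller quantity, [c0] is already controlled by [I |f|]. Otherwise [I |f|]
   is below the gradient norm, so [f] itself is controlled by the gradient and [c = 0] will do;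
   [8 K1' + 4] comes from this case. *)
have [le|lt] := leP (Nm p g) (I (fun x => `|f x|)).
  exists c0.
    by apply: (le_trans P1); rewrite ler_wpM2r//; lra.
  by apply: (le_trans P2); clear -le g0 f0 K1'0; nra.
exists 0; last by rewrite normr0 mulr_ge0//; lra.
apply: (le_trans P3).
clear -P1 P2 lt g0 f0 K1'0.
move: (Nm p (fun x => `|f x - c0|)) (Nm p g) (I _) P1 P2 lt g0 f0 => y z w; nra.
Qed.

(** Applied to the smoothed absolute value of [F = f - c]: Poincare turns the full W^{1,p} norm of
    [F] into the gradient norm, and [|c| <= K2 I |f|] keeps the L^u norm of [F] below that of [f].
    The additive L^1 term is the cost of putting [c] back. *)
Lemma gn_cube n p u q theta s1 : 1 <= p -> 1 <= u -> 0 < q ->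
  0 <= theta <= 1 -> s1 <= p^-1 -> p^-1 <= s1 + n.+1%:R^-1 ->
  q^-1 = theta * s1 + (1 - theta) / u ->
  exists2 K : R, 0 < K & forall f g : 'rV[R]_n.+1 -> R,
    continuous f -> cnn g -> DG f g ->
    Nm q (fun x => `|f x|) <=
      K * (Nm p g `^ theta * Nm u (fun x => `|f x|) `^ (1 - theta) + I (fun x => `|f x|)).
Proof.
move=> p1 u1 q0 th s1p ps1 qE; have [th0 th1] := andP th.
have p0 : 0 < p by exact: lt_le_trans p1.
have u0 : 0 < u by exact: lt_le_trans u1.
(* Needed for the triangle inequality in L^q. It follows from the exponent relation, since [s1] and
   [1/u] are at most 1. *)
have q1 : 1 <= q.
  rewrite -[q]invrK -[1]invr1 lef_pV2 ?posrE ?invr_gt0// qE.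
  have h1 : s1 <= 1 by rewrite (le_trans s1p)// invf_le1.
  have h2 : u^-1 <= 1 by rewrite invf_le1.
  have h3 : theta * s1 <= theta by rewrite ler_piMr.
  have h4 : (1 - theta) / u <= 1 - theta by rewrite ler_piMr// subr_ge0.
  by clear -h3 h4; lra.
have [K0 K00 HK0] := gn_positive p1 u1 q0 th s1p ps1 qE.
have [K2 K21 HK2] := @poincare_normalized n.+1 p p1.
(* Covers two triangle inequalities with constant 4 together with the factor [K2]. *)
pose M := 16 * (4 * K2 + 4).
have M1 : 1 <= M by rewrite /M; lra.
exists (4 * (K0 * M + K2)); first by rewrite mulr_gt0// addr_gt0 ?mulr_gt0//; lra.
move=> f g cf cg dg.
have [c Pc cK] := HK2 f g cf cg dg.
pose F x := f x - c.
have cF : continuous F.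
  by move=> x; apply: continuousB; [exact: cf|exact: cst_continuous].
have dF : DG F g by exact: DG_subr.
have cff : cnn (fun x => `|f x|) by exact: cnn_norm.
have cFF : cnn (fun x => `|F x|) by exact: cnn_norm.
have ccc : cnn (fun _ : 'rV[R]_n.+1 => `|c|) by exact: cnn_cst.
set gp := Nm p g in Pc *; set U := Nm u (fun x => `|f x|); set If := I _ in cK *.
have gp0 : 0 <= gp by exact: Nm_ge0.
have U0 : 0 <= U by exact: Nm_ge0.
have IU : If <= U by exact: I_le_Nm.
have If0 : 0 <= If by exact: I_ge0.
have UF : Nm u (fun x => `|F x|) <= 4 * (U + `|c|).
  rewrite -(@Nm_cst R n.+1 u `|c| u0)//.
  apply: le_trans (Nm_add u1 cff ccc).
  by apply: Nm_le => //; [exact: cnnD|move=> x _; exact: ler_normB].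
have H1 : Nm q (fun x => `|F x|) <= (K0 * M) * (gp `^ theta * U `^ (1 - theta)).
  apply: powR_limit => // e e0.
  have cS := smabs_cnn e cF.
  have ce : cnn (fun _ : 'rV[R]_n.+1 => e) by apply: cnn_cst; exact: ltW.
  have L1 : Nm q (fun x => `|F x|) <= Nm q (smabs e F).
    by apply: Nm_le => // x _; exact: smabs_ge.
  have L2 := HK0 (smabs e F) g cS.1 (fun x => smabs_gt0 F x e0) cg (DG_smabs e0 dF).
  have L3 : Nm u (smabs e F) <= M * (U + e).
    have A1 : Nm u (smabs e F) <= 4 * (Nm u (fun x => `|F x|) + e).
      rewrite -{2}(@Nm_cst R n.+1 u e u0 (ltW e0)).
      apply: le_trans (Nm_add u1 cFF ce).
      by apply: Nm_le => //; [exact: cnnD|move=> x _; apply: smabs_le; exact: ltW].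
    apply: (le_trans A1); clear -UF cK IU U0 e0 K21.
    rewrite /M; move: (Nm u (fun x => `|F x|)) UF => z UF; nra.
  have L4 : Nm p (fun x => smabs e F x + g x) <= M * (gp + e).
    have A1 : Nm p (smabs e F) <= 4 * (Nm p (fun x => `|F x|) + e).
      rewrite -{2}(@Nm_cst R n.+1 p e p0 (ltW e0)).
      apply: le_trans (Nm_add p1 cFF ce).
      by apply: Nm_le => //; [exact: cnnD|move=> x _; apply: smabs_le; exact: ltW].
    apply: (le_trans (Nm_add p1 cS cg)); rewrite -/gp.
    move: A1 Pc; rewrite /F -/F /M; clear -gp0 e0 K21.
    move: (Nm p (fun x => `|f x - c|)) (Nm p (smabs e F)) => z w; nra.
  apply: (le_trans L1); apply: (le_trans L2).
  rewrite -mulrA ler_pM2l//.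
  apply: (@le_trans _ _ ((M * (gp + e)) `^ theta * (M * (U + e)) `^ (1 - theta))).
    apply: ler_pM; [exact: powR_ge0|exact: powR_ge0| |].
      exact: (powR_le th0 (Nm_ge0 _ _) L4).
    apply: (powR_le _ (Nm_ge0 _ _) L3).
    by rewrite subr_ge0.
  by apply: powR_scale2 => //; rewrite addr_ge0// ltW.
have H2 : Nm q (fun x => `|f x|) <= 4 * (Nm q (fun x => `|F x|) + `|c|).
  rewrite -(@Nm_cst R n.+1 q `|c| q0)//.
  apply: le_trans (Nm_add q1 cFF ccc).
  apply: Nm_le => //; first exact: cnnD.
  by move=> x _; rewrite /F -{1}[f x](subrK c) ler_normD.
have T0 : 0 <= gp `^ theta * U `^ (1 - theta) by rewrite mulr_ge0 ?powR_ge0.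
have KM : 0 <= K0 * M by rewrite mulr_ge0// ?(ltW K00)// (le_trans _ M1).
apply: (le_trans H2).
move: H1 cK T0 KM; clear -If0 K21.
move: (gp `^ _ * _) (K0 * M) (Nm q _) => T L z; nra.
Qed.

End CubeGN.

(** * Integrals over regions of R^n *)

Section RestrictedIntegral.
Variables (R : realType) (n : nat).
Implicit Types (P Q : 'rV[R]_n -> bool) (h k : 'rV[R]_n -> R).

(** The same cut-off as in [Lp_annulus], so that the Herz terms are instances of it. *)
Definition rint P h : \bar R := iint (fun x => if P x then (h x)%:E else 0%E).

Definition mpred P := measurable_fun setT (fun w => P (@ev R n w)).

Lemma rint_measurable P h : mpred P -> cnn h ->
  measurable_fun setT (fun w => if P (@ev R n w) then (h (ev w))%:E else 0%E).
Proof. by move=> mP ch; apply: measurable_fun_ifT => //; exact: cnn_measurable. Qed.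

Lemma rint_fun_ge0 P h x : cnn h -> (0 <= if P x then (h x)%:E else 0%E)%E.
Proof. by move=> [_ h0]; case: ifP => // _; rewrite lee_fin. Qed.

Lemma rintE P h : mpred P -> cnn h -> rint P h =
  (\int[mun (@lebesgue_measure R) n]_w (if P (ev w) then (h (ev w))%:E else 0))%E.
Proof.
move=> mP ch; rewrite /rint (@iintE R n (fun x => if P x then (h x)%:E else 0%E))//.
- by move=> x; exact: rint_fun_ge0.
- exact: rint_measurable.
Qed.

Lemma rint_ge0 P h : mpred P -> cnn h -> (0 <= rint P h)%E.
Proof.
by move=> mP ch; rewrite rintE//; apply: integral_ge0 => w _; exact: rint_fun_ge0.
Qed.

Lemma rint_le P Q h k : mpred P -> mpred Q -> cnn h -> cnn k ->
  (forall x, P x -> Q x /\ h x <= k x) -> (rint P h <= rint Q k)%E.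
Proof.
move=> mP mQ ch ck H; rewrite !rintE//; apply: ge0_le_integral => //.
- by move=> w _; exact: rint_fun_ge0.
- exact: rint_measurable.
- exact: rint_measurable.
- move=> w _; case: ifP => [Pw|_]; last exact: rint_fun_ge0.
  by have [-> hk] := H _ Pw; rewrite lee_fin.
Qed.

Lemma rint_cover (J : Type) (s : seq J) P (Q : J -> 'rV[R]_n -> bool) h :
  mpred P -> (forall j, mpred (Q j)) -> cnn h ->
  (forall x, P x -> has (fun j => Q j x) s) ->
  (rint P h <= \sum_(j <- s) rint (Q j) h)%E.
Proof.
move=> mP mQ ch H; rewrite rintE//.
under eq_bigr do rewrite rintE//.
rewrite -ge0_integral_sum//; first last.
- by move=> j w _; exact: rint_fun_ge0.
- by move=> j; exact: rint_measurable.
apply: ge0_le_integral => //.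
- by move=> w _; exact: rint_fun_ge0.
- exact: rint_measurable.
- by apply: emeasurable_sum => j; exact: rint_measurable.
move=> w _; case: ifP => [Pw|_]; last first.
  by apply: sume_ge0 => j _; exact: rint_fun_ge0.
elim: s {H} (H _ Pw) => //= j s IH /orP[Qj|/IH {}IH].
  rewrite big_cons Qj leeDl//; apply: sume_ge0 => i _; exact: rint_fun_ge0.
by rewrite big_cons (le_trans IH)// leeDr//; exact: rint_fun_ge0.
Qed.

Lemma rintZ P h c : 0 <= c -> mpred P -> cnn h ->
  rint P (fun x => c * h x) = (c%:E * rint P h)%E.
Proof.
move=> c0 mP ch; rewrite !rintE//; last exact: cnnZ.
rewrite -ge0_integralZl//; first last.
- by move=> w _; exact: rint_fun_ge0.
- exact: rint_measurable.
by apply: eq_integral => w _; case: ifP; rewrite ?mule0// EFinM.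
Qed.

Lemma rint_holder P h k (a b : R) : 0 <= a -> 0 <= b -> a + b = 1 ->
  mpred P -> cnn h -> cnn k ->
  (rint P (fun x => h x `^ a * k x `^ b)%R <= rint P h `^ a * rint P k `^ b)%E.
Proof.
move=> a0 b0 ab mP ch ck.
have mr m : cnn m -> measurable_fun setT (fun w => if P (@ev R n w) then m (ev w) else 0).
  by move=> [cm _]; apply: measurable_fun_ifT => //; exact: continuous_ev_measurable.
have ge m w : cnn m -> 0 <= (if P (@ev R n w) then m (ev w) else 0).
  by move=> [_ m0]; case: ifP.
have := @integral_holder R _ _ (mun (@lebesgue_measure R) n) _ _ a b a0 b0 ab
  (mr h ch) (mr k ck) (fun w => ge h w ch) (fun w => ge k w ck).
rewrite !rintE//; last by apply: cnnM; apply: cnn_powR.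
rewrite (eq_integral (fun w => if P (ev w) then (h (ev w) `^ a * k (ev w) `^ b)%R%:E else 0)%E).
  move=> /le_trans; apply; rewrite le_eqVlt; apply/orP; left; apply/eqP.
  by congr (_ `^ _ * _ `^ _)%E; apply: eq_integral => w _; case: ifP.
move=> w _; case: ifP => // _.
(* Off the region the product [0^a 0^b] has to vanish; since [0^0 = 1], for [a = 0] the second
   factor must do it. *)
have [a00|an0] := eqVneq a 0; last by rewrite powR0// mul0r.
have -> : b = 1 by rewrite -ab a00 add0r.
by rewrite [0 `^ 1]powR0 ?oner_eq0// mulr0.
Qed.

Lemma rint_affine P h (a : 'rV[R]_n) (l : R) : 0 < l -> mpred P -> cnn h ->
  rint P h = ((l ^+ n)%:E * rint (fun x => P (a + l *: x)%R) (fun x => h (a + l *: x)%R))%E.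
Proof.
move=> l0 mP ch; rewrite /rint (iint_affine a l0)//.
- by move=> x; exact: rint_fun_ge0.
- exact: rint_measurable.
Qed.

End RestrictedIntegral.

Section CubeLink.
Variable R : realType.

Definition cubeb n (x : 'rV[R]_n) := [forall j, (0 <= x ord0 j) && (x ord0 j <= 1)].

Lemma cubeb_rcons0 n t (y : 'rV[R]_n) : cubeb (rcons0 t y) = (0 <= t <= 1) && cubeb y.
Proof.
apply/forallP/andP => [H|[t01 /forallP cy] j].
  split; first by have := H ord0; rewrite rcons0_0.
  by apply/forallP => j; have := H (lift ord0 j); rewrite rcons0_S.
by case: (unliftP ord0 j) => [k|] ->; rewrite ?rcons0_S ?rcons0_0.
Qed.

Lemma mpred_coord n (j : 'I_n) (a b : R) :
  mpred (fun x : 'rV[R]_n => (a <= x ord0 j) && (x ord0 j <= b)).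
Proof.
have mc : measurable_fun setT (fun w => @ev R n w ord0 j).
  apply: (@continuous_ev_measurable R n (fun x => x ord0 j)).
  exact: coord_continuous.
by apply: measurable_and; apply: measurable_fun_ler.
Qed.

Lemma mpred_forall n (P : 'I_n -> 'rV[R]_n -> bool) : (forall j, mpred (P j)) ->
  mpred (fun x => [forall j, P j x]).
Proof.
move=> mP; rewrite /mpred.
rewrite (_ : (fun w => _) = fun w => all (fun j => P j (@ev R n w)) (enum 'I_n)); last first.
  apply/funext => w; apply/forallP/allP => [H j _|H j]; first exact: H.
  by apply: H; rewrite mem_enum.
elim: (enum _) => [|j s IH] /=; first exact: measurable_cst.
by apply: measurable_and => //; exact: mP.
Qed.

Lemma rint0 n (P : 'rV[R]_n -> bool) h : (forall x, P x = false) -> rint P h = 0%E.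
Proof.
move=> P0; rewrite /rint (_ : (fun x => _) = fun=> 0%E); last first.
  by apply/funext => x; rewrite P0.
by elim: n {P h P0} => //= n IH; rewrite IH integral0.
Qed.

Lemma rint_cubeb n (h : 'rV[R]_n -> R) : cnn h -> rint (@cubeb n) h = (I h)%:E.
Proof.
move=> ch; rewrite -IE//; elim: n h ch => [|n IH] h ch.
  rewrite cubeint0 /rint /= ifT//; by apply/forallP => -[].
rewrite cubeint_rec// integral_mkcond /=.
rewrite /rint /=; apply: eq_integral => t _; rewrite patchE mem_setE in_itv/=.
rewrite -(IH _ (cnn_slice t ch)) /rint /slice.
case: ifP => t01.
  by congr iint; apply/funext => y; rewrite cubeb_rcons0 t01.
rewrite -[RHS](@rint0 n (fun=> false) (fun=> 0)%R)// /rint.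
by congr iint; apply/funext => y; rewrite (cubeb_rcons0 t y) t01.
Qed.

End CubeLink.

(** * Dyadic annuli and their covering by small cubes *)

Section Annuli.
Variables (R : realType) (m : nat).
Local Notation n := m.+1.
Local Notation vec := 'rV[R]_n.

Lemma sum_continuous (T : topologicalType) (J : Type) (s : seq J) (F : J -> T -> R) :
  (forall j, continuous (F j)) -> continuous (fun x => \sum_(j <- s) F j x).
Proof.
move=> cF; elim: s => [|j s IH].
  by under eq_fun do rewrite big_nil; exact: cst_continuous.
under eq_fun do rewrite big_cons.
by move=> x; apply: continuousD; [exact: cF|exact: IH].
Qed.

Lemma cnn_enorm : cnn (@enorm R n).
Proof.
split=> [x|x]; last exact: sqrtr_ge0.
apply: (@continuous_comp _ _ _ (fun x : vec => \sum_(i < n) x ord0 i ^+ 2) (@Num.sqrt R)).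
  apply: sum_continuous => i y.
  by apply: (@continuousM _ _ (fun x : vec => x ord0 i)); exact: coord_continuous.
exact: sqrt_continuous.
Qed.

Lemma coord_le_enorm (x : vec) i : `|x ord0 i| <= enorm x.
Proof.
rewrite -sqrtr_sqr ler_wsqrtr// (bigD1 i)//= lerDl.
by apply: sumr_ge0 => j _; exact: sqr_ge0.
Qed.

Lemma enormZ (l : R) (x : vec) : 0 <= l -> enorm (l *: x) = l * enorm x.
Proof.
move=> l0; rewrite /enorm.
rewrite (eq_bigr (fun i => l ^+ 2 * x ord0 i ^+ 2)); last by move=> i _; rewrite mxE exprMn.
by rewrite -mulr_sumr sqrtrM ?sqr_ge0// sqrtr_sqr ger0_norm.
Qed.

(** The factor [n] is cruder than its square root but suits the grid, whose side is [1/(4n)]. *)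
Lemma enorm_close (x y : vec) (e : R) : 0 <= e ->
  (forall i, `|x ord0 i - y ord0 i| <= e) -> enorm x <= enorm y + n%:R * e.
Proof.
move=> e0 H; set E := enorm y; have E0 : 0 <= E by exact: sqrtr_ge0.
have N1 : 1 <= n%:R :> R by rewrite ler1n.
have r0 : 0 <= E + n%:R * e by rewrite addr_ge0// mulr_ge0// ler0n.
rewrite -[leRHS]ger0_norm// -sqrtr_sqr ler_wsqrtr//.
apply: (@le_trans _ _ (\sum_(i < n) (y ord0 i ^+ 2 + (2 * E * e + e ^+ 2)))).
  apply: ler_sum => i _; have := H i; have := coord_le_enorm y i; rewrite -/E.
  move: (x ord0 i) (y ord0 i) => a b hb hab.
  have ha : `|a| <= `|b| + e.
    by rewrite -[a](subrK b) addrC (le_trans (ler_normD _ _))// lerD2l.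
  rewrite -(real_normK (num_real a)) -(real_normK (num_real b)).
  have a0 := normr_ge0 a; have b0 := normr_ge0 b.
  move: `|a| `|b| a0 b0 hb ha => a' b' a0 b0 hb ha; clear -a0 b0 hb ha e0 E0; nra.
rewrite big_split /= sumr_const card_ord -[X in _ + X <= _]mulr_natl.
have -> : \sum_(i < n) y ord0 i ^+ 2 = E ^+ 2.
  by rewrite sqr_sqrtr// sumr_ge0// => i _; exact: sqr_ge0.
have N2 : n%:R * e ^+ 2 <= n%:R * n%:R * e ^+ 2.
  by rewrite -mulrA ler_peMl// mulr_ge0 ?ler0n ?sqr_ge0.
rewrite sqrrD exprMn [n%:R ^+ 2]expr2 mulrDr -addrA lerD2l lerD//.
by rewrite le_eqVlt; apply/orP; left; apply/eqP; ring.
Qed.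

Lemma continuous_aff (h : vec -> R) (a : vec) (l : R) : continuous h ->
  continuous (fun x : vec => h (a + l *: x)).
Proof.
move=> ch x; apply: (@continuous_comp _ _ _ (fun x : vec => a + l *: x) h); last exact: ch.
apply: continuousD; first exact: cst_continuous.
by apply: continuousZr; exact: cvg_id.
Qed.

Lemma cnn_aff (h : vec -> R) (a : vec) (l : R) : cnn h -> cnn (fun x => h (a + l *: x)).
Proof. by move=> [ch h0]; split=> [|x]; [exact: continuous_aff|exact: h0]. Qed.

Lemma cnn_dil (h : vec -> R) (l : R) : cnn h -> cnn (fun x => h (l *: x)).
Proof. by move=> /(cnn_aff 0 l); under eq_fun do rewrite add0r. Qed.

Lemma mpred_annulus k : mpred (@annulus R n k).
Proof.
have me := continuous_ev_measurable cnn_enorm.1.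
apply: measurable_and; first exact: measurable_fun_ler.
exact: measurable_fun_ltr.
Qed.

Lemma annulusZ k (l : int) (x : vec) :
  annulus k (2 `^ l%:~R *: x) = annulus (k - l) x.
Proof.
rewrite /annulus enormZ ?powR_ge0//.
have l0 : 0 < 2 `^ l%:~R :> R by exact: powR_gt0.
have E (c : R) : 2 `^ (c - l%:~R) = (2 `^ l%:~R)^-1 * 2 `^ c.
  by rewrite addrC powRD ?powRN// pnatr_eq0 implybT.
rewrite !intrB -ler_pdivrMl// -ltr_pdivlMl// -!E.
by congr ((_ <= _) && _); congr (_ `^ _); ring.
Qed.

Definition anint k (h : vec -> R) : \bar R := rint (annulus k) h.

Lemma anintZ k l (h : vec -> R) : cnn h ->
  anint k h = ((2 `^ (l%:~R * n%:R))%:E * anint (k - l) (fun x => h (2 `^ l%:~R *: x)))%E.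
Proof.
move=> ch; rewrite /anint.
have l0 : 0 < 2 `^ l%:~R :> R by exact: powR_gt0.
rewrite (rint_affine 0 l0 (mpred_annulus k) ch).
rewrite powRrM powR_mulrn ?powR_ge0//; congr (_ * _)%E.
rewrite /rint; congr iint; apply/funext => x.
by rewrite add0r annulusZ.
Qed.

(* Grid of closed cubes of side (4n)^-1 covering the unit ball. *)
Definition gridN := (4 * n)%N.
Definition side : R := gridN%:R^-1.
Definition corner (z : {ffun 'I_n -> 'I_(2 * gridN)}) : vec :=
  \row_i ((z i)%:R * side - 1).
Definition gridcube z (x : vec) := cubeb (side^-1 *: (x - corner z)).

Lemma gridN_gt0 : 0 < gridN%:R :> R.
Proof. by rewrite ltr0n. Qed.

Lemma side_gt0 : 0 < side.
Proof. by rewrite invr_gt0 gridN_gt0. Qed.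

Lemma gridcubeP z (x : vec) :
  reflect (forall i, corner z ord0 i <= x ord0 i <= corner z ord0 i + side) (gridcube z x).
Proof.
have s0 := side_gt0.
have E i : (0 <= (side^-1 *: (x - corner z)) ord0 i) && ((side^-1 *: (x - corner z)) ord0 i <= 1)
   = (corner z ord0 i <= x ord0 i <= corner z ord0 i + side).
  have -> : (side^-1 *: (x - corner z)) ord0 i = (x ord0 i - corner z ord0 i) / side.
    by rewrite mxE mulrC !mxE.
  rewrite pmulr_lge0 ?invr_gt0// subr_ge0 ler_pdivrMr// mul1r.
  by rewrite lerBlDl.
by apply: (iffP forallP) => H i; [rewrite -E|rewrite E].
Qed.

Lemma mpred_gridcube z : mpred (gridcube z).
Proof.
rewrite /mpred (_ : (fun w => _) = fun w => [forall i, (corner z ord0 i <= @ev R n w ord0 i) &&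
    (@ev R n w ord0 i <= corner z ord0 i + side)]).
  apply: (@mpred_forall R n (fun i x => (corner z ord0 i <= x ord0 i) &&
    (x ord0 i <= corner z ord0 i + side))) => i.
  exact: mpred_coord.
apply/funext => w; apply/gridcubeP/forallP => H i; exact: H.
Qed.

Lemma grid_cover x : annulus 0 x -> exists z, gridcube z x.
Proof.
move=> /andP[_]; rewrite powRr0 => x1.
have N0 := gridN_gt0.
have xi i : -1 < x ord0 i < 1.
  by have := le_lt_trans (coord_le_enorm x i) x1; rewrite ltr_norml.
have fl i : 0 <= (x ord0 i + 1) * gridN%:R.
  by rewrite mulr_ge0 ?ler0n//; have := xi i; lra.
pose t i := Num.truncn ((x ord0 i + 1) * gridN%:R).
have tlt i : (t i < 2 * gridN)%N.
  rewrite truncn_lt_nat; last exact: fl.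
  rewrite natrM ltr_pM2r//; have := xi i; lra.
exists [ffun i => Ordinal (tlt i)].
apply/gridcubeP => i; rewrite mxE ffunE /=.
have [t1 t2] : (t i)%:R <= (x ord0 i + 1) * gridN%:R /\ (x ord0 i + 1) * gridN%:R < (t i).+1%:R.
  by have /andP := truncn_itv (fl i).
rewrite lerBlDr ler_pdivrMr// t1 /=.
have -> : (t i)%:R * side - 1 + side = (t i).+1%:R * side - 1 by rewrite -natr1; ring.
by rewrite lerBrDr ler_pdivlMr// ltW.
Qed.

Definition star_pred (x : vec) := [|| annulus (-1) x, annulus 0 x | annulus 1 x].

Lemma mpred_star : mpred star_pred.
Proof.
by apply: measurable_or; [|apply: measurable_or]; exact: mpred_annulus.
Qed.

(** Within a grid cube the Euclidean norm varies by at most [1/4], so [1/2 <= |x| < 1] gives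
    [1/4 <= |y| < 5/4]. This is what fixes the side [1/(4n)]. *)
Lemma gridcube_star z x y : annulus 0 x -> gridcube z x -> gridcube z y -> star_pred y.
Proof.
move=> ax /gridcubeP zx /gridcubeP zy.
have s0 := side_gt0.
have dist i : `|x ord0 i - y ord0 i| <= side.
  by have := zx i; have := zy i; rewrite ler_norml; lra.
have h1 := enorm_close (ltW s0) dist.
have h2 : enorm y <= enorm x + n%:R * side.
  by apply: enorm_close; [exact: ltW|move=> i; rewrite distrC].
have ns : n%:R * side = 4^-1.
  by rewrite /side /gridN natrM invfM mulrCA mulfV ?mulr1// pnatr_eq0.
rewrite ns in h1 h2.
move: ax; rewrite /star_pred /annulus.
have p1 : 2 `^ (-1) = 2^-1 :> R by rewrite powR_inv1.
have p2 : 2 `^ (-1 - 1) = 4^-1 :> R.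
  have -> : -1 - 1 = - 2%:R :> R by lra.
  by rewrite powR_invn// -natrX.
rewrite (_ : (-1)%:~R = -1 :> R)// (_ : 0%:~R = 0 :> R)// (_ : 1%:~R = 1 :> R)//.
rewrite !subrr !sub0r !p1 p2 !powRr0 powRr1//.
move: (enorm x) (enorm y) h1 h2 => a b h1 h2 /andP[a1 a2].
have [b1|b1] := ltP b 2^-1; first by rewrite andbT; apply/orP; left; lra.
by have [b2|b2] := ltP b 1 => /=; rewrite ?orbT//=; lra.
Qed.

Lemma rint_gridcube z (h : vec -> R) : cnn h ->
  rint (gridcube z) h = (side ^+ n * I (fun x => h (corner z + side *: x)))%:E.
Proof.
move=> ch; have s0 := side_gt0.
rewrite (rint_affine (corner z) s0 (mpred_gridcube z) ch) EFinM; congr (_ * _)%E.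
rewrite -rint_cubeb; last first.
  exact: cnn_aff.
rewrite /rint; congr iint; apply/funext => x; rewrite /gridcube.
by rewrite [corner z + _]addrC addrK scalerA mulVf ?scale1r// gt_eqF.
Qed.

(** A dilation reduces to [C_0], which finitely many cubes cover. *)
Lemma anint_fin k (h : vec -> R) : cnn h -> anint k h \is a fin_num.
Proof.
wlog -> : k h / k = 0.
  move=> H ch; rewrite (anintZ k k ch) subrr fin_numM//.
  by apply: H => //; exact: cnn_dil.
move=> ch; rewrite ge0_fin_numE; last exact: rint_ge0 (mpred_annulus _) ch.
have := @rint_cover R n _ (enum {ffun 'I_n -> 'I_(2 * gridN)}) _ gridcube h
  (mpred_annulus 0) mpred_gridcube ch.
move=> H; apply: (le_lt_trans (H _)).
  by move=> x /grid_cover [z zx]; apply/hasP; exists z => //; rewrite mem_enum.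
apply: lte_sum_pinfty => z _; rewrite rint_gridcube//; exact: ltry.
Qed.

End Annuli.

(* [anint] is always finite on continuous functions, so [fine] loses nothing. *)
HB.lock Definition AI (R : realType) m k (h : 'rV[R]_m.+1 -> R) : R := fine (anint k h).

(** * The local inequality on [C_0] *)

Section LocalInequality.
Variables (R : realType) (m : nat).
Local Notation n := m.+1.
Local Notation vec := 'rV[R]_n.
Implicit Types h f g : vec -> R.

Lemma AIE k h : cnn h -> anint k h = (AI k h)%:E.
Proof. by move=> ch; rewrite AI.unlock fineK//; exact: anint_fin. Qed.

Lemma AI_ge0 k h : cnn h -> 0 <= AI k h.
Proof.
by move=> ch; rewrite -lee_fin -AIE//; apply: rint_ge0 => //; exact: mpred_annulus.
Qed.

Lemma AIZ k l h : cnn h ->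
  AI k h = 2 `^ (l%:~R * n%:R) * AI (k - l) (fun x => h (2 `^ l%:~R *: x)).
Proof.
move=> ch; apply: EFin_inj; rewrite -AIE// (anintZ k l ch) EFinM AIE//.
exact: cnn_dil.
Qed.

Lemma AI_scale k c h : 0 <= c -> cnn h -> AI k (fun x => c * h x) = c * AI k h.
Proof.
move=> c0 ch; apply: EFin_inj; rewrite EFinM -!AIE//; last exact: cnnZ.
by rewrite /anint rintZ//; exact: mpred_annulus.
Qed.

Lemma AI_jensen k p h : 1 <= p -> cnn h ->
  AI k h <= AI k (fun _ : vec => 1) `^ (1 - p^-1) * AI k (fun x => h x `^ p) `^ p^-1.
Proof.
move=> p1 ch; have p0 : 0 < p by exact: lt_le_trans p1.
have cp : cnn (fun x => h x `^ p) by apply: cnn_powR => //; exact: ltW.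
have c1 : cnn (fun _ : vec => 1 : R) by exact: cnn_cst.
have pV0 : 0 <= p^-1 by rewrite invr_ge0 ltW.
have pV1 : 0 <= 1 - p^-1 by rewrite subr_ge0 invf_le1.
have E : p^-1 + (1 - p^-1) = 1 by rewrite addrC subrK.
have := rint_holder pV0 pV1 E (mpred_annulus (m := m) k) cp c1.
rewrite -!/(anint _ _) !AIE//; last by apply: cnnM; exact: cnn_powR.
rewrite !poweR_EFin -EFinM lee_fin mulrC; apply: le_trans.
rewrite le_eqVlt; apply/orP; left; apply/eqP; congr (AI k _).
by apply/funext => x; rewrite powRK ?gt_eqF//; [rewrite powR1 mulr1|case: ch].
Qed.

Definition AS h := AI (-1) h + AI 0 h + AI 1 h.

Lemma AS_ge0 h : cnn h -> 0 <= AS h.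
Proof. by move=> ch; rewrite !addr_ge0// AI_ge0. Qed.

Lemma rint_star h : cnn h -> (rint (@star_pred R m) h <= (AS h)%:E)%E.
Proof.
move=> ch.
have := @rint_cover R n _ [:: -1; 0; 1 : int] _ (@annulus R n) h
   (@mpred_star R m) (@mpred_annulus R m) ch.
rewrite !big_cons big_nil adde0 -!/(anint _ _) !(AIE _ ch) -!EFinD addrA; apply.
by move=> x; rewrite /= orbF.
Qed.

Lemma DG_aff f g (a : vec) (l : R) : 0 <= l -> DG f g ->
  DG (fun x => f (a + l *: x)) (fun x => l * g (a + l *: x)).
Proof.
move=> l0 H x i; have [d dd dg] := H (a + l *: x) i.
exists (d * l); last by rewrite normrM mulrC ger0_norm// ler_wpM2l.
rewrite (_ : (fun s => _) = (fun s : R => f (a + l *: x + s *: delta_mx 0 i)) \o (fun s => l * s)).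
  apply: is_derive1_comp; first by rewrite mulr0.
  have := @is_deriveZ R R R id l (0 : R) (1 : R) 1 (is_derive_id _ _).
  by rewrite /GRing.scale /= mulr1.
by apply/funext => s /=; rewrite scalerDr scalerA addrA.
Qed.

Lemma side_le1 : side R m <= 1.
Proof. by rewrite invf_le1 ?gridN_gt0// ler1n. Qed.

Lemma I_grid_le z h : cnn h ->
  (exists2 x : vec, annulus 0 x & gridcube z x) ->
  I (fun x => h (corner R z + side R m *: x)) <= (side R m ^+ n)^-1 * AS h.
Proof.
move=> ch [x ax zx].
have s0 : 0 < side R m ^+ n by rewrite exprn_gt0// side_gt0.
rewrite -ler_pdivrMl ?invr_gt0// invrK -lee_fin -rint_gridcube//.
apply: le_trans (rint_star ch); apply: rint_le => //.
- exact: mpred_gridcube.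
- exact: mpred_star.
- by move=> y zy; split=> //; exact: gridcube_star ax zx zy.
Qed.

Lemma powR_scale_le (sg a r : R) : 1 <= sg -> 0 <= a -> 1 <= r ->
  (sg * a) `^ r^-1 <= sg * a `^ r^-1.
Proof.
move=> s1 a0 r1; have s0 : 0 <= sg by exact: le_trans s1.
rewrite powRM// ler_wpM2r ?powR_ge0//.
by apply: ler1_powR => //; rewrite invf_le1// (lt_le_trans _ r1).
Qed.

Lemma gn_gridcube (p u q theta s1 : R) : 1 <= p -> 1 <= u -> 0 < q ->
  0 <= theta <= 1 -> s1 <= p^-1 -> p^-1 <= s1 + n%:R^-1 ->
  q^-1 = theta * s1 + (1 - theta) / u ->
  exists2 K : R, 0 < K & forall f g z, continuous f -> cnn g -> DG f g ->
    (exists2 x : vec, annulus 0 x & gridcube z x) ->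
    Nm q (fun x => `|f (corner R z + side R m *: x)|) <=
     K * ((AS (fun x => g x `^ p) `^ p^-1) `^ theta *
          (AS (fun x => `|f x| `^ u) `^ u^-1) `^ (1 - theta) + AS (fun x => `|f x|)).
Proof.
move=> p1 u1 q0 th s1p ps1 qE; have [th0 th1] := andP th.
have p0 : 0 < p by exact: lt_le_trans p1.
have u0 : 0 < u by exact: lt_le_trans u1.
have [K K0 HK] := gn_cube p1 u1 q0 th s1p ps1 qE.
have s0 := side_gt0 R m; have sl := side_le1.
(* The Jacobian of the passage to the unit cube. Being at least 1, it also dominates its own
   [1/p]-th and [1/u]-th powers, so one constant serves for all norms. *)
pose sg := (side R m ^+ n)^-1.
have sg1 : 1 <= sg by rewrite /sg invf_ge1 ?exprn_gt0// exprn_ile1// ltW.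
have sg0 : 0 < sg by exact: lt_le_trans sg1.
exists (K * sg); first exact: mulr_gt0.
move=> f g z cf cg dg good.
have cff : cnn (fun x => `|f x|) by exact: cnn_norm.
have cgp : cnn (fun x => g x `^ p) by apply: cnn_powR => //; exact: ltW.
have cfu : cnn (fun x => `|f x| `^ u) by apply: cnn_powR => //; exact: ltW.
have cga := cnn_aff (corner R z) (side R m) cg.
have cgz := cnnZ (ltW s0) cga.
have := HK _ _ (@continuous_aff R m f (corner R z) (side R m) cf) cgz
  (DG_aff (corner R z) (ltW s0) dg).
move/le_trans; apply; rewrite -mulrA ler_pM2l// mulrDr.
have A1 : Nm p (fun x => side R m * g (corner R z + side R m *: x)) <=
   sg * AS (fun x => g x `^ p) `^ p^-1.
  apply: (@le_trans _ _ (Nm p (fun x => g (corner R z + side R m *: x)))).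
    apply: Nm_le => // x _; rewrite ler_piMl//; by case: cg.
  rewrite NmE; apply: le_trans (powR_scale_le sg1 (AS_ge0 cgp) p1).
  apply: powR_le; first by rewrite invr_ge0 ltW.
    by apply: I_ge0; apply: cnn_powR => //; exact: ltW.
  exact: (I_grid_le cgp good).
have A2 : Nm u (fun x => `|f (corner R z + side R m *: x)|) <=
   sg * AS (fun x => `|f x| `^ u) `^ u^-1.
  rewrite NmE; apply: le_trans (powR_scale_le sg1 (AS_ge0 cfu) u1).
  apply: powR_le; first by rewrite invr_ge0 ltW.
    by apply: I_ge0; apply: cnn_powR; [exact: ltW|exact: (cnn_aff _ _ cff)].
  exact: (I_grid_le cfu good).
apply: lerD; last exact: (I_grid_le cff good).
apply: le_trans (powR_scale2 theta sg1 (powR_ge0 _ _) (powR_ge0 _ _)).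
apply: ler_pM; [exact: powR_ge0|exact: powR_ge0| |].
  exact: (powR_le th0 (Nm_ge0 _ _) A1).
apply: (powR_le _ (Nm_ge0 _ _) A2).
by rewrite subr_ge0.
Qed.

Lemma gn_annulus (p u q theta s1 : R) : 1 <= p -> 1 <= u -> 0 < q ->
  0 <= theta <= 1 -> s1 <= p^-1 -> p^-1 <= s1 + n%:R^-1 ->
  q^-1 = theta * s1 + (1 - theta) / u ->
  exists2 K : R, 0 < K & forall f g, continuous f -> cnn g -> DG f g ->
    AI 0 (fun x => `|f x| `^ q) `^ q^-1 <=
     K * ((AS (fun x => g x `^ p) `^ p^-1) `^ theta *
          (AS (fun x => `|f x| `^ u) `^ u^-1) `^ (1 - theta) + AS (fun x => `|f x|)).
Proof.
move=> p1 u1 q0 th s1p ps1 qE.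
have [K K0 HK] := gn_gridcube p1 u1 q0 th s1p ps1 qE.
(* Only cubes that meet [C_0] are kept: these lie in the three neighbouring annuli, and they still
   cover [C_0]. The [+ 1] in [c] spares a proof that some cube is left. *)
pose s := [seq z <- enum {ffun 'I_n -> 'I_(2 * gridN m)} |
  `[< exists2 x : vec, annulus 0 x & gridcube z x >]].
pose c : R := (size s)%:R + 1.
have c0 : 0 < c by rewrite ltr_wpDl.
exists (c `^ q^-1 * K); first by rewrite mulr_gt0// powR_gt0.
move=> f g cf cg dg.
have := HK f g _ cf cg dg; set T := _ + AS _ => HT.
have cff : cnn (fun x => `|f x|) by exact: cnn_norm.
have cfq : cnn (fun x => `|f x| `^ q) by apply: cnn_powR => //; exact: ltW.
have T0 : 0 <= T by rewrite addr_ge0 ?AS_ge0// mulr_ge0// powR_ge0.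
have KT : 0 <= K * T by rewrite mulr_ge0// ltW.
have s0 := side_gt0 R m; have sl := side_le1.
have B : AI 0 (fun x => `|f x| `^ q) <= c * (K * T) `^ q.
  rewrite -lee_fin -AIE//.
  have := @rint_cover R n _ s _ (@gridcube R m) _ (mpred_annulus (m := m) 0)
    (@mpred_gridcube R m) cfq.
  move=> H; apply: (le_trans (H _)).
    move=> x ax; have [z zx] := grid_cover ax.
    apply/hasP; exists z => //; rewrite mem_filter mem_enum andbT.
    by apply/asboolP; exists x.
  apply: (@le_trans _ _ (\sum_(z <- s) ((K * T) `^ q)%:E)%E).
    rewrite big_seq [leRHS]big_seq; apply: lee_sum => z.
    rewrite mem_filter => /andP[/asboolP good _].
    rewrite rint_gridcube// lee_fin.
    apply: (@le_trans _ _ (I (fun x => `|f (corner R z + side R m *: x)| `^ q))).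
      rewrite ler_piMl ?exprn_ile1 ?(ltW s0)//.
      by apply: I_ge0; exact: (cnn_aff _ _ cfq).
    have := powR_le (ltW q0) (Nm_ge0 _ _) (HT z good).
    rewrite NmE powRVK ?gt_eqF//.
    by apply: I_ge0; exact: (cnn_aff _ _ cfq).
  rewrite sumEFin lee_fin big_const_seq count_predT iter_addr_0 -mulr_natl.
  by rewrite ler_wpM2r ?powR_ge0// lerDl.
have qV : 0 <= q^-1 by rewrite invr_ge0 ltW.
have := powR_le qV (AI_ge0 0 cfq) B.
by rewrite powRM ?powR_ge0 ?(ltW c0)// powRK ?gt_eqF// mulrA.
Qed.

End LocalInequality.

(** * Comparison of neighbouring annuli along rays *)

Section RadialInequality.
Variables (R : realType) (m : nat).
Local Notation n := m.+1.
Local Notation vec := 'rV[R]_n.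
Implicit Types h f g : vec -> R.

(** Derivative along the ray through [x]. The factor [n] comes from summing over coordinates in
    [derive_le_grad]. *)
Definition RD f g := forall x (t : R),
  exists2 d : R, is_derive t (1 : R) (fun s : R => f (s *: x)) d
               & `|d| <= n%:R * enorm x * g (t *: x).

Lemma mpred_annulus_dil k (l : R) : mpred (fun x : vec => annulus k (l *: x)).
Proof.
have me := continuous_ev_measurable (cnn_dil l (cnn_enorm R m)).1.
apply: measurable_and; first exact: measurable_fun_ler.
exact: measurable_fun_ltr.
Qed.

Lemma annulus01_dil (l : R) (x : vec) : 1 <= l <= 2 -> annulus 0 (l^-1 *: x) ->
  annulus 0 x || annulus 1 x.
Proof.
move=> /andP[l1 l2]; have l0 : 0 < l by exact: lt_le_trans l1.
have p1 : 2 `^ (-1) = 2^-1 :> R by rewrite powR_inv1.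
rewrite /annulus enormZ ?invr_ge0 ?(ltW l0)//.
rewrite (_ : 0%:~R = 0 :> R)// (_ : 1%:~R = 1 :> R)//.
rewrite !subrr !sub0r !p1 !powRr0 powRr1// ler_pdivlMl// ltr_pdivrMl//.
move: (enorm x) => b; clear -l1 l2 => /andP[b1 b2].
by have [b3|b3] := ltP b 1; rewrite ?orbT/=; lra.
Qed.

(** The Jacobian [l^n >= 1] is dropped, and [l] times a point of [C_0] stays in [C_0] or [C_1]. The
    bound is uniform in [l], as integration in [l] requires. *)
Lemma rint_dil_le g (l : R) : cnn g -> 1 <= l <= 2 ->
  (rint (annulus 0) (fun x => g (l *: x)) <= (AI 0 g + AI 1 g)%:E)%E.
Proof.
move=> cg l12; have /andP[l1 l2] := l12; have l0 : 0 < l by exact: lt_le_trans l1.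
have mP := mpred_annulus_dil 0 l^-1.
have ln1 : 1 <= l ^+ n by exact: exprn_ege1.
have cgl := cnn_dil l cg.
apply: (@le_trans _ _ (rint (fun x : vec => annulus 0 (l^-1 *: x)) g)).
  rewrite (rint_affine 0 l0 mP cg).
  have -> : rint (fun x : vec => annulus 0 (l^-1 *: (0 + l *: x))) (fun x => g (0 + l *: x))
     = rint (annulus 0) (fun x => g (l *: x)).
    rewrite /rint; congr iint; apply/funext => x.
    by rewrite add0r scalerA mulVf ?gt_eqF// scale1r.
  apply: lee_pemull; last by rewrite lee_fin.
  exact: rint_ge0 (mpred_annulus (m := m) 0) cgl.
have := @rint_cover R n _ [:: 0; 1 : int] _ (@annulus R n) g mP (@mpred_annulus R m) cg.
rewrite !big_cons big_nil adde0 -!/(anint _ _) !(AIE _ cg) -!EFinD; apply.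
by move=> x /(annulus01_dil l12) /=; rewrite orbF.
Qed.

(** The fundamental theorem along the segment from [x] to [2 x]; the factor [|x|] of the radial
    derivative is below 1 on [C_0]. *)
Lemma radial_pointwise f g (x : vec) : cnn g -> RD f g -> annulus 0 x ->
  (`|f x|%:E <= `|f (2 *: x)|%:E +
    \int[@lebesgue_measure R]_(s in `[0%R, 1%R]) (n%:R * g ((1 + s) *: x))%:E)%E.
Proof.
move=> cg rd /andP[_]; rewrite powRr0 => x1.
have cgam : continuous (fun s : R => n%:R * g ((1 + s) *: x)).
  move=> s; apply: (@continuousM _ _ (fun=> n%:R)); first exact: cst_continuous.
  apply: (@continuous_comp _ _ _ (fun s : R => (1 + s) *: x) g); last exact: cg.1.
  apply: continuousZl; apply: continuousD; [exact: cst_continuous|exact: cvg_id].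
have Hd (s : R) : exists2 d : R, is_derive s (1 : R) (fun s => f ((1 + s) *: x)) d &
    `|d| <= n%:R * g ((1 + s) *: x).
  have [d dd dle] := rd x (1 + s); exists d.
    rewrite -[d]mulr1.
    apply: (@is_derive1_comp R (fun s : R => f (s *: x)) (fun s : R => 1 + s)) => //.
    have := @is_deriveD R R R (fun=> 1) id s (1 : R) 0 1 (is_derive_cst _ _ _) (is_derive_id _ _).
    by rewrite add0r.
  apply: (le_trans dle); rewrite ler_wpM2r ?cg.2// ler_piMr ?ler0n//.
  exact: ltW.
have := @derive_bound01 R (fun s => f ((1 + s) *: x)) _ 0 1 _ _ cgam Hd.
rewrite !lexx !ler01 => /(_ isT isT) H.
have E : `|f x| <= `|f (2 *: x)| + `|f ((1 + 1) *: x) - f ((1 + 0) *: x)|.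
  rewrite addr0 scale1r (_ : 1 + 1 = 2 :> R)// -lerBlDl.
  by rewrite -[X in _ <= X]normrN opprB; exact: lerB_dist.
apply: (@le_trans _ _ (`|f (2 *: x)| + `|f ((1 + 1) *: x) - f ((1 + 0) *: x)|)%:E).
  by rewrite lee_fin.
by rewrite EFinD leeD2l.
Qed.

Lemma radial_integral f g : continuous f -> cnn g -> RD f g ->
  AI 0 (fun x => `|f x|) <= AI 0 (fun x => `|f (2 *: x)|) + n%:R * (AI 0 g + AI 1 g).
Proof.
move=> cf cg rd.
have cff := cnn_norm cf; have cf2 := cnn_dil 2 cff.
rewrite -lee_fin EFinD -!(AIE _ cff) -(AIE _ cf2) /anint.
pose Phi (z : measurableTypeR R * projT2 (TT R n)) : \bar R :=
  if annulus 0 (ev z.2) then (n%:R * g ((1 + z.1) *: ev z.2))%:E else 0%E.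
have cgl (s : R) := cnnZ (ler0n R n) (cnn_dil (1 + s) cg).
have Phi0 z : (0 <= Phi z)%E.
  by rewrite /Phi; case: ifP => // _; rewrite lee_fin mulr_ge0 ?ler0n ?cg.2.
have mPhi : measurable_fun setT Phi.
  apply: measurable_fun_ifT => //.
    exact: (measurableT_comp (mpred_annulus (m := m) 0) measurable_snd).
  apply/measurable_EFinP.
  (* The order of integration will be exchanged, which needs joint measurability in the dilation
     parameter and the point. *)
  apply: (@caratheodory_measurable R _ (projT2 (TT R n))
    (fun z => n%:R * g ((1 + z.1) *: ev z.2))) => [w|s] /=.
    move=> s; apply: (@continuousM _ _ (fun=> n%:R)); first exact: cst_continuous.
    apply: (@continuous_comp _ _ _ (fun s : R => (1 + s) *: ev w) g); last exact: cg.1.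
    by apply: continuousZl; apply: continuousD; [exact: cst_continuous|exact: cvg_id].
  exact: (@continuous_ev_measurable R n (fun x => n%:R * g ((1 + s) *: x))) (cgl s).1.
pose G w := (\int[unif01 R]_s Phi (s, w))%E.
have mG : measurable_fun setT G by exact: measurable_fun_fubini_tonelli_G.
have G0 w : (0 <= G w)%E by apply: integral_ge0 => s _; exact: Phi0.
have mann := @mpred_annulus R m 0.
apply: (@le_trans _ _ (\int[mun (@lebesgue_measure R) n]_w
   ((if annulus 0 (ev w) then `|f (2 *: ev w)|%:E else 0) + G w))%E).
  rewrite rintE//; apply: ge0_le_integral => //.
  - by move=> w _; exact: (rint_fun_ge0 _ _ cff).
  - exact: (rint_measurable mann cff).
  - by apply: emeasurable_funD => //; exact: (rint_measurable mann cf2).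
  - move=> w _; rewrite /G /Phi /=; case: ifP => [aw|_]; last first.
      by rewrite integral0 adde0.
    apply: (le_trans (radial_pointwise cg rd aw)); rewrite leeD2l//.
    rewrite integral_unif01//.
      apply/measurable_EFinP; apply: continuous_measurable_fun => s.
      apply: (@continuousM _ _ (fun=> n%:R)); first exact: cst_continuous.
      apply: (@continuous_comp _ _ _ (fun s : R => (1 + s) *: ev w) g); last exact: cg.1.
      by apply: continuousZl; apply: continuousD; [exact: cst_continuous|exact: cvg_id].
    by move=> s; rewrite lee_fin mulr_ge0 ?ler0n ?cg.2.
rewrite ge0_integralD//; first last.
- exact: (rint_measurable mann cf2).
- by move=> w _; exact: (rint_fun_ge0 _ _ cf2).
rewrite -(rintE mann cf2) leeD2l//.
have -> : (\int[mun (@lebesgue_measure R) n]_w G w =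
    \int[unif01 R]_s \int[mun (@lebesgue_measure R) n]_w Phi (s, w))%E.
  by rewrite fubini_tonelli.
rewrite integral_unif01; first last.
- by move=> s; apply: integral_ge0 => w _; exact: Phi0.
- exact: measurable_fun_fubini_tonelli_F.
apply: (@le_trans _ _ (\int[@lebesgue_measure R]_(s in `[0%R, 1%R])
  (n%:R * (AI 0 g + AI 1 g))%:E)%E).
  apply: ge0_le_integral => //.
  - by move=> s _; apply: integral_ge0 => w _; exact: Phi0.
  - by apply: measurable_funTS; exact: measurable_fun_fubini_tonelli_F.
  - move=> s; rewrite /= in_itv/= => /andP[s0 s1].
    rewrite -(rintE mann (cgl s)) (rintZ (ler0n R n) mann (cnn_dil (1 + s) cg)) EFinM.
    apply: lee_wpmul2l; first by rewrite lee_fin.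
    by apply: rint_dil_le => //; clear -s0 s1; lra.
rewrite integral_cst//= lebesgue_measure_itv/= lte_fin ltr01.
by rewrite -EFinB -EFinM subr0 mulr1.
Qed.

End RadialInequality.

(** * Sums over the integers *)

Section IntegerSums.
Variable R : realType.
Implicit Types x y z : int -> R.

Definition isum x : \bar R := (\esum_(k in [set: int]) (x k)%:E)%R.

Lemma isum_ge0 x : (forall k, 0 <= x k) -> (0 <= isum x)%E.
Proof. by move=> x0; apply: esum_ge0 => k _; rewrite lee_fin. Qed.

Lemma isum_ub x c :
  (forall s : seq int, uniq s -> ((\sum_(k <- s) x k)%:E <= c)%E) -> (isum x <= c)%E.
Proof.
move=> H; apply: ge_ereal_sup => /= _ [F [finF _] <-].
rewrite fsbig_finite//= sumEFin; apply: H; exact: finmap.fset_uniq.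
Qed.

Lemma isum_lb x (s : seq int) : uniq s -> ((\sum_(k <- s) x k)%:E <= isum x)%E.
Proof.
move=> us; apply: esum_ge; exists [set` s]; first by split => //; exact: finite_seq.
by rewrite -(fsbig_seq _ _ us) sumEFin.
Qed.

Lemma isum_term x k : ((x k)%:E <= isum x)%E.
Proof. by have := @isum_lb x [:: k] isT; rewrite big_seq1. Qed.

Lemma isum_le x y : (forall k, x k <= y k) -> (isum x <= isum y)%E.
Proof. by move=> xy; apply: le_esum => k _; rewrite lee_fin. Qed.

Lemma isumD x y : (forall k, 0 <= x k) -> (forall k, 0 <= y k) ->
  isum (fun k => x k + y k) = (isum x + isum y)%E.
Proof.
move=> x0 y0; rewrite /isum -esumD; last 2 first.
- by move=> k _; rewrite lee_fin.
- by move=> k _; rewrite lee_fin.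
by apply: eq_esum => k _; rewrite EFinD.
Qed.

Lemma isumZ_le x c : 0 <= c -> (isum (fun k => c * x k)%R <= c%:E * isum x)%E.
Proof.
move=> c0; apply: isum_ub => s us; rewrite -mulr_sumr EFinM.
by apply: lee_wpmul2l; [rewrite lee_fin|exact: isum_lb].
Qed.

Lemma isum_shift_le x i : (isum (fun k => x (k + i)%R) <= isum x)%E.
Proof.
apply: isum_ub => s us; rewrite -(big_map (fun k => k + i) predT x).
by apply: isum_lb; rewrite map_inj_uniq// => a b /addIr.
Qed.

Lemma young_powR (x y a b : R) : 0 <= a -> 0 <= b -> a + b = 1 -> 0 <= x -> 0 <= y ->
  x `^ a * y `^ b <= a * x + b * y.
Proof.
move=> a0 b0 ab x0 y0.
have [a00|an0] := eqVneq a 0.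
  have -> : b = 1 by rewrite -ab a00 add0r.
  by rewrite a00 powRr0 powRr1// mul0r add0r !mul1r.
have [b00|bn0] := eqVneq b 0.
  have -> : a = 1 by rewrite -ab b00 addr0.
  by rewrite b00 powRr0 powRr1// mul0r addr0 mulr1 mul1r.
have := @conjugate_powR R (x `^ a) (y `^ b) a^-1 b^-1.
rewrite !invrK !powRK// !invr_gt0 !lt_neqAle ![0 == _]eq_sym an0 bn0 a0 b0 !powR_ge0.
by move=> /(_ isT isT isT isT ab); rewrite [x * a]mulrC [y * b]mulrC.
Qed.

(** Young's inequality for the normalised terms [x k / X] and [y k / Y]; vanishing sums and
    exponents are set apart. *)
Lemma sum_holder (s : seq int) x y (a b : R) : 0 <= a -> 0 <= b -> a + b = 1 ->
  (forall k, 0 <= x k) -> (forall k, 0 <= y k) ->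
  \sum_(k <- s) x k `^ a * y k `^ b <= (\sum_(k <- s) x k) `^ a * (\sum_(k <- s) y k) `^ b.
Proof.
move=> a0 b0 ab x0 y0.
have [a00|an0] := eqVneq a 0.
  have -> : b = 1 by rewrite -ab a00 add0r.
  rewrite a00 !powRr0 mul1r powRr1 ?sumr_ge0//.
  by apply: ler_sum => k _; rewrite powRr0 mul1r powRr1.
have [b00|bn0] := eqVneq b 0.
  have -> : a = 1 by rewrite -ab b00 addr0.
  rewrite b00 !powRr0 mulr1 powRr1 ?sumr_ge0//.
  by apply: ler_sum => k _; rewrite powRr0 mulr1 powRr1.
set X := \sum_(k <- s) x k; set Y := \sum_(k <- s) y k.
have X0 : 0 <= X by exact: sumr_ge0.
have Y0 : 0 <= Y by exact: sumr_ge0.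
have zero (w : int -> R) : (forall k, 0 <= w k) -> \sum_(k <- s) w k = 0 -> forall k, k \in s -> w k = 0.
  move=> w0 /eqP; rewrite psumr_eq0// => /allP H k ks; exact/eqP/H.
have [XE|XN] := eqVneq X 0.
  rewrite XE powR0// mul0r big_seq big1// => k ks.
  by rewrite (zero x x0 XE k ks) powR0// mul0r.
have [YE|YN] := eqVneq Y 0.
  rewrite YE powR0// mulr0 big_seq big1// => k ks.
  by rewrite (zero y y0 YE k ks) powR0// mulr0.
have E k : x k `^ a * y k `^ b <= X `^ a * Y `^ b * (a * (x k / X) + b * (y k / Y)).
  have Xi : 0 <= X^-1 by rewrite invr_ge0.
  have Yi : 0 <= Y^-1 by rewrite invr_ge0.
  have := young_powR a0 b0 ab (mulr_ge0 (x0 k) Xi) (mulr_ge0 (y0 k) Yi).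
  move=> /(ler_wpM2l (mulr_ge0 (powR_ge0 X a) (powR_ge0 Y b))); apply: le_trans.
  rewrite mulrACA -!powRM ?mulr_ge0//.
  by rewrite [X * _]mulrC [Y * _]mulrC !mulfVK.
apply: (le_trans (ler_sum _ (fun k _ => E k))).
rewrite -mulr_sumr big_split /= -!mulr_sumr -!mulr_suml -/X -/Y !mulfV// !mulr1 ab.
by rewrite mulr1.
Qed.

Lemma isum_holder x y (a b : R) : 0 <= a -> 0 <= b -> a + b = 1 ->
  (forall k, 0 <= x k) -> (forall k, 0 <= y k) ->
  (isum (fun k => x k `^ a * y k `^ b)%R <= isum x `^ a * isum y `^ b)%E.
Proof.
move=> a0 b0 ab x0 y0; apply: isum_ub => s us.
apply: (@le_trans _ _ ((\sum_(k <- s) x k) `^ a * (\sum_(k <- s) y k) `^ b)%:E).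
  by rewrite lee_fin sum_holder.
have mono w c : 0 <= c -> (forall k, 0 <= w k) ->
    (((\sum_(k <- s) w k) `^ c)%:E <= isum w `^ c)%E.
  move=> c0 w0; rewrite -poweR_EFin; apply: gt0_ler_poweR => //.
  - by rewrite in_itv/= lee_fin sumr_ge0//= leey.
  - by rewrite in_itv/= isum_ge0//= leey.
  - exact: isum_lb.
by rewrite EFinM; apply: lee_pmul; rewrite ?lee_fin ?powR_ge0// mono.
Qed.

(** For [s < 1] the triangle inequality fails, so the window is peeled off one term at a time with
    [powR_addle], and each translate has at most the full sum. *)
Lemma isum_window (s : R) l : 0 < s -> exists2 c : R, 0 < c &
  forall x, (forall k, 0 <= x k) ->
  (isum (fun k => (\sum_(i < l) x (k + i%:Z - 1)) `^ s)%R <= c%:E * isum (fun k => x k `^ s)%R)%E.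
Proof.
move=> s0; elim: l => [|l [c c0 IH]].
  exists 1 => // x x0; rewrite mul1e.
  by apply: isum_le => k; rewrite big_ord0 powR0 ?gt_eqF// powR_ge0.
exists (2 `^ s * (c + 1)); first by rewrite mulr_gt0 ?powR_gt0// addr_gt0.
move=> x x0.
apply: (@le_trans _ _ (isum (fun k => 2 `^ s * ((\sum_(i < l) x (k + i%:Z - 1)) `^ s +
     x (k + l%:Z - 1) `^ s)))).
  apply: isum_le => k; rewrite big_ord_recr/=; apply: powR_addle => //; first exact: ltW.
  exact: sumr_ge0.
apply: (le_trans (isumZ_le _ (powR_ge0 _ _))).
rewrite EFinM -muleA; apply: lee_wpmul2l; first by rewrite lee_fin powR_ge0.
rewrite isumD; try by move=> k; exact: powR_ge0.
rewrite EFinD ge0_muleDl ?lee_fin ?ler01 ?(ltW c0)//.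
apply: leeD; first exact: IH.
rewrite mul1e; have := isum_shift_le (fun k => x k `^ s) (l%:Z - 1).
by under eq_fun do rewrite addrA.
Qed.

(** The index [j] depends on [k], so the maps [k + j L] may collide. Replacing the single term by
    the series over all [i] removes this: for fixed [i] the shift is injective, and the geometric
    series yields [1/(1 - rho)]. *)
Lemma isum_decay y z (c rho : R) (L : int) : 0 < c -> 0 <= rho < 1 ->
  (forall k, 0 <= z k) ->
  (forall k, exists j : nat, y k <= c * rho ^+ j * z (k + j%:Z * L)) ->
  (isum y <= (c / (1 - rho))%:E * isum z)%E.
Proof.
move=> c0 /andP[r0 r1] z0 /choice[j H].
have d0 : 0 < 1 - rho by rewrite subr_gt0.
have cd : 0 < c / (1 - rho) by exact: divr_gt0.
have Z0 := isum_ge0 z0; have lb := @isum_lb z.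
move: (isum z) Z0 lb => [t| |]// Z0 lb; last first.
  by rewrite gt0_muley ?lte_fin// leey.
have t0 : 0 <= t by rewrite -lee_fin.
apply: isum_ub => s us; rewrite -EFinM lee_fin.
(* A finite list of [k] involves finitely many [j], hence a finite geometric sum suffices. *)
pose J := (\max_(k <- s) j k).+1.
apply: (@le_trans _ _ (\sum_(k <- s) \sum_(i < J) c * rho ^+ i * z (k + i%:Z * L))).
  rewrite big_seq [leRHS]big_seq; apply: ler_sum => k ks.
  have jJ : (j k < J)%N by rewrite ltnS; exact: leq_bigmax_seq.
  apply: (le_trans (H k)); rewrite (bigD1 (Ordinal jJ))//= lerDl sumr_ge0// => i _.
  by rewrite !mulr_ge0 ?exprn_ge0// ltW.
rewrite exchange_big/=.
apply: (@le_trans _ _ (\sum_(i < J) c * rho ^+ i * t)).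
  apply: ler_sum => i _; rewrite -mulr_sumr ler_wpM2l ?mulr_ge0 ?exprn_ge0 ?(ltW c0)//.
  rewrite -lee_fin -(big_map (fun k => k + i%:Z * L) predT z).
  by apply: lb; rewrite map_inj_uniq// => a b /addIr.
rewrite -mulr_suml -mulr_sumr ler_wpM2r// ler_wpM2l ?(ltW c0)//.
rewrite -[leRHS]mul1r ler_pdivlMr// mulrC.
have := subrX1 rho J => /(congr1 -%R); rewrite opprB -mulNr opprB => <-.
by rewrite gerBl exprn_ge0.
Qed.

End IntegerSums.

(** * The halving argument *)

Section Descent.
Variables (R : realType) (theta beta gamma delta C : R) (L : nat).
Hypotheses (C0 : 0 < C) (th01 : 0 <= theta <= 1).
Hypotheses (gammaE : gamma = theta * delta + (1 - theta) * beta).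
Hypotheses (Lgamma : 2 <= L%:R * gamma) (Lbeta : 2 <= L%:R * beta).
Variables W G A : int -> R.
Hypotheses (W0 : forall k, 0 <= W k) (G0 : forall k, 0 <= G k) (A0 : forall k, 0 <= A k).
Hypothesis Wstep : forall k, W k <= W (k + 1) + C * 2 `^ (- (k%:~R * delta)) * (G k + G (k + 1)).
Hypothesis WA : forall k, W k <= C * 2 `^ (- (k%:~R * beta)) * A k.
Variable B : R.
Hypothesis AB : forall k, A k <= B.

(** Bounds [2^(-l delta)] for all [l <= L], whatever the sign of [delta]. *)
Definition descent_factor : R := 2 `^ (L%:R * `|delta|).
(** The 4 is 2 from bounding two terms by a window and 2 from halving; the [+ 1] makes the constant
    positive. *)
Definition descent_const : R := 4 * (C * descent_factor) * L%:R + 1.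
(** Runs from [k - 1] to [k + L]: the terms met in [L] radial steps from [k], together with the
    neighbours in the local inequality. *)
Definition window (k : int) : R := \sum_(i < L.+2) G (k + i%:Z - 1).

Let D0 : 0 < descent_factor. Proof. exact: powR_gt0. Qed.
Let K0 : 0 < descent_const.
Proof. by rewrite ltr_wpDl// !mulr_ge0// ltW. Qed.

Lemma window_ge k (i : nat) : (i <= L)%N -> G (k + i%:Z) <= window k.
Proof.
move=> iL; rewrite /window (bigD1 (Ordinal (iL : i.+1 < L.+2)%N))//=.
have -> : k + i.+1%:Z - 1 = k + i%:Z by rewrite -addn1 PoszD addrA addrK.
by rewrite lerDl sumr_ge0.
Qed.

Lemma window_ge0 k : 0 <= window k.
Proof. exact: sumr_ge0. Qed.

Lemma pow2D (a b : R) : 2 `^ (a + b) = 2 `^ a * 2 `^ b :> R.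
Proof. by rewrite powRD// pnatr_eq0 implybT. Qed.

Lemma telescope k (l : nat) : (l <= L)%N ->
  W k <= W (k + l%:Z) +
    C * descent_factor * 2 `^ (- (k%:~R * delta)) * (l%:R * (2 * window k)).
Proof.
elim: l => [_|l IH lL]; first by rewrite addr0 mul0r mulr0 addr0.
apply: (le_trans (IH (ltnW lL))).
have E : k + l.+1%:Z = k + l%:Z + 1 by rewrite -addn1 PoszD addrA.
set X := C * descent_factor * _.
have -> : X * (l.+1%:R * (2 * window k)) = X * (l%:R * (2 * window k)) + X * (2 * window k).
  by rewrite -natr1; ring.
rewrite addrCA [leLHS]addrC lerD2l E; apply: (le_trans (Wstep _)); rewrite lerD2l {}/X.
have w1 := window_ge k (ltnW lL); have w2 := window_ge k lL.
rewrite -mulrA -[leRHS]mulrA -mulrA ler_pM2l//.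
have -> : 2 * window k = window k + window k by rewrite mulr_natl mulr2n.
rewrite mulrA; apply: ler_pM.
- exact: powR_ge0.
- by rewrite addr_ge0.
- rewrite intrD mulrDl opprD pow2D mulrC ler_wpM2r ?powR_ge0//.
  apply: ler_powR; first by rewrite ler1n.
  rewrite -mulrN; apply: (le_trans (ler_norm _)).
  rewrite normrM normrN ger0_norm ?ler0n// ler_wpM2r// ler_nat ltnW//.
- by rewrite -E; apply: lerD.
Qed.

(* When W has halved after L steps, the increments, hence G, control W; combine
   this with the bound of W by A. *)
Lemma descent_good k : W (k + L%:Z) <= W k / 2 ->
  2 `^ (k%:~R * gamma) * W k <=
    (descent_const `^ theta * C `^ (1 - theta)) * (window k `^ theta * A k `^ (1 - theta)).
Proof.
move=> good; have /andP[t0 t1] := th01; have t1' : 0 <= 1 - theta by rewrite subr_ge0.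
have h1 : W k <= descent_const * 2 `^ (- (k%:~R * delta)) * window k.
  have := telescope k (leqnn L); move: good (window_ge0 k).
  have := W0 k; have := powR_ge0 2 (- (k%:~R * delta)).
  rewrite /descent_const; move: (W (k + L%:Z)) (W k) (2 `^ _) (window k) => a w e g.
  move=> e0 w0 gd g0 tel.
  have eg : 0 <= e * g by exact: mulr_ge0.
  have cd : C * descent_factor * e * (L%:R * (2 * g)) = (C * descent_factor * L%:R) * (e * g) * 2 by ring.
  rewrite cd in tel.
  have -> : (4 * (C * descent_factor) * L%:R + 1) * e * g =
     (C * descent_factor * L%:R) * (e * g) * 4 + e * g by ring.
  move: (C * descent_factor * L%:R * (e * g)) (e * g) eg tel => X Y Y0 tel.
  by lra.
have h2 := WA k.
have [W00|Wn0] := eqVneq (W k) 0.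
  by rewrite W00 mulr0 !mulr_ge0 ?powR_ge0.
have WE : W k = W k `^ theta * W k `^ (1 - theta).
  by rewrite -powRD ?Wn0 ?implybT// addrC subrK powRr1.
have g1 := powR_le t0 (W0 k) h1; have g2 := powR_le t1' (W0 k) h2.
have e1 : 0 <= 2 `^ (- (k%:~R * delta)) :> R by exact: powR_ge0.
have e2 : 0 <= 2 `^ (- (k%:~R * beta)) :> R by exact: powR_ge0.
have gg := ler_pM (powR_ge0 _ _) (powR_ge0 _ _) g1 g2; rewrite -WE in gg.
apply: (le_trans (ler_wpM2l (powR_ge0 _ _) gg)).
rewrite !powRM ?mulr_ge0 ?window_ge0// ?(ltW K0) ?(ltW C0)// -!powRrM.
(* By [gammaE], [gamma] is exactly the exponent at which the weights of the two bounds cancel after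
   interpolation. *)
have E : 2 `^ (k%:~R * gamma) * (2 `^ (- (k%:~R * delta) * theta) *
     2 `^ (- (k%:~R * beta) * (1 - theta))) = 1 :> R.
  rewrite -!pow2D (_ : _ + _ = 0) ?powRr0// gammaE; ring.
rewrite le_eqVlt; apply/orP; left; apply/eqP.
move: E; move: (descent_const `^ theta) (C `^ (1 - theta)) (window k `^ theta) (A k `^ (1 - theta)).
move: (2 `^ (k%:~R * gamma)) (2 `^ (- (k%:~R * delta) * theta))
  (2 `^ (- (k%:~R * beta) * (1 - theta))) => x y z a b c d E.
by rewrite -[RHS]mul1r -E; ring.
Qed.

(* Otherwise move to k + L: as A is bounded and L * beta >= 2, W cannot keep
   decaying slower than 2^-j along k + j L. *)
Lemma descent_reach k : 0 < W k -> exists2 j : nat,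
  W (k + j%:Z * L%:Z + L%:Z) <= W (k + j%:Z * L%:Z) / 2 & W k <= 2 ^+ j * W (k + j%:Z * L%:Z).
Proof.
move=> Wk; apply: contrapT => H.
have all j : W k <= 2 ^+ j * W (k + j%:Z * L%:Z).
  elim: j => [|j IH]; first by rewrite mul0r addr0 expr0 mul1r.
  have [le|lt] := leP (W (k + j%:Z * L%:Z + L%:Z)) (W (k + j%:Z * L%:Z) / 2).
    by exfalso; apply: H; exists j.
  have -> : k + j.+1%:Z * L%:Z = k + j%:Z * L%:Z + L%:Z by rewrite -addn1 PoszD mulrDl mul1r addrA.
  apply: (le_trans IH); rewrite exprSr -mulrA ler_pM2l ?exprn_gt0//.
  by rewrite [leRHS]mulrC -ler_pdivrMr//; exact: ltW.
pose E := C * 2 `^ (- (k%:~R * beta)) * B.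
(* Without halving, [W k <= 2^j W (k + j L)]. The bound by [A], with [L beta >= 2], contributes a
   factor [4^-j], so [2^j W k] would stay bounded in [j]. *)
have bnd j : W k * 2 ^+ j <= E.
  have := all j => /le_trans /(_ (ler_wpM2l (exprn_ge0 j (ler0n R 2)) (WA _))) h.
  apply: (@le_trans _ _ (2 ^+ j * (C * 2 `^ (- ((k + j%:Z * L%:Z)%:~R * beta)) *
     A (k + j%:Z * L%:Z)) * 2 ^+ j)).
    by rewrite ler_pM2r ?exprn_gt0.
  have -> : 2 ^+ j * (C * 2 `^ (- ((k + j%:Z * L%:Z)%:~R * beta)) * A (k + j%:Z * L%:Z)) * 2 ^+ j
    = C * (2 ^+ j * 2 ^+ j * 2 `^ (- ((k + j%:Z * L%:Z)%:~R * beta))) * A (k + j%:Z * L%:Z) by ring.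
  apply: ler_pM => //; first by rewrite !mulr_ge0 ?exprn_ge0 ?powR_ge0// ltW.
  rewrite ler_pM2l// -!powR_mulrn// -!pow2D; apply: ler_powR; first by rewrite ler1n.
  rewrite intrD intrM; have : 0 <= j%:R :> R by rewrite ler0n.
  have -> : (j%:Z)%:~R = j%:R :> R by [].
  have -> : (L%:Z)%:~R = L%:R :> R by [].
  move: (j%:R) (k%:~R) (L%:R) Lbeta => a c l lb a0.
  have : a * 2 <= a * (l * beta) by exact: ler_wpM2l.
  rewrite !mulrDl !opprD; have -> : a * l * beta = a * (l * beta) by rewrite mulrA.
  by move: (a * (l * beta)) (c * beta) => u v; lra.
have arch := archi_boundP (divr_ge0 (le_trans (mulr_ge0 (ltW Wk) (exprn_ge0 0 (ler0n R 2))) (bnd 0%N)) (ltW Wk)).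
move: arch; set N := Num.bound _; rewrite ltr_pdivrMr// => EN.
have := bnd N; rewrite leNgt => /negP; apply; apply: (lt_le_trans EN).
rewrite mulrC ler_pM2l// -natrX ler_nat ltnW//.
exact: ltn_expl.
Qed.

(** At the halving index the weight is [2^((k + j L) gamma)]; moving it back to [k] gains
    [2^(-j L gamma) <= 4^-j], which against the loss [2^j] leaves [2^-j]. *)
Lemma descent k : exists j : nat, 2 `^ (k%:~R * gamma) * W k <=
    (descent_const `^ theta * C `^ (1 - theta)) * 2^-1 ^+ j *
    (window (k + j%:Z * L%:Z) `^ theta * A (k + j%:Z * L%:Z) `^ (1 - theta)).
Proof.
have [W00|Wn0] := eqVneq (W k) 0.
  by exists 0%N; rewrite W00 mulr0 !mulr_ge0 ?powR_ge0// exprn_ge0// invr_ge0.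
have Wk : 0 < W k by rewrite lt_neqAle eq_sym Wn0 W0.
have [j good reach] := descent_reach Wk; exists j.
have := descent_good good.
move=> /(ler_wpM2l (_ : 0 <= 2^-1 ^+ j)) H.
rewrite mulrAC; apply: (le_trans _ (le_trans (H _) _)); last by rewrite mulrC.
  apply: (le_trans (ler_wpM2l (powR_ge0 _ _) reach)).
  rewrite !mulrA ler_wpM2r// intrD intrM mulrDl pow2D.
  rewrite [2^-1 ^+ j * _]mulrCA ler_pM2l ?powR_gt0//.
  have two : 0 < 2 ^+ j :> R by exact: exprn_gt0.
  rewrite exprVn [leRHS]mulrC ler_pdivlMr// -!powR_mulrn// -!pow2D; apply: ler_powR; first by rewrite ler1n.
  have : 0 <= j%:R :> R by rewrite ler0n.
  have -> : (j%:Z)%:~R = j%:R :> R by [].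
  have -> : (L%:Z)%:~R = L%:R :> R by [].
  move: (j%:R) (L%:R) Lgamma => a l lb a0.
  have : a * 2 <= a * (l * gamma) by exact: ler_wpM2l.
  by rewrite mulrA; move: (a * l * gamma) => u; lra.
by rewrite exprn_ge0// invr_ge0.
Qed.

End Descent.

(** * The discrete inequality for the four sequences *)

Section DiscreteInequality.
Variable R : realType.

Lemma powR_exprn (x r : R) j : 0 <= x -> (x ^+ j) `^ r = (x `^ r) ^+ j.
Proof.
move=> x0; elim: j => [|j IH]; first by rewrite !expr0 powR1.
by rewrite !exprS (powRM _ x0 (exprn_ge0 _ x0)) IH.
Qed.

Lemma powR_sum4 (a b c d r : R) : 0 <= r -> 0 <= a -> 0 <= b -> 0 <= c -> 0 <= d ->
  ((a + b) + (c + d)) `^ r <= 2 `^ r * 2 `^ r * ((a `^ r + b `^ r) + (c `^ r + d `^ r)).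
Proof.
move=> r0 a0 b0 c0 d0; apply: (le_trans (powR_addle r0 (addr_ge0 a0 b0) (addr_ge0 c0 d0))).
by rewrite -mulrA ler_wpM2l ?powR_ge0// mulrDr lerD// powR_addle.
Qed.

Lemma powR_interp_pow (x y theta s v r : R) : 0 < s -> 0 < v -> 0 <= x -> 0 <= y ->
  (x `^ theta * y `^ (1 - theta)) `^ r =
  (x `^ s) `^ (theta * r / s) * (y `^ v) `^ ((1 - theta) * r / v).
Proof.
move=> s0 v0 x0 y0; rewrite (powRM _ (powR_ge0 _ _) (powR_ge0 _ _)).
have E (c e : R) : 0 < e -> e * (c / e) = c by move=> e0; rewrite mulrCA mulfV ?mulr1// gt_eqF.
by rewrite -(powRrM x theta) -(powRrM y (1 - theta)) -(powRrM x s) -(powRrM y v) (E _ _ s0) (E _ _ v0).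
Qed.

Lemma archi_two (a b : R) : 0 < a -> 0 < b ->
  exists2 L : nat, (0 < L)%N & 2 <= L%:R * a /\ 2 <= L%:R * b.
Proof.
move=> a0 b0; have p (c : R) : 0 < c -> 2 / c <= (Num.bound (2 / c))%:R.
  by move=> c0; rewrite ltW// archi_boundP// divr_ge0// ltW.
exists (Num.bound (2 / a) + Num.bound (2 / b)).+1 => //.
split; rewrite -ler_pdivrMr//.
  by apply: (le_trans (p _ a0)); rewrite ler_nat leqW// leq_addr.
by apply: (le_trans (p _ b0)); rewrite ler_nat leqW// leq_addl.
Qed.

Lemma window3 (A : int -> R) k :
  window 1 A k = A (k - 1) + A k + A (k + 1).
Proof.
rewrite /window !big_ord_recr big_ord0 /= add0r.
by congr (A _ + A _ + A _); rewrite ?addr0 ?addrK// -addrA.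
Qed.

Lemma window_le (A : int -> R) L L' k : (L <= L')%N -> (forall k, 0 <= A k) ->
  window L A k <= window L' A k.
Proof.
move=> LL A0; rewrite /window -!(big_mkord xpredT (fun i => A (k + i%:Z - 1))).
rewrite [leRHS](@big_cat_nat _ _ _ L.+2)//= ?lerDl ?sumr_ge0//; exact: leqW.
Qed.

(** Giving [W (k - 1)] its own weight costs [2^gamma], while [W (k + 1)] gains one; as
    [2^gamma >= 1], a single factor covers all terms. *)
Lemma discrete_local (M Y : int -> R) (W : int -> R) (Z : int -> R) (C gamma : R) k :
  0 < C -> 0 < gamma -> (forall k, 0 <= W k) -> 0 <= Z k ->
  (forall k, Y k = 2 `^ (k%:~R * gamma) * W k) ->
  M k <= C * (Z k + 2 `^ (k%:~R * gamma) * (W (k - 1) + W k + W (k + 1))) ->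
  M k <= C * 2 `^ gamma * ((Z k + Y (k - 1)) + (Y k + Y (k + 1))).
Proof.
move=> C0 g0 W0 Z0 YE /le_trans; apply; rewrite -mulrA ler_pM2l//.
have e1 : 1 <= 2 `^ gamma :> R by rewrite -[leLHS](powRr0 2) ler_powR ?ler1n// ltW.
rewrite !YE; have E a : 2 `^ ((k + a)%:~R * gamma) = 2 `^ (k%:~R * gamma) * 2 `^ (a%:~R * gamma) :> R.
  by rewrite intrD mulrDl pow2D.
rewrite !E (_ : (-1)%:~R = -1 :> R)// (_ : 1%:~R = 1 :> R)// mul1r mulN1r powRN.
move: (W0 (k - 1)) (W0 k) (W0 (k + 1)) Z0 (powR_ge0 2 (k%:~R * gamma)).
move: (W (k - 1)) (W k) (W (k + 1)) (Z k) (2 `^ (k%:~R * gamma)) => a b c z x a0 b0 c0 z0 x0.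
move: (2 `^ gamma) e1 => e e1; have en : e != 0 by rewrite gt_eqF// (lt_le_trans ltr01).
have -> : e * (z + x / e * a + (x * b + x * e * c)) =
  e * z + x * a + e * (x * b) + e * e * (x * c) by field.
have xa := mulr_ge0 x0 a0; have xb := mulr_ge0 x0 b0; have xc := mulr_ge0 x0 c0.
rewrite !mulrDr !addrA; apply: lerD; first (apply: lerD; first apply: lerD) => //.
- by rewrite ler_peMl.
- by rewrite ler_peMl.
- by rewrite ler_peMl// (le_trans e1)// ler_peMl// (le_trans ler01).
Qed.

(** All that remains once scaling is removed. [K] is chosen before the bound [B] of [A], which
    serves only to make the descent stop. *)
Lemma discrete_gn (theta beta gamma delta C s v r : R) :
  0 < C -> 0 < s -> 0 < v -> 0 < r -> 0 <= theta <= 1 ->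
  r^-1 = theta / s + (1 - theta) / v ->
  gamma = theta * delta + (1 - theta) * beta -> 0 < gamma -> 0 < beta ->
  exists2 K : R, 0 < K & forall (M W G A : int -> R) (B : R),
    (forall k, 0 <= M k) -> (forall k, 0 <= W k) -> (forall k, 0 <= G k) ->
    (forall k, 0 <= A k) -> (forall k, A k <= B) ->
    (forall k, W k <= W (k + 1) + C * 2 `^ (- (k%:~R * delta)) * (G k + G (k + 1))) ->
    (forall k, W k <= C * 2 `^ (- (k%:~R * beta)) * A k) ->
    (forall k, M k <= C * ((G (k - 1) + G k + G (k + 1)) `^ theta *
       (A (k - 1) + A k + A (k + 1)) `^ (1 - theta) +
       2 `^ (k%:~R * gamma) * (W (k - 1) + W k + W (k + 1)))) ->
    (isum (fun k => M k `^ r)%R <= K%:E *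
      (isum (fun k => G k `^ s)%R `^ (theta * r / s) *
       isum (fun k => A k `^ v)%R `^ ((1 - theta) * r / v)))%E.
Proof.
move=> C0 s0 v0 r0 th rE gE g0 b0; have /andP[t0 t1] := th.
have t1' : 0 <= 1 - theta by rewrite subr_ge0.
have [L L0 [Lg Lb]] := archi_two g0 b0.
have [c1 c10 H1] := @isum_window R s L.+2 s0.
have [c2 c20 H2] := @isum_window R v 3 v0.
set a := theta * r / s; set b := (1 - theta) * r / v.
have a0 : 0 <= a by rewrite divr_ge0 ?mulr_ge0// ltW.
have bb0 : 0 <= b by rewrite divr_ge0 ?mulr_ge0// ltW.
have ab : a + b = 1.
  have -> : a + b = r * (theta / s + (1 - theta) / v) by rewrite /a /b; ring.
  by rewrite -rE mulfV// gt_eqF.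
have [Kd KdE Kd0] : exists2 Kd, Kd = descent_const delta C L `^ theta * C `^ (1 - theta) & 0 < Kd.
  exists (descent_const delta C L `^ theta * C `^ (1 - theta)) => //.
  rewrite mulr_gt0 ?powR_gt0// /descent_const ltr_wpDl// !mulr_ge0 ?powR_ge0//.
  exact: ltW.
have half0 : 0 <= 2^-1 :> R by rewrite invr_ge0.
pose rho : R := 2^-1 `^ r.
have rho01 : 0 <= rho < 1.
  have p1 : 1 `^ r = 1 :> R by rewrite powR1.
  rewrite powR_ge0/= -[ltRHS]p1; apply: gt0_ltr_powR; rewrite ?nnegrE ?invr_ge0//.
  by rewrite invf_lt1// ltr1n.
(* The sum of the geometric series of ratio [2^-r] produced by the descent. *)
pose c3 := Kd `^ r / (1 - rho).
have c30 : 0 < c3 by rewrite divr_gt0 ?powR_gt0// subr_gt0; case/andP: rho01.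
pose c4 := (C * 2 `^ gamma) `^ r * (2 `^ r * 2 `^ r).
have c40 : 0 < c4 by rewrite !mulr_gt0 ?powR_gt0// mulr_gt0// powR_gt0.
exists (c4 * (1 + 3 * c3) * (c1 `^ a * c2 `^ b)).
  apply: mulr_gt0; last by apply: mulr_gt0; exact: powR_gt0.
  by apply: mulr_gt0 => //; apply: addr_gt0 => //; exact: mulr_gt0.
move=> M W G A B M0 W0 G0 A0 AB Wstep WA local.
(* With the long window of [G] and the short one of [A], [Z] dominates both the main term of the
   local inequality and the outcome of the descent. The local bound contains [Z] once and [Y] three
   times, whence [1 + 3 c3]. *)
pose Z k := window L G k `^ theta * window 1 A k `^ (1 - theta).
pose Y k := 2 `^ (k%:~R * gamma) * W k.
have wG0 k : 0 <= window L G k by exact: sumr_ge0.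
have wA0 k : 0 <= window 1 A k by exact: sumr_ge0.
have Z0 k : 0 <= Z k by rewrite mulr_ge0 ?powR_ge0.
have Y0 k : 0 <= Y k by rewrite mulr_ge0 ?powR_ge0.
have ZT : (isum (fun k => Z k `^ r)%R <= (c1 `^ a * c2 `^ b)%:E *
    (isum (fun k => G k `^ s)%R `^ a * isum (fun k => A k `^ v)%R `^ b))%E.
  rewrite (_ : (fun k => Z k `^ r) =
    (fun k => (window L G k `^ s) `^ a * (window 1 A k `^ v) `^ b)); last first.
    by apply/funext => k; rewrite /Z (@powR_interp_pow _ _ theta s v).
  have ps (x : int -> R) (e : R) k : 0 <= x k `^ e by exact: powR_ge0.
  apply: (le_trans (isum_holder a0 bb0 ab (ps _ s) (ps _ v))).
  have pw (x : int -> R) (y : \bar R) (e : R) : (forall k, 0 <= x k) -> 0 <= e ->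
      (isum x <= y)%E -> (isum x `^ e <= y `^ e)%E.
    move=> x0 e0 xy; have xs := isum_ge0 x0.
    by apply: gt0_ler_poweR => //; rewrite in_itv/= leey andbT//; exact: le_trans xy.
  have -> : ((c1 `^ a * c2 `^ b)%:E * (isum (fun k => G k `^ s)%R `^ a *
      isum (fun k => A k `^ v)%R `^ b) =
      (c1%:E * isum (fun k => G k `^ s)%R) `^ a * (c2%:E * isum (fun k => A k `^ v)%R) `^ b)%E.
    have iG := isum_ge0 (ps G s); have iA := isum_ge0 (ps A v).
    have pc1 : (0 <= c1%:E)%E by rewrite lee_fin ltW.
    have pc2 : (0 <= c2%:E)%E by rewrite lee_fin ltW.
    by rewrite (poweRM a pc1 iG) (poweRM b pc2 iA) !poweR_EFin EFinM muleACA.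
  by apply: lee_pmul; rewrite ?poweR_ge0//; apply: pw => //; [exact: H1|exact: H2].
have YT : (isum (fun k => Y k `^ r)%R <= c3%:E * isum (fun k => Z k `^ r)%R)%E.
  apply: (@isum_decay R _ _ (Kd `^ r) rho L%:Z) => //; first exact: powR_gt0.
    by move=> k; exact: powR_ge0.
  move=> k; have [j Hj] := descent C0 th gE Lg Lb W0 G0 A0 Wstep WA AB k.
  exists j; have Hj' : Y k <= Kd * 2^-1 ^+ j * Z (k + j%:Z * L%:Z).
    apply: (le_trans Hj); rewrite -KdE ler_wpM2l ?mulr_ge0 ?(ltW Kd0) ?exprn_ge0 ?invr_ge0//.
    rewrite ler_wpM2l ?powR_ge0// powR_le// window3.
    by rewrite addrAC lerDr addr_ge0.
  have e0 : 0 <= 2^-1 ^+ j :> R by rewrite exprn_ge0// invr_ge0.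
  apply: (le_trans (powR_le (ltW r0) (Y0 k) Hj')).
  rewrite powRM ?Z0 ?mulr_ge0 ?(ltW Kd0)// powRM ?(ltW Kd0)//.
  by rewrite (powR_exprn _ _ half0).
have loc k : M k `^ r <= c4 * ((Z k `^ r + Y (k - 1) `^ r) + (Y k `^ r + Y (k + 1) `^ r)).
  have Lk : M k <= C * (Z k + 2 `^ (k%:~R * gamma) * (W (k - 1) + W k + W (k + 1))).
    apply: (le_trans (local k)); rewrite ler_pM2l// lerD2r /Z window3.
    rewrite ler_wpM2r ?powR_ge0//; apply: powR_le => //; first by rewrite !addr_ge0.
    by rewrite -window3; exact: window_le.
  have := @discrete_local M Y W Z C gamma k C0 g0 W0 (Z0 k) (fun=> erefl) Lk.
  move=> /(powR_le (ltW r0) (M0 k)) /le_trans; apply.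
  rewrite powRM ?addr_ge0 ?Z0 ?Y0 ?mulr_ge0 ?powR_ge0 ?(ltW C0)// /c4 -mulrA.
  rewrite ler_wpM2l ?powR_ge0//; apply: powR_sum4 => //; exact: ltW.
apply: (le_trans (isum_le loc)); apply: (le_trans (isumZ_le _ (ltW c40))).
have -> : ((c4 * (1 + 3 * c3) * (c1 `^ a * c2 `^ b))%:E =
    c4%:E * (1 + 3 * c3)%:E * (c1 `^ a * c2 `^ b)%:E)%E by rewrite !EFinM.
rewrite -[(c4%:E * _ * _ * _)%E]muleA -[(c4%:E * _ * _)%E]muleA.
apply: lee_wpmul2l; first by rewrite lee_fin ltW.
have p0 (x : int -> R) k : 0 <= x k `^ r by exact: powR_ge0.
have pp (x y : int -> R) k : 0 <= x k `^ r + y k `^ r by rewrite addr_ge0 ?powR_ge0.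
rewrite (isumD (pp Z (fun k => Y (k - 1))) (pp Y (fun k => Y (k + 1)))).
rewrite (isumD (p0 Z) (p0 (fun k => Y (k - 1)))) (isumD (p0 Y) (p0 (fun k => Y (k + 1)))).
have S1 := isum_shift_le (fun k => Y k `^ r) (- 1).
have S2 := isum_shift_le (fun k => Y k `^ r) 1.
have iZ := isum_ge0 (p0 Z).
apply: (@le_trans _ _ ((1 + 3 * c3)%:E * isum (fun k => Z k `^ r)%R)%E).
  have -> : (1 + 3 * c3) = (1 + c3) + (c3 + c3) by ring.
  rewrite !EFinD !ge0_muleDl ?adde_ge0 ?lee_fin ?ler01 ?(ltW c30)// mul1e.
  apply: leeD; apply: leeD => //; exact: le_trans YT.
apply: lee_wpmul2l => //; rewrite lee_fin; apply: addr_ge0 => //.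
by apply: mulr_ge0 => //; exact: ltW.
Qed.

End DiscreteInequality.

(** * Derivative bounds for C^1 functions *)

Section C1Functions.
Variables (R : realType) (m : nat).
Local Notation n := m.+1.
Local Notation vec := 'rV[R]_n.
Implicit Types f : vec -> R.

Lemma differentiable_line f (x w : vec) : differentiable f x ->
  is_derive (0 : R) (1 : R) (fun s : R => f (x + s *: w)) ('D_w f x).
Proof.
move=> df; have dv := @diff_derivable R _ _ f x w df.
have E : (fun h : R => h^-1 *: (((fun s : R => f (x + s *: w)) \o shift 0) (h *: (1 : R)) -
     f (x + (0 : R) *: w))) = (fun h : R => h^-1 *: ((f \o shift x) (h *: w) - f x)).
  apply/funext => h /=; rewrite addr0 scale0r addr0 [x + _]addrC.
  by rewrite [h *: 1]mulr1.
by split; rewrite /derivable /derive E.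
Qed.

Lemma C1_continuous f : C1 f -> continuous f.
Proof. by move=> [df _] x; exact: differentiable_continuous. Qed.

Lemma cnn_grad_norm f : C1 f -> cnn (grad_norm f).
Proof.
move=> [df cd]; split=> [x|x]; last exact: sqrtr_ge0.
apply: (@continuous_comp _ _ _ (fun x : vec => \sum_(i < n) derive f x (evec R i) ^+ 2) (@Num.sqrt R)).
  apply: sum_continuous => i y.
  by apply: (@continuousM _ _ (fun x : vec => derive f x (evec R i))); exact: cd.
exact: sqrt_continuous.
Qed.

Lemma partial_le_grad f (x : vec) i : `|derive f x (evec R i)| <= grad_norm f x.
Proof.
rewrite -sqrtr_sqr ler_wsqrtr// (bigD1 i)//= lerDl.
by apply: sumr_ge0 => j _; exact: sqr_ge0.
Qed.

Lemma C1_DG f : C1 f -> DG f (grad_norm f).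
Proof.
move=> [df _] x i; exists (derive f x (evec R i)); last exact: partial_le_grad.
exact: differentiable_line.
Qed.

Lemma derive_le_grad f (x w : vec) : differentiable f x ->
  `|'D_w f x| <= n%:R * enorm w * grad_norm f x.
Proof.
move=> df; rewrite deriveE// {1}(row_sum_delta w) linear_sum.
apply: (le_trans (ler_norm_sum _ _ _)).
apply: (@le_trans _ _ (\sum_(j < n) enorm w * grad_norm f x)).
  apply: ler_sum => j _; rewrite linearZ normrM -deriveE//.
  by apply: ler_pM => //; [exact: coord_le_enorm|exact: partial_le_grad].
by rewrite sumr_const card_ord -[leRHS]mulrA mulr_natl.
Qed.

Lemma C1_RD f : C1 f -> RD f (grad_norm f).
Proof.
move=> [df _] x t; exists ('D_x f (t *: x)); last exact: derive_le_grad.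
apply: is_derive_line.
under eq_fun do rewrite scalerDl.
exact: differentiable_line.
Qed.

Lemma DG_dil f g (l : R) : 0 <= l -> DG f g ->
  DG (fun x => f (l *: x)) (fun x => l * g (l *: x)).
Proof.
move=> l0 /(DG_aff 0 l0).
by under eq_fun do rewrite add0r; under [fun x => l * _]eq_fun do rewrite add0r.
Qed.

Lemma RD_dil f g (l : R) : 0 <= l -> RD f g ->
  RD (fun x => f (l *: x)) (fun x => l * g (l *: x)).
Proof.
move=> l0 H x t; have [d dd dle] := H (l *: x) t.
exists d; first by under eq_fun do rewrite scalerA mulrC -scalerA.
apply: (le_trans dle); rewrite enormZ// !scalerA [t * l]mulrC.
by rewrite le_eqVlt; apply/orP; left; apply/eqP; ring.
Qed.

End C1Functions.

(** * Terms of the Herz norms and their behaviour under dilation *)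

HB.lock Definition NA (R : realType) m (p : R) (h : 'rV[R]_m.+1 -> R) (k : int) : R :=
  AI k (fun x => `|h x| `^ p) `^ p^-1.

(* The k-th term of the Herz norm: its r-th powers sum to herz ^ r. *)
HB.lock Definition SA (R : realType) m (a p : R) (h : 'rV[R]_m.+1 -> R) (k : int) : R :=
  2 `^ (k%:~R * a) * NA p h k.

(** Equals [2^(-k n)] times the integral of [|f|] over [C_k]; the dilated form keeps everything on
    [C_0]. *)
HB.lock Definition SW (R : realType) m (f : 'rV[R]_m.+1 -> R) (k : int) : R :=
  AI 0 (fun x => `|f (2 `^ k%:~R *: x)|).

Section AnnularNorms.
Variables (R : realType) (m : nat).
Local Notation n := m.+1.
Local Notation vec := 'rV[R]_n.
Implicit Types (h f g : vec -> R) (k j : int).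

Definition dil h k : vec -> R := fun x => h (2 `^ k%:~R *: x).

Lemma NAE (p : R) h k : NA p h k = AI k (fun x => `|h x| `^ p) `^ p^-1.
Proof. by rewrite NA.unlock. Qed.

Lemma SAE (a p : R) h k : SA a p h k = 2 `^ (k%:~R * a) * NA p h k.
Proof. by rewrite SA.unlock. Qed.

Lemma SWE f k : SW f k = AI 0 (fun x => `|dil f k x|).
Proof. by rewrite SW.unlock. Qed.

Lemma NA_ge0 p h k : 0 <= NA p h k. Proof. by rewrite NAE powR_ge0. Qed.

Lemma SA_ge0 a p h k : 0 <= SA a p h k.
Proof. by rewrite SAE mulr_ge0 ?powR_ge0// NA_ge0. Qed.

Lemma continuous_dil h k : continuous h -> continuous (dil h k).
Proof.
move=> /(@continuous_aff R m h 0 (2 `^ k%:~R)).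
by under eq_fun do rewrite add0r.
Qed.

Lemma cnn_normX p h : 0 <= p -> continuous h -> cnn (fun x => `|h x| `^ p).
Proof. by move=> p0 ch; apply: cnn_powR => //; exact: cnn_norm. Qed.

Lemma Lp_annulusE p h k : 0 <= p -> continuous h -> Lp_annulus p h k = (NA p h k)%:E.
Proof.
move=> p0 ch; rewrite /Lp_annulus.
have := AIE k (cnn_normX p0 ch); rewrite /anint /rint => ->.
by rewrite poweR_EFin NAE.
Qed.

Lemma herzE a p q h : 0 <= p -> continuous h ->
  herz a p q h = (isum (fun k => SA a p h k `^ q)%R `^ q^-1)%E.
Proof.
move=> p0 ch; rewrite /herz /isum; congr (_ `^ _)%E; apply: eq_esum => k _.
rewrite Lp_annulusE// poweR_EFin -EFinM; congr EFin.
by rewrite SAE (powRM _ (powR_ge0 _ _) (NA_ge0 _ _ _)) -(powRrM 2).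
Qed.

Lemma AI_dil h k j : cnn h ->
  AI j (dil h k) = 2 `^ (- (k%:~R * n%:R)) * AI (k + j) h.
Proof.
move=> ch; rewrite (AIZ (k + j) k ch) mulrA -pow2D addNr powRr0 mul1r.
by congr (AI _ _); rewrite addrC addKr.
Qed.

(** The change of variables gives [2^(-k n/p)]; the other powers of 2 undo the Herz weight contained
    in the term of index [k + j]. *)
Lemma NA_dil p a h k j : 0 < p -> continuous h -> NA p (dil h k) j =
  2 `^ (- (k%:~R * (n%:R / p + a))) * 2 `^ (- (j%:~R * a)) * SA a p h (k + j).
Proof.
move=> p0 ch; have cp := cnn_normX (ltW p0) ch.
rewrite NAE -[fun x => _]/(dil (fun x => `|h x| `^ p) k) AI_dil//.
rewrite (powRM _ (powR_ge0 _ _) (AI_ge0 _ cp)) SAE NAE mulrA -powRrM -!pow2D.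
congr (2 `^ _ * _); rewrite intrD; field; exact/lt0r_neq0.
Qed.

Lemma pow2_small (a : R) j : `|j%:~R| <= 1 :> R -> 2 `^ (- (j%:~R * a)) <= 2 `^ `|a| :> R.
Proof.
move=> j1; apply: ler_powR; first by rewrite ler1n.
apply: (le_trans (ler_norm _)); rewrite normrN normrM.
by rewrite ler_piMl.
Qed.

Lemma NA_dil_le p a h k j : 0 < p -> continuous h -> `|j%:~R| <= 1 :> R ->
  NA p (dil h k) j <=
  2 `^ (- (k%:~R * (n%:R / p + a))) * 2 `^ `|a| * SA a p h (k + j).
Proof.
move=> p0 ch j1; rewrite (NA_dil a)// ler_wpM2r ?SA_ge0// ler_wpM2l ?powR_ge0//.
exact: pow2_small.
Qed.

Lemma NA_scale p c h k : 0 < p -> 0 <= c -> continuous h ->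
  NA p (fun x => c * h x) k = c * NA p h k.
Proof.
move=> p0 c0 ch; have cp := cnn_normX (ltW p0) ch; rewrite !NAE.
have -> : (fun x => `|c * h x| `^ p) = (fun x => c `^ p * `|h x| `^ p).
  by apply/funext => x; rewrite normrM ger0_norm// powRM.
rewrite AI_scale ?powR_ge0// (powRM _ (powR_ge0 _ _) (AI_ge0 _ cp)).
by rewrite powRK// gt_eqF.
Qed.

Lemma powR_sum3 (x y z a : R) : 0 <= a <= 1 -> 0 <= x -> 0 <= y -> 0 <= z ->
  (x + y + z) `^ a <= 4 * (x `^ a + y `^ a + z `^ a).
Proof.
move=> /andP[a0 a1] x0 y0 z0.
have t0 : 0 <= 2 `^ a :> R by exact: powR_ge0.
have t2 : 2 `^ a <= 2 :> R by rewrite -[leRHS](powRr1 (ler0n R 2)) ler_powR// ler1n.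
have h1 := powR_addle a0 x0 y0; have h2 := powR_addle a0 (addr_ge0 x0 y0) z0.
move: (powR_ge0 x a) (powR_ge0 y a) (powR_ge0 z a) (powR_ge0 (x + y) a) h1 h2.
move: ((x + y + z) `^ a) ((x + y) `^ a) (x `^ a) (y `^ a) (z `^ a) (2 `^ a) t0 t2.
clear => S Q X Y Z t t0 t2 X0 Y0 Z0 Q0 h1 h2.
apply: (le_trans h2); apply: (@le_trans _ _ (2 * (Q + Z))).
  by rewrite ler_wpM2r// addr_ge0.
have : Q <= 2 * (X + Y) by apply: (le_trans h1); rewrite ler_wpM2r// addr_ge0.
by lra.
Qed.

Lemma AS_root p h : 1 <= p -> continuous h ->
  AS (fun x => `|h x| `^ p) `^ p^-1 <= 4 * (NA p h (-1) + NA p h 0 + NA p h 1).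
Proof.
move=> p1 ch; have p0 : 0 < p by exact: lt_le_trans p1.
have cp := cnn_normX (ltW p0) ch.
have pV : 0 <= p^-1 <= 1 by rewrite invr_ge0 (ltW p0) invf_le1.
rewrite !NAE; exact: (powR_sum3 pV (AI_ge0 _ cp) (AI_ge0 _ cp) (AI_ge0 _ cp)).
Qed.

Lemma AI_le_NA p k : 1 <= p -> exists2 c : R, 0 < c &
  forall h, continuous h -> AI k (fun x => `|h x|) <= c * NA p h k.
Proof.
move=> p1; exists (AI k (fun _ : vec => 1) `^ (1 - p^-1) + 1).
  by rewrite ltr_wpDl ?powR_ge0.
move=> h ch; apply: (le_trans (AI_jensen k p1 (cnn_norm ch))).
by rewrite -NAE ler_wpM2r ?NA_ge0// lerDl.
Qed.

Lemma AI_dil_SW f k j : continuous f -> `|j%:~R| <= 1 :> R ->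
  AI j (fun x => `|dil f k x|) <= 2 `^ n%:R * SW f (k + j).
Proof.
move=> cf j1; have cff := cnn_norm cf.
rewrite SWE -[fun x => `|dil f k x|]/(dil (fun x => `|f x|) k).
rewrite -[fun x => `|dil f (k + j) x|]/(dil (fun x => `|f x|) (k + j)).
rewrite !(AI_dil _ _ cff) addr0 mulrA ler_wpM2r ?AI_ge0//.
rewrite -pow2D; apply: ler_powR; first by rewrite ler1n.
have : j%:~R * n%:R <= n%:R :> R.
  by rewrite ler_piMl// (le_trans (ler_norm _)).
by move=> H; rewrite intrD mulrDl opprD addrCA lerDl subr_ge0.
Qed.

Lemma SW_ge0 f k : continuous f -> 0 <= SW f k.
Proof. by move=> cf; rewrite SWE; apply: AI_ge0; apply: cnn_norm; exact: continuous_dil. Qed.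

End AnnularNorms.

(** * The hypotheses of the discrete inequality for C^1 functions *)

Section LocalSystem.
Variables (R : realType) (m : nat).
Local Notation n := m.+1.
Local Notation vec := 'rV[R]_n.
Implicit Types (h f g : vec -> R) (k j : int).

(** Gradient majorant of [dil f k]. The factor [2^k] of the chain rule is the origin of the [- 1] in
    [delta = n/p + alpha2 - 1]. *)
Definition dgrad f k : vec -> R := fun x => 2 `^ k%:~R * dil (grad_norm f) k x.

Lemma cnn_dgrad f k : C1 f -> cnn (dgrad f k).
Proof.
move=> c1; apply: cnnZ; first exact: powR_ge0.
exact: (cnn_dil (2 `^ k%:~R) (cnn_grad_norm c1)).
Qed.

Lemma dgrad_norm f k : C1 f -> (fun x => `|dgrad f k x|) = dgrad f k.
Proof. by move=> c1; apply/funext => x; rewrite ger0_norm//; case: (cnn_dgrad k c1). Qed.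

Lemma NA_dgrad_le p a f k j : 0 < p -> C1 f -> `|j%:~R| <= 1 :> R ->
  NA p (dgrad f k) j <=
  2 `^ (- (k%:~R * (n%:R / p + a - 1))) * 2 `^ `|a| * SA a p (grad_norm f) (k + j).
Proof.
move=> p0 c1 j1; have cg := (cnn_grad_norm c1).1.
rewrite (NA_scale _ p0 (powR_ge0 _ _) (@continuous_dil R m _ k cg)).
apply: (le_trans (ler_wpM2l (powR_ge0 _ _) (NA_dil_le a k p0 cg j1))).
rewrite !mulrA -(pow2D k%:~R) le_eqVlt; apply/orP; left; apply/eqP.
by congr (2 `^ _ * _ * _); ring.
Qed.

Lemma AI_dgrad_le p a j : 1 <= p -> `|j%:~R| <= 1 :> R -> exists2 c : R, 0 < c &
  forall f k, C1 f -> AI j (dgrad f k) <=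
    c * (2 `^ (- (k%:~R * (n%:R / p + a - 1))) * SA a p (grad_norm f) (k + j)).
Proof.
move=> p1 j1; have p0 : 0 < p by exact: lt_le_trans p1.
have [c c0 H] := @AI_le_NA R m p j p1.
exists (c * 2 `^ `|a|); first by rewrite mulr_gt0// powR_gt0.
move=> f k c1; have := H _ (cnn_dgrad k c1).1; rewrite (dgrad_norm k c1) => /le_trans; apply.
rewrite -mulrA ler_pM2l//; apply: (le_trans (NA_dgrad_le a k p0 c1 j1)).
by rewrite mulrA [2 `^ `|a| * _]mulrC.
Qed.

(** [radial_integral] for the dilate of index [k]: doubling the argument turns it into the dilate of
    index [k + 1]. *)
Lemma SW_step (p a : R) : 1 <= p -> exists2 c : R, 0 < c & forall f k, C1 f ->
  SW f k <= SW f (k + 1) + c * 2 `^ (- (k%:~R * (n%:R / p + a - 1))) *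
    (SA a p (grad_norm f) k + SA a p (grad_norm f) (k + 1)).
Proof.
move=> p1.
have j0 : `|0%:~R| <= 1 :> R by rewrite normr0.
have j1 : `|1%:~R| <= 1 :> R by rewrite normr1.
have [c0 c00 H0] := AI_dgrad_le a p1 j0; have [c1 c10 H1] := AI_dgrad_le a p1 j1.
exists (n%:R * (c0 + c1)); first by rewrite mulr_gt0 ?ltr0n// addr_gt0.
move=> f k C1f; have cf := C1_continuous C1f.
have l0 : 0 <= 2 `^ k%:~R :> R by exact: powR_ge0.
rewrite !SWE; have := radial_integral (@continuous_dil R m f k cf) (cnn_dgrad k C1f)
  (RD_dil l0 (C1_RD C1f)).
have -> : (fun x => `|dil f k (2 *: x)|) = (fun x => `|dil f (k + 1) x|).
  by apply/funext => x; rewrite /dil scalerA intrD pow2D powRr1.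
move=> /le_trans; apply; rewrite lerD2l -!mulrA ler_pM2l ?ltr0n//.
have := H0 f k C1f; have := H1 f k C1f; rewrite addr0.
have s0 := SA_ge0 a p (grad_norm f) k; have s1 := SA_ge0 a p (grad_norm f) (k + 1).
have e0 := powR_ge0 2 (- (k%:~R * (n%:R / p + a - 1))).
move: (AI 0 _) (AI 1 _) => X0 X1.
move: (SA a p _ k) (SA a p _ (k + 1)) (2 `^ _) s0 s1 e0 => S0 S1 e s0 s1 e0 h1 h0.
apply: (@le_trans _ _ (c0 * (e * S0) + c1 * (e * S1))); first exact: lerD.
have es0 := mulr_ge0 e0 s0; have es1 := mulr_ge0 e0 s1.
have x0 := mulr_ge0 (ltW c10) es0; have x1 := mulr_ge0 (ltW c00) es1.
rewrite !(mulrDl, mulrDr); move: (c0 * (e * S0)) (c0 * (e * S1)) (c1 * (e * S0)) (c1 * (e * S1)) x0 x1.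
by clear => a b c d ? ?; lra.
Qed.

Lemma SW_le (u a : R) : 1 <= u -> exists2 c : R, 0 < c & forall f k, continuous f ->
  SW f k <= c * 2 `^ (- (k%:~R * (n%:R / u + a))) * SA a u f k.
Proof.
move=> u1; have u0 : 0 < u by exact: lt_le_trans u1.
have [c c0 H] := @AI_le_NA R m u 0 u1; exists c => // f k cf.
rewrite SWE; apply: (le_trans (H _ (@continuous_dil R m f k cf))); rewrite (NA_dil a)//.
by rewrite mul0r oppr0 powRr0 mulr1 addr0 mulrA.
Qed.

Lemma interp_scale (D e1 e2 x y theta : R) : 0 < D -> 0 <= e1 -> 0 <= e2 -> 0 <= x -> 0 <= y ->
  (D * e1 * x) `^ theta * (D * e2 * y) `^ (1 - theta) =
  D * (e1 `^ theta * e2 `^ (1 - theta)) * (x `^ theta * y `^ (1 - theta)).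
Proof.
move=> D0 e10 e20 x0 y0.
have DE : D = D `^ theta * D `^ (1 - theta).
  by rewrite -powRD ?(gt_eqF D0) ?implybT// addrC subrK powRr1// ltW.
rewrite (powRM _ (mulr_ge0 (ltW D0) e10) x0) (powRM _ (mulr_ge0 (ltW D0) e20) y0).
rewrite {3}DE (powRM _ (ltW D0) e10) (powRM _ (ltW D0) e20).
move: (D `^ theta) (D `^ (1 - theta)) (e1 `^ theta) (e2 `^ (1 - theta)) (x `^ theta) (y `^ (1 - theta)).
by clear => a b c d e f; ring.
Qed.

(** [gn_annulus] for the dilate of index [k], multiplied by the weight of the left side. By the
    scaling relation the powers of 2 in the product term cancel, and only the L^1 term keeps one. *)
Lemma SA_local (p u q theta a1 a2 a3 s1 : R) : 1 <= p -> 1 <= u -> 0 < q ->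
  0 <= theta <= 1 -> s1 <= p^-1 -> p^-1 <= s1 + n%:R^-1 ->
  q^-1 = theta * s1 + (1 - theta) / u ->
  n%:R / q + a1 = theta * (n%:R / p + a2 - 1) + (1 - theta) * (n%:R / u + a3) ->
  exists2 c : R, 0 < c & forall f k, C1 f ->
    SA a1 q f k <= c * (
      (SA a2 p (grad_norm f) (k - 1) + SA a2 p (grad_norm f) k +
       SA a2 p (grad_norm f) (k + 1)) `^ theta *
      (SA a3 u f (k - 1) + SA a3 u f k + SA a3 u f (k + 1)) `^ (1 - theta) +
      2 `^ (k%:~R * (n%:R / q + a1)) * (SW f (k - 1) + SW f k + SW f (k + 1))).
Proof.
move=> p1 u1 q0 th s1p ps1 qE gE; have /andP[t0 t1] := th.
have t1' : 0 <= 1 - theta by rewrite subr_ge0.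
have p0 : 0 < p by exact: lt_le_trans p1.
have u0 : 0 < u by exact: lt_le_trans u1.
have jm : `|(-1)%:~R| <= 1 :> R by rewrite normrN1.
have j0 : `|0%:~R| <= 1 :> R by rewrite normr0.
have j1 : `|1%:~R| <= 1 :> R by rewrite normr1.
have [K K0 HK] := @gn_annulus R m p u q theta s1 p1 u1 q0 th s1p ps1 qE.
(* One constant for both norms: 4 from the root of a sum of three terms, the powers from replacing
   the weight of index [k - 1] or [k + 1] by that of [k]. *)
have [D DE D0] : exists2 D : R, D = 4 * (2 `^ `|a2| * 2 `^ `|a3|) & 0 < D.
  by exists (4 * (2 `^ `|a2| * 2 `^ `|a3|)) => //; rewrite !mulr_gt0 ?powR_gt0.
have pow1 (a : R) : 1 <= 2 `^ `|a| :> R by rewrite -[leLHS](powRr0 2) ler_powR ?ler1n.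
have D2 : 4 * 2 `^ `|a2| <= D.
  by rewrite DE ler_pM2l// ler_peMr// powR_ge0.
have D3 : 4 * 2 `^ `|a3| <= D.
  by rewrite DE ler_pM2l// ler_peMl// powR_ge0.
have N0 : 0 < 2 `^ n%:R :> R by exact: powR_gt0.
exists (K * (D + 2 `^ n%:R)); first by rewrite mulr_gt0// addr_gt0.
move=> f k C1f; have cf := C1_continuous C1f.
have cfk := @continuous_dil R m f k cf; have cg := cnn_dgrad k C1f.
have l0 : 0 <= 2 `^ k%:~R :> R by exact: powR_ge0.
have := HK _ _ cfk cg (DG_dil l0 (C1_DG C1f)).
rewrite -(NAE q (dil f k) 0) (NA_dil a1)// mul0r oppr0 powRr0 mulr1 addr0 => H.
have e0 : 0 <= 2 `^ (k%:~R * (n%:R / q + a1)) :> R by exact: powR_ge0.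
have := ler_wpM2l e0 H; rewrite mulrA -pow2D subrr powRr0 mul1r => /le_trans; apply.
rewrite mulrCA -[leRHS]mulrA ler_pM2l//.
set GG := SA a2 _ _ _ + _ + _; set AA := SA a3 _ _ _ + _ + _; set WW := SW _ _ + _ + _.
have GG0 : 0 <= GG by rewrite !addr_ge0// SA_ge0.
have AA0 : 0 <= AA by rewrite !addr_ge0// SA_ge0.
have WW0 : 0 <= WW by rewrite !addr_ge0// SW_ge0.
pose eG : R := 2 `^ (- (k%:~R * (n%:R / p + a2 - 1))).
pose eA : R := 2 `^ (- (k%:~R * (n%:R / u + a3))).
have sum3 (x y z x' y' z' c d : R) : x <= c * d * x' -> y <= c * d * y' -> z <= c * d * z' ->
    4 * (x + y + z) <= 4 * d * c * (x' + y' + z').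
  by move=> hx hy hz; rewrite -!mulrA ler_pM2l// mulrCA mulrA !mulrDr !lerD// [d * c]mulrC.
have AX : AS (fun x => dgrad f k x `^ p) `^ p^-1 <= D * eG * GG.
  have E : (fun x => dgrad f k x `^ p) = (fun x => `|dgrad f k x| `^ p).
    by apply/funext => x; rewrite ger0_norm//; case: cg.
  rewrite E; apply: (le_trans (AS_root p1 cg.1)).
  have := sum3 _ _ _ _ _ _ _ _ (NA_dgrad_le a2 k p0 C1f jm) (NA_dgrad_le a2 k p0 C1f j0)
    (NA_dgrad_le a2 k p0 C1f j1).
  rewrite addr0 -/GG -/eG => /le_trans; apply.
  by rewrite ler_wpM2r// ler_wpM2r ?powR_ge0.
have AY : AS (fun x => `|dil f k x| `^ u) `^ u^-1 <= D * eA * AA.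
  apply: (le_trans (AS_root u1 cfk)).
  have := sum3 _ _ _ _ _ _ _ _ (NA_dil_le a3 k u0 cf jm) (NA_dil_le a3 k u0 cf j0)
    (NA_dil_le a3 k u0 cf j1).
  rewrite addr0 -/AA -/eA => /le_trans; apply.
  by rewrite ler_wpM2r// ler_wpM2r ?powR_ge0.
have AW : AS (fun x => `|dil f k x|) <= 2 `^ n%:R * WW.
  rewrite /AS /WW !mulrDr; apply: lerD; first apply: lerD.
  - exact: AI_dil_SW cf jm.
  - by have := @AI_dil_SW R m f k 0 cf j0; rewrite addr0.
  - exact: AI_dil_SW cf j1.
have XY : (AS (fun x => dgrad f k x `^ p) `^ p^-1) `^ theta *
    (AS (fun x => `|dil f k x| `^ u) `^ u^-1) `^ (1 - theta) <=
    D * 2 `^ (- (k%:~R * (n%:R / q + a1))) * (GG `^ theta * AA `^ (1 - theta)).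
  have eGA : eG `^ theta * eA `^ (1 - theta) = 2 `^ (- (k%:~R * (n%:R / q + a1))).
    by rewrite /eG /eA -!(powRrM 2) -pow2D gE; congr (2 `^ _); ring.
  rewrite -eGA -interp_scale ?powR_ge0//.
  apply: ler_pM; [exact: powR_ge0|exact: powR_ge0| |].
    exact: (powR_le t0 (powR_ge0 _ _) AX).
  exact: (powR_le t1' (powR_ge0 _ _) AY).
have {}XY := ler_wpM2l e0 (lerD XY AW); apply: (le_trans XY).
have E1 : 2 `^ (k%:~R * (n%:R / q + a1)) * 2 `^ (- (k%:~R * (n%:R / q + a1))) = 1 :> R.
  by rewrite -pow2D subrr powRr0.
have Z0 : 0 <= GG `^ theta * AA `^ (1 - theta) by rewrite mulr_ge0 ?powR_ge0.
move: (GG `^ theta * AA `^ (1 - theta)) Z0 E1 => Z Z0.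
move: (2 `^ (k%:~R * (n%:R / q + a1))) (2 `^ (- (k%:~R * (n%:R / q + a1)))) e0 => x y x0 E1.
move: (2 `^ n%:R) N0 WW WW0 D D0 {DE D2 D3 AX AY AW XY} => N N0 W W0 D D0.
have xw := mulr_ge0 x0 W0; have N0' := ltW N0; have D0' := ltW D0.
have -> : x * (D * y * Z + N * W) = D * ((x * y) * Z) + N * (x * W) by ring.
rewrite E1 mul1r mulrDl !mulrDr; have := mulr_ge0 N0' Z0; have := mulr_ge0 D0' xw.
by move: (D * Z) (N * (x * W)) (D * (x * W)) (N * Z); clear => a b c d; lra.
Qed.

End LocalSystem.

(** * Herz norms: exponents and conclusion *)

Section HerzInequality.
Variable R : realType.

(** The only point has norm 0 and lies in no annulus. *)
Lemma herz_dim0 (a p q : R) (f : 'rV[R]_0 -> R) : p != 0 -> q != 0 -> herz a p q f = 0%E.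
Proof.
move=> p0 q0; rewrite /herz esum1 ?poweR0r ?invr_eq0// => k _.
rewrite /Lp_annulus /= ifF; last first.
  by rewrite /annulus /enorm big_ord0 sqrtr0 leNgt powR_gt0.
by rewrite !poweR0r ?invr_eq0// mule0.
Qed.

Lemma isum_bounded (x : int -> R) (v : R) : 0 < v -> (forall k, 0 <= x k) ->
  (isum (fun k => x k `^ v)%R < +oo)%E -> exists B : R, forall k, x k <= B.
Proof.
move=> v0 x0; have := isum_term (fun k => x k `^ v).
have := @isum_ge0 R (fun k => x k `^ v) (fun k => powR_ge0 _ _).
move: (isum _) => [t| |]// t0 H _; exists (t `^ v^-1) => k.
have vV : 0 <= v^-1 by rewrite invr_ge0 ltW.
have := H k; rewrite lee_fin => /(powR_le vV (powR_ge0 _ _)).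
by rewrite powRK ?gt_eqF.
Qed.

(** Subtracting the relation for [alpha1] from the scaling relation eliminates [alpha1] and
    [alpha3]; dividing by [N] leaves the exponent relation of the cube inequality, with [s1] made
    explicit. *)
Lemma smoothness_exponent (N p u q theta a1 a2 a3 sigma : R) : 0 < N ->
  a1 = theta * sigma + (1 - theta) * a3 ->
  N / q + a1 = theta * (N / p + a2 - 1) + (N / u + a3) * (1 - theta) ->
  q^-1 = theta * (p^-1 + (a2 - sigma - 1) / N) + (1 - theta) / u.
Proof.
move=> N0 e1 e2; have Nn : N != 0 by rewrite gt_eqF.
apply: (mulfI Nn).
have -> : N * (theta * (p^-1 + (a2 - sigma - 1) / N) + (1 - theta) / u) =
   theta * (N / p + a2 - 1) + (N / u + a3) * (1 - theta) - (theta * sigma + (1 - theta) * a3).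
  by move: (p^-1) (u^-1) => P U; field.
by rewrite -e2 -e1 addrK.
Qed.

Lemma herz_interpolation m (p u q r v s theta a1 a2 a3 sigma : R) :
  1 <= p -> 1 <= u -> 0 < q -> 0 < r -> 0 < v -> 0 < s -> 0 <= theta <= 1 ->
  0 < m.+1%:R / u + a3 -> 0 < m.+1%:R / q + a1 ->
  sigma <= a2 <= sigma + 1 ->
  a1 = theta * sigma + (1 - theta) * a3 ->
  m.+1%:R / q + a1 = theta * (m.+1%:R / p + a2 - 1) + (m.+1%:R / u + a3) * (1 - theta) ->
  r^-1 = theta / s + (1 - theta) / v ->
  exists2 c : R, 0 < c & forall f : 'rV[R]_m.+1 -> R, C1 f ->
    (herz a3 u v f < +oo)%E ->
    (herz a1 q r f <= c%:E * herz a2 p s (grad_norm f) `^ theta * herz a3 u v f `^ (1 - theta))%E.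
Proof.
move=> p1 u1 q0 r0 v0 s0 th b0 g0 /andP[sg1 sg2] e1 e2 rE.
have N0 : 0 < m.+1%:R :> R by rewrite ltr0n.
have p0 : 0 < p by exact: lt_le_trans p1.
have u0 : 0 < u by exact: lt_le_trans u1.
have qE := smoothness_exponent N0 e1 e2.
have gE : m.+1%:R / q + a1 = theta * (m.+1%:R / p + a2 - 1) + (1 - theta) * (m.+1%:R / u + a3).
  by rewrite e2 [(_ + a3) * _]mulrC.
(* The two bounds on [sigma] are the two ends of the Sobolev range for [s1]. *)
have s1p : p^-1 + (a2 - sigma - 1) / m.+1%:R <= p^-1.
  by rewrite gerDl pmulr_lle0 ?invr_gt0//; clear -sg2; lra.
have ps1 : p^-1 <= p^-1 + (a2 - sigma - 1) / m.+1%:R + m.+1%:R^-1.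
  rewrite -addrA lerDl -[X in _ + X]mul1r -mulrDl pmulr_lge0 ?invr_gt0//.
  by clear -sg1; lra.
have [k1 k10 H1] := @SW_step R m p a2 p1.
have [k2 k20 H2] := @SW_le R m u a3 u1.
have [k3 k30 H3] := @SA_local R m p u q theta a1 a2 a3 _ p1 u1 q0 th s1p ps1 qE gE.
have [C [C0 k1C k2C k3C]] : exists C : R, [/\ 0 < C, k1 <= C, k2 <= C & k3 <= C].
  by exists (k1 + k2 + k3); clear -k10 k20 k30; split; lra.
have [K K0 HK] := discrete_gn C0 s0 v0 r0 th rE gE g0 b0.
exists (K `^ r^-1); first exact: powR_gt0.
move=> f C1f fin; have cf := C1_continuous C1f; have cg := (cnn_grad_norm C1f).1.
move: fin; rewrite !herzE ?(ltW u0) ?(ltW q0) ?(ltW p0)//.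
have rV : 0 <= r^-1 by rewrite invr_ge0 ltW.
have vV : v^-1 != 0 by rewrite invr_eq0 gt_eqF.
move=> /(lty_poweRy vV) /(isum_bounded v0 (SA_ge0 a3 u f)) [B AB].
have := HK (SA a1 q f) (SW f) (SA a2 p (grad_norm f)) (SA a3 u f) B
  (SA_ge0 _ _ _) (fun k => SW_ge0 k cf) (SA_ge0 _ _ _) (SA_ge0 _ _ _) AB.
have A1 k : SW f k <= SW f (k + 1) + C * 2 `^ (- (k%:~R * (m.+1%:R / p + a2 - 1))) *
    (SA a2 p (grad_norm f) k + SA a2 p (grad_norm f) (k + 1)).
  apply: (le_trans (H1 f k C1f)); rewrite lerD2l.
  by rewrite ler_wpM2r ?addr_ge0 ?SA_ge0// ler_wpM2r// powR_ge0.
have A2 k : SW f k <= C * 2 `^ (- (k%:~R * (m.+1%:R / u + a3))) * SA a3 u f k.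
  apply: (le_trans (H2 f k cf)).
  by rewrite ler_wpM2r ?SA_ge0// ler_wpM2r// powR_ge0.
move=> /(_ A1 A2) H.
have iG := isum_ge0 (fun k => powR_ge0 (SA a2 p (grad_norm f) k) s).
have iA := isum_ge0 (fun k => powR_ge0 (SA a3 u f k) v).
have iM := isum_ge0 (fun k => powR_ge0 (SA a1 q f k) r).
have KE : (0 <= K%:E)%E by rewrite lee_fin ltW.
apply: (@le_trans _ _ ((K%:E * (isum (fun k => SA a2 p (grad_norm f) k `^ s)%R `^ (theta * r / s) *
    isum (fun k => SA a3 u f k `^ v)%R `^ ((1 - theta) * r / v))) `^ r^-1)%E).
  apply: gt0_ler_poweR => //.
  - by rewrite in_itv/= iM leey.
  - by rewrite in_itv/= leey andbT !mule_ge0// poweR_ge0.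
  - apply: H => k; apply: (le_trans (H3 f k C1f)); apply: ler_wpM2r k3C.
    apply: addr_ge0; apply: mulr_ge0; rewrite ?powR_ge0//.
    by rewrite !addr_ge0// SW_ge0.
rewrite (poweRM _ KE (mule_ge0 (poweR_ge0 _ _) (poweR_ge0 _ _))).
rewrite (poweRM _ (poweR_ge0 _ _) (poweR_ge0 _ _)) poweR_EFin -!poweRrM muleA.
have E (c e : R) : c * r / e / r = e^-1 * c.
  by move: (e^-1) => x; field; exact: lt0r_neq0.
by rewrite !E.
Qed.

End HerzInequality.

Theorem theorem2p14 (R : realType) (n : nat)
  (p u q r v s theta alpha1 alpha2 alpha3 sigma : R) :
  1 <= p -> 1 <= u -> 0 < q -> 0 < r -> 0 < v -> 0 < s ->
  0 <= theta <= 1 ->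
  0 < n%:R / p + alpha2 ->
  0 < n%:R / u + alpha3 ->
  0 < n%:R / q + alpha1 ->
  sigma <= alpha2 <= sigma + 1 ->
  alpha1 = theta * sigma + (1 - theta) * alpha3 ->
  n%:R / q + alpha1
    = theta * (n%:R / p + alpha2 - 1) + (n%:R / u + alpha3) * (1 - theta) ->
  r^-1 = theta / s + (1 - theta) / v ->
  exists c : R, 0 < c /\
    forall f : 'rV[R]_n -> R, C1 f ->
      (herz alpha3 u v f < +oo)%E ->
      (herz alpha1 q r f
        <= c%:E * (herz alpha2 p s (grad_norm f)) `^ theta
                * (herz alpha3 u v f) `^ (1 - theta))%E.
Proof.
(* In dimension 0 the left side vanishes and any positive constant will do. *)
case: n => [|m] p1 u1 q0 r0 v0 s0 th _ b0 g0 sg e1 e2 rE.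
  exists 1; split=> // f _ _; rewrite herz_dim0 ?gt_eqF//.
  by rewrite !mule_ge0// ?poweR_ge0.
have [c c0 H] := herz_interpolation p1 u1 q0 r0 v0 s0 th b0 g0 sg e1 e2 rE.
by exists c; split.
Qed.
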